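(* Suppose that the following assumptions hold, where $G(h)=\mathbb{E}[g(X,h)]$, $\theta$ is the unique zero of $\nabla G$ and $H=\nabla^2G(\theta)$. (i) $G$ is twice continuously differentiable, $H$ is positive definite, and there is $L_{\nabla G}>0$ such that $\|\nabla^2G(h)\|_{op}\le L_{\nabla G}$ for all $h\in\mathbb{R}^d$. (ii) There exist $r>0$ and $L_r>0$ such that $\|\nabla^2G(h)-\nabla^2G(\theta)\|_{op}\le L_r\|\theta-h\|$ for all $h\in\mathcal{B}(\theta,r)$. (iii) There exist $q>2$ and $C_q$ such that $\mathbb{E}\left[\|\nabla_h^2g(X,h)\|_F^q\right]\le C_q$ for all $h\in\mathbb{R}^d$. Suppose also that $\frac{1-\gamma}{q-1}<\beta<\gamma-\frac12$, and that the estimates $\hat\theta_n$ of $\theta$ satisfy, for some $a>0$ and for all $\delta>0$, $$\|\hat\theta_n-\theta\|^2=o\left(\frac{(\ln n)^{1+\delta}}{n^a}\right)\quad\text{a.s.}$$ Then the estimates $A_n$ and $A_{n,\tau}$ (defined in the context, built from $\hat\theta_n$) satisfy, for all $\delta>0$, $$\|A_n-H^{-1}\|^2=o\left(\frac{(\ln n)^{1+\delta}}{n^{\min\{\gamma,a,2\beta(q-1)\}}}\right)\ \text{a.s.}\quad\text{and}\quad \|A_{n,\tau}-H^{-1}\|^2=o\left(\frac{(\ln n)^{1+\delta}}{n^{\min\{1,a,2\beta(q-1)\}}}\right)\ \text{a.s.}$$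
   Context: Setting. $X$ is a random vector of $\mathbb{R}^p$ and $g:\mathbb{R}^p\times\mathbb{R}^d\to\mathbb{R}$ is such that $g(X,\cdot)$ is convex. For every $h\in\mathbb{R}^d$ there is $\Omega_h\subseteq\mathbb{R}^p$ with $\mathbb{P}[X\in\Omega_h]=1$ such that for all $x\in\Omega_h$, $g(x,\cdot)$ is twice differentiable at $h$; $\nabla_hg$ and $\nabla_h^2g$ denote the gradient and Hessian in the second variable. $G:\mathbb{R}^d\to\mathbb{R}$, $G(h)=\mathbb{E}[g(X,h)]$, is convex, with $\nabla G(h)=\mathbb{E}[\nabla_hg(X,h)]$ and $\nabla^2G(h)=\mathbb{E}[\nabla_h^2g(X,h)]$, and there is a unique $\theta\in\mathbb{R}^d$ with $\nabla G(\theta)=0$. Norms. $\|\cdot\|$ is the Euclidean norm for vectors, $\|\cdot\|_{op}$ and $\|\cdot\|_F$ are the spectral and Frobenius norms of matrices (for $d\times d$ matrices $\|\cdot\|$ may be taken to be either of these). $\mathcal{B}(\theta,r)$ is the ball of radius $r$ centered at $\theta$. Data. $(X_n)_{n\ge1}$ are i.i.d. copies of $X$. $(Z_n)_{n\ge1}$ are i.i.d. random vectors of $\mathbb{R}^d$, independent of $(X_n)$, bounded ($\|Z_n\|\le M$ for a constant $M$), with $\mathbb{E}[Z_n]=0$ and $\mathbb{E}[Z_nZ_n^T]=I_d$. $\mathcal{F}_n=\sigma(X_1,\dots,X_n,Z_1,\dots,Z_n)$, and $(\hat\theta_n)_{n\ge0}$ is a sequence of $\mathbb{R}^d$-valued estimates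 with $\hat\theta_n$ being $\mathcal{F}_n$-measurable. Parameters. $\gamma_n=c_\gamma n^{-\gamma}$ with $c_\gamma>0$, $\frac12<\gamma<1$; $\beta_n=c_\beta n^\beta$ with $c_\beta>0$ and $\gamma_n\beta_n\le\frac12$ for all $n\ge1$; $\beta_n'=c_\beta'n^{\beta'}$ with $c'_\beta>0$, $\beta'\in(1-\gamma,\gamma-2\beta)$ and $\gamma_n^2\beta_n^2\beta_n'\le\gamma_n$ for all $n\ge1$; $\tau\ge0$. Estimates. $\Pi_{\beta_n'}$ denotes the projection (for the Frobenius norm) onto the ball of $d\times d$ matrices of Frobenius norm at most $\beta_n'$ centered at $0$. $A_0$ is an arbitrary symmetric positive definite matrix and, for $n\ge1$, $$P_n=A_{n-1}Z_n,\qquad Q_n=\nabla_h^2g(X_n,\hat\theta_{n-1})Z_n,$$ $$A_n=\Pi_{\beta_n'}\left(A_{n-1}-\gamma_n\left(P_nQ_n^T+Q_nP_n^T-2I_d\right)\mathbf{1}_{\{\|Q_n\|\|Z_n\|\le\beta_n\}}\right),$$ $$A_{n,\tau}=\left(1-\frac{(\ln(n+1))^\tau}{\sum_{k=0}^n(\ln(k+1))^\tau}\right)A_{n-1,\tau}+\frac{(\ln(n+1))^\tau}{\sum_{k=0}^n(\ln(k+1))^\tau}A_n,\qquad A_{0,\tau}=A_0$$ (with $0^0=1$). *)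

(* Defs.v *)
From HB Require Import structures.
From mathcomp Require Import all_boot all_order all_algebra finmap.
From mathcomp Require Import all_classical all_reals all_analysis.

Set Implicit Arguments.
Unset Strict Implicit.
Unset Printing Implicit Defensive.

Import Order.TTheory GRing.Theory Num.Theory.
Import numFieldNormedType.Exports.

Local Open Scope classical_set_scope.
Local Open Scope ring_scope.

(* Matrices (in particular column vectors) over a measurable type carry the
   product sigma-algebra, generated by the coordinates; over R : realType this
   is the Borel sigma-algebra of R^(m * n). *)
Section measurable_matrix.
Context {d : measure_display} (T : measurableType d) (m n : nat).

Definition mx_coordinates : set (set 'M[T]_(m, n)) :=
  \bigcup_(ij in [set: 'I_m * 'I_n])
    preimage_set_system setT (fun M : 'M[T]_(m, n) => M ij.1 ij.2) measurable.

Definition measure_matrix_display : measure_display -> measure_display.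
Proof. exact. Qed.

HB.instance Definition _ := @isMeasurable.Build (measure_matrix_display d)
  'M[T]_(m, n) <<s mx_coordinates >>
  (@sigma_algebra0 _ setT mx_coordinates)
  (@sigma_algebraC _ mx_coordinates)
  (@sigma_algebra_bigcup _ setT mx_coordinates).

End measurable_matrix.

Section norms.
Context {R : realType}.

(* The normed-module norm `|M| of the library is the sup norm. On column
   vectors [normF] is the Euclidean norm. *)
Definition normF m n (M : 'M[R]_(m, n)) : R :=
  Num.sqrt (\sum_i \sum_j M i j ^+ 2).

Definition normop m n (M : 'M[R]_(m, n)) : R :=
  sup [set normF (M *m x) | x in [set x : 'cV[R]_n | normF x <= 1]].

Definition posdef n (M : 'M[R]_n) : Prop :=
  M^T = M /\ forall x : 'cV[R]_n, x != 0 -> 0 < (x^T *m M *m x) 0 0.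

Definition is_projF m n (b : R) (M N : 'M[R]_(m, n)) : Prop :=
  normF N <= b /\
  forall N' : 'M[R]_(m, n), normF N' <= b -> normF (M - N) <= normF (M - N').

(* Total by choice; such an N exists and is unique as soon as 0 <= b. *)
Definition projF m n (b : R) (M : 'M[R]_(m, n)) : 'M[R]_(m, n) :=
  get (is_projF b M).

End norms.

Section second_order_calculus.
Context {R : realType} {d : nat}.
Implicit Types (f : 'cV[R]_d -> R^o) (h : 'cV[R]_d).

Definition gradient f h : 'cV[R]_d := \col_i 'D_(delta_mx i 0) f h.

(* The Jacobian matrix of the gradient. *)
Definition hessian f h : 'M[R]_d :=
  \matrix_(i, j) 'D_(delta_mx j 0) (fun u => gradient f u i 0 : R^o) h.

Definition twice_differentiable f h : Prop :=
  (\forall u \near h, differentiable f u) /\ differentiable (gradient f) h.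

End second_order_calculus.

Section probability_notions.
Context {d : measure_display} {T : measurableType d} {R : realType}.
Variable P : probability T R.

Definition same_law d' (E : measurableType d') (X Y : {RV P >-> E}) : Prop :=
  forall B, measurable B -> distribution P X B = distribution P Y B.

(* The families of events S i, for i in D, are mutually independent. *)
Definition mutually_independent (I : choiceType) (D : set I)
    (S : I -> set (set T)) : Prop :=
  forall J : {fset I}, [set` J] `<=` D ->
  forall E : I -> set T, (forall i, i \in J -> S i (E i)) ->
  P (\bigcap_(i in [set` J]) E i) = (\prod_(i <- J) P (E i))%E.

Definition independent2 (S1 S2 : set (set T)) : Prop :=
  forall A B, S1 A -> S2 B -> P (A `&` B) = (P A * P B)%E.

(* sigma(X_n, n >= 1) *)
Definition sigma_seq d' (E : measurableType d') (X : nat -> T -> E) :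
    set (set T) :=
  <<s \bigcup_(k in [set k | (1 <= k)%N]) g_sigma_algebra_preimage (X k) >>.

(* sigma(X_1, ..., X_n, Z_1, ..., Z_n) *)
Definition sigma_upto d1 d2 (E1 : measurableType d1) (E2 : measurableType d2)
    (X : nat -> T -> E1) (Z : nat -> T -> E2) (n : nat) : set (set T) :=
  <<s \bigcup_(k in [set k | (1 <= k <= n)%N])
        (g_sigma_algebra_preimage (X k) `|` g_sigma_algebra_preimage (Z k)) >>.

(* The sequence (X_n)_(n >= 1) is i.i.d. *)
Definition iid d' (E : measurableType d') (X : nat -> {RV P >-> E}) : Prop :=
  mutually_independent [set n | (1 <= n)%N]
    (fun n => g_sigma_algebra_preimage (X n)) /\
  forall n, (1 <= n)%N -> same_law (X n) (X 1%N).

Definition integrable_mx m n (M : T -> 'M[R]_(m, n)) : Prop :=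
  forall i j, P.-integrable setT (fun w => (M w i j)%:E).

Definition expectation_mx m n (M : T -> 'M[R]_(m, n)) : 'M[R]_(m, n) :=
  \matrix_(i, j) fine 'E_P[fun w => M w i j].

End probability_notions.

Section estimates.
Context {R : realType} {p d : nat}.

Definition power_seq (c e : R) (n : nat) : R := c * n%:R `^ e.

(* The estimates A_n, along one realization x, z, th of the sequences
   (X_n), (Z_n), (\hat\theta_n); the values x 0 and z 0 are not used. *)
Fixpoint inv_hessian_est (gam bet bet' : nat -> R)
    (hessg : 'cV[R]_p -> 'cV[R]_d -> 'M[R]_d) (A0 : 'M[R]_d)
    (x : nat -> 'cV[R]_p) (z th : nat -> 'cV[R]_d) (n : nat) : 'M[R]_d :=
  if n is k.+1 then
    let A := inv_hessian_est gam bet bet' hessg A0 x z th k in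
    let Pn := A *m z n in
    let Qn := hessg (x n) (th k) *m z n in
    projF (bet' n)
      (A - gam n *: ((normF Qn * normF (z n) <= bet n)%R%:R *:
                       (Pn *m Qn^T + Qn *m Pn^T - 2%:M)))
  else A0.

(* The library has 0 `^ 0 = 1. *)
Definition log_weight (tau : R) (n : nat) : R := ln n.+1%:R `^ tau.

Fixpoint weighted_average (tau : R) (A : nat -> 'M[R]_d) (n : nat) : 'M[R]_d :=
  if n is k.+1 then
    let c := log_weight tau n / \sum_(0 <= i < n.+1) log_weight tau i in
    (1 - c) *: weighted_average tau A k + c *: A n
  else A 0%N.

End estimates.

(* Main.v *)
(** Let B = hessg (X_n, h) Z_n Z_n^T. Discarding B when |B| > beta_n biases its mean,
    which is the Hessian of G at h, by O(beta_n^(1-q)) only, and with D_n = A_n - H^-1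
    the recursion reads
      D_n = D_(n-1) - gamma_n (D_(n-1) H + H D_(n-1)) + gamma_n (bias + noise),
    the projection being inactive along bounded trajectories.

    - The trajectories are almost surely bounded: outside the ball of radius 1 around
      H^-1 the mean increment points inwards, so that 1 + dist(A_n, ball)^2 is almost a
      supermartingale; the projection onto a ball does not increase this distance.
    - As gamma_n beta_n -> 0, exponential moments give a Bernstein inequality for the
      damped noise and for its plain sum; with the Borel-Cantelli lemma they are
      O(sqrt(ln n) n^(-gamma/2)) and O(sqrt(n ln n)).
    - The rest is pathwise. The Lyapunov operator contracts, so D_n is bounded by the
      damped noise plus the bias, which is governed by |thetah_n - theta| and
      beta_n^(1-q). Summing the recursion gives the faster rate for D_0 + ... + D_(n-1),
      which an Abel summation transfers to the weighted averages.
    Since delta is arbitrary, O-bounds for delta/2 suffice. *)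

Require Import Defs.
From HB Require Import structures.
From mathcomp Require Import all_boot all_order all_algebra finmap.
From mathcomp Require Import all_classical all_reals all_analysis.
From mathcomp Require Import measurable_realfun ring lra zify.

Set Implicit Arguments.
Unset Strict Implicit.
Unset Printing Implicit Defensive.

Import Order.TTheory GRing.Theory Num.Theory.
Import numFieldNormedType.Exports.

Local Open Scope classical_set_scope.
Local Open Scope ring_scope.

(** * The Frobenius inner product and the Lyapunov operator *)

Section frobenius.
Context {R : realType}.

(** The noise is multiplied by A_(n-1), for which only the growing bound beta'_(n-1) is known at the
    outset, so exponential inequalities cannot come first. Boundedness has to be obtained from
    second moments alone; since gamma > 1/2, the squared steps are summable and this suffices. The
    noise is then cut off at every natural level, and each trajectory selects the level that bounds
    it. The radius 1 has a reason: the bias multiplies A = D + H^-1, and only for |D| > 1 is this of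
    order |D|, so that the bias competes with the quadratic gain of coercivity. Inside the ball no
    drift is required. The estimates of theta are close to theta only from a random time on, so the
    energy is killed when they leave a neighbourhood, and the starting time runs over the naturals.
    Conditional expectations are replaced by Tonelli: the pair (X_n, Z_n) is independent of the
    past, which is frozen in the inner integral. The condition beta < gamma - 1/2 < gamma/2 makes
    the largest single noise term negligible against the fluctuation of the sum, with and without
    damping. *)

Definition dotF m n (A B : 'M[R]_(m, n)) : R := \sum_i \sum_j A i j * B i j.

Lemma dotFC m n (A B : 'M[R]_(m, n)) : dotF A B = dotF B A.
Proof. by do 2 apply: eq_bigr => ? _; rewrite mulrC. Qed.

Lemma dotFDl m n (A B C : 'M[R]_(m, n)) : dotF (A + B) C = dotF A C + dotF B C.
Proof.
rewrite -big_split; apply: eq_bigr => i _; rewrite -big_split.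
by apply: eq_bigr => j _; rewrite mxE mulrDl.
Qed.

Lemma dotFZl m n a (A C : 'M[R]_(m, n)) : dotF (a *: A) C = a * dotF A C.
Proof.
rewrite mulr_sumr; apply: eq_bigr => i _; rewrite mulr_sumr.
by apply: eq_bigr => j _; rewrite mxE mulrA.
Qed.

Lemma dotFNl m n (A C : 'M[R]_(m, n)) : dotF (- A) C = - dotF A C.
Proof. by rewrite -scaleN1r dotFZl mulN1r. Qed.

Lemma dotFBl m n (A B C : 'M[R]_(m, n)) : dotF (A - B) C = dotF A C - dotF B C.
Proof. by rewrite dotFDl dotFNl. Qed.

Lemma dotFDr m n (A B C : 'M[R]_(m, n)) : dotF C (A + B) = dotF C A + dotF C B.
Proof. by rewrite dotFC dotFDl !(dotFC C). Qed.

Lemma dotFZr m n a (A C : 'M[R]_(m, n)) : dotF C (a *: A) = a * dotF C A.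
Proof. by rewrite dotFC dotFZl (dotFC C). Qed.

Lemma dotFNr m n (A C : 'M[R]_(m, n)) : dotF C (- A) = - dotF C A.
Proof. by rewrite dotFC dotFNl (dotFC C). Qed.

Lemma dotFBr m n (A B C : 'M[R]_(m, n)) : dotF C (A - B) = dotF C A - dotF C B.
Proof. by rewrite dotFDr dotFNr. Qed.

Lemma dotF_ge0 m n (A : 'M[R]_(m, n)) : 0 <= dotF A A.
Proof. by do 2 apply: sumr_ge0 => ? _; rewrite -expr2 sqr_ge0. Qed.

Lemma normFE m n (A : 'M[R]_(m, n)) : normF A = Num.sqrt (dotF A A).
Proof. by congr Num.sqrt; do 2 apply: eq_bigr => ? _; rewrite expr2. Qed.

Lemma normF_ge0 m n (A : 'M[R]_(m, n)) : 0 <= normF A.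
Proof. exact: sqrtr_ge0. Qed.

Lemma normF_sqr m n (A : 'M[R]_(m, n)) : normF A ^+ 2 = dotF A A.
Proof. by rewrite normFE sqr_sqrtr // dotF_ge0. Qed.

Lemma normF0 m n : normF (0 : 'M[R]_(m, n)) = 0.
Proof. by rewrite normFE -(scale0r 0) dotFZl mul0r sqrtr0. Qed.

Lemma normFZ m n a (A : 'M[R]_(m, n)) : normF (a *: A) = `|a| * normF A.
Proof.
by rewrite !normFE dotFZl dotFZr mulrA -expr2 sqrtrM ?sqr_ge0// sqrtr_sqr.
Qed.

Lemma normFN m n (A : 'M[R]_(m, n)) : normF (- A) = normF A.
Proof. by rewrite -scaleN1r normFZ normrN1 mul1r. Qed.

Lemma normFB m n (A B : 'M[R]_(m, n)) : normF (A - B) = normF (B - A).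
Proof. by rewrite -normFN opprB. Qed.

(** Cauchy-Schwarz. The square of [normF B *: A - normF A *: B] gives the bound up to a factor
    [normF A * normF B], so the degenerate cases use other squares: an affine function of [t] if
    [normF B] vanishes, and [dotF A B *: B - normF B ^+ 2 *: A] if [normF A] does. *)
Lemma dotF_le m n (A B : 'M[R]_(m, n)) : dotF A B <= normF A * normF B.
Proof.
have nA := normF_ge0 A; have nB := normF_ge0 B.
have [B0|B0] := eqVneq (normF B) 0.
  have h t : 0 <= normF A ^+ 2 + 2 * t * dotF A B.
    have := dotF_ge0 (A + t *: B).
    rewrite !(dotFDl, dotFDr, dotFZl, dotFZr) -!normF_sqr B0 (dotFC B A).
    by rewrite expr0n /= !mulr0 addr0 -addrA; congr (_ <= _ + _); ring.
  rewrite B0 mulr0.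
  have [->//|d0] := eqVneq (dotF A B) 0.
  (* At this [t] the affine function, which must be nonnegative, equals -1. *)
  have := h (- (normF A ^+ 2 + 1) / (2 * dotF A B)).
  have -> : 2 * (- (normF A ^+ 2 + 1) / (2 * dotF A B)) * dotF A B =
     - (normF A ^+ 2 + 1) by field.
  lra.
have B1 : 0 < normF B by rewrite lt_def B0.
have := dotF_ge0 (normF B *: A - normF A *: B).
rewrite !(dotFBl, dotFBr, dotFZl, dotFZr) -!normF_sqr (dotFC B A).
have [A0|A0] := eqVneq (normF A) 0.
  have := dotF_ge0 (dotF A B *: B - normF B ^+ 2 *: A).
  rewrite !(dotFBl, dotFBr, dotFZl, dotFZr) -!normF_sqr (dotFC B A) A0.
  rewrite expr0n /= !mulr0 subr0 mul0r => h _.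
  have {}h : 0 <= - (dotF A B ^+ 2 * normF B ^+ 2) by move: h; congr (_ <= _); ring.
  have : dotF A B ^+ 2 <= 0.
    by rewrite -(pmulr_lle0 _ (exprn_gt0 2 B1)); lra.
  have h1 := sqr_ge0 (dotF A B) => h2.
  have /eqP : dotF A B ^+ 2 = 0 by apply/le_anti; rewrite h1 h2.
  by rewrite sqrf_eq0 => /eqP ->; rewrite mulr_ge0.
have A1 : 0 < normF A by rewrite lt_def A0.
move=> h.
have {}h : 0 <= 2 * (normF A * normF B) * (normF A * normF B - dotF A B).
  by move: h; congr (_ <= _); ring.
by move: h; rewrite pmulr_rge0 ?subr_ge0// !mulr_gt0.
Qed.

Lemma dotF_abs m n (A B : 'M[R]_(m, n)) : `|dotF A B| <= normF A * normF B.
Proof.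
by rewrite ler_norml dotF_le andbT lerNl -dotFNl -(normFN A) dotF_le.
Qed.

Lemma normF_triangle m n (A B : 'M[R]_(m, n)) :
  normF (A + B) <= normF A + normF B.
Proof.
rewrite -(@ler_pXn2r _ 2) ?nnegrE ?addr_ge0 ?normF_ge0//.
rewrite normF_sqr dotFDl !dotFDr -!normF_sqr (dotFC B).
have := dotF_le A B; nra.
Qed.

Lemma normFD m n (A B : 'M[R]_(m, n)) a b : normF A <= a -> normF B <= b ->
  normF (A + B) <= a + b.
Proof. by move=> ha hb; apply: le_trans (normF_triangle _ _) (lerD ha hb). Qed.

Lemma normF_sum m n I (r : seq I) (Q : pred I) (F : I -> 'M[R]_(m, n)) :
  normF (\sum_(i <- r | Q i) F i) <= \sum_(i <- r | Q i) normF (F i).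
Proof.
apply: (big_ind2 (fun A x => normF A <= x)) => // [|? ? ? ?].
  by rewrite normF0.
exact: normFD.
Qed.

Lemma normF_triangleB m n (A B : 'M[R]_(m, n)) :
  normF (A - B) <= normF A + normF B.
Proof. by rewrite -(normFN B) normF_triangle. Qed.

Lemma normF_coord m n (A : 'M[R]_(m, n)) i j : `|A i j| <= normF A.
Proof.
rewrite -(@ler_pXn2r _ 2) ?nnegrE ?normF_ge0// normF_sqr.
rewrite real_normK ?num_real//.
rewrite /dotF (bigD1 i)//= (bigD1 j)//= -expr2 -addrA lerDl.
have nn x : 0 <= x * x :> R by rewrite -expr2 sqr_ge0.
by rewrite addr_ge0// sumr_ge0// => k _; rewrite sumr_ge0.
Qed.

Lemma normF_le_entries m n (A : 'M[R]_(m, n)) c :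
  (forall i j, `|A i j| <= c) -> normF A <= (m * n)%:R * c.
Proof.
move=> h.
suff : normF A <= \sum_(i < m) \sum_(j < n) `|A i j|.
  move/le_trans; apply.
  apply: (@le_trans _ _ (\sum_(i < m) \sum_(j < n) c)).
    by do 2 apply: ler_sum => ? _.
  by rewrite !sumr_const !card_ord -!mulrnA mulr_natl mulnC.
have -> : A = \sum_i \sum_j A i j *: delta_mx i j by exact: matrix_sum_delta.
apply: le_trans (normF_sum _ _ _) _; apply: ler_sum => i _.
apply: le_trans (normF_sum _ _ _) _; apply: ler_sum => j _.
rewrite -matrix_sum_delta normFZ.
rewrite normFE /dotF (bigD1 i)//= (bigD1 j)//= !big1 ?addr0.
- by rewrite mxE !eqxx mulr1 sqrtr1 mulr1.
- by move=> k /negPf ki; rewrite big1// => l _; rewrite mxE ki mulr0.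
- by move=> k /negPf kj; rewrite mxE kj andbF mulr0.
Qed.

Lemma dotF_mulmx_col m n (A B : 'M[R]_(m, n)) :
  dotF A B = \sum_j (\sum_i A i j * B i j).
Proof. by rewrite /dotF exchange_big. Qed.

Lemma normF_tr m n (A : 'M[R]_(m, n)) : normF A^T = normF A.
Proof.
rewrite !normFE /dotF exchange_big; congr Num.sqrt.
by do 2 apply: eq_bigr => ? _; rewrite !mxE.
Qed.

Lemma normF_mul m n k (A : 'M[R]_(m, n)) (B : 'M[R]_(n, k)) :
  normF (A *m B) <= normF A * normF B.
Proof.
rewrite -(@ler_pXn2r _ 2) ?nnegrE ?mulr_ge0 ?normF_ge0// exprMn.
rewrite -(normF_tr B) !normF_sqr /dotF mulr_suml; apply: ler_sum => i _.
rewrite mulr_sumr; apply: ler_sum => j _.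
have -> : (A *m B) i j = dotF (row i A) (row j B^T).
  by rewrite mxE /dotF big_ord1; apply: eq_bigr => l _; rewrite ?mxE.
rewrite -expr2.
have -> : \sum_j0 A i j0 * A i j0 = normF (row i A) ^+ 2.
  by rewrite normF_sqr /dotF big_ord1; apply: eq_bigr => l _; rewrite !mxE.
have -> : \sum_j0 B^T j j0 * B^T j j0 = normF (row j B^T) ^+ 2.
  by rewrite normF_sqr /dotF big_ord1; apply: eq_bigr => l _; rewrite !mxE.
rewrite -exprMn -[X in X <= _]real_normK ?num_real//.
by rewrite ler_pXn2r ?nnegrE ?mulr_ge0 ?normF_ge0// dotF_abs.
Qed.

Lemma normF_col_row n (x y : 'cV[R]_n) : normF (x *m y^T) = normF x * normF y.
Proof.
rewrite !normFE -sqrtrM ?dotF_ge0//; congr Num.sqrt.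
rewrite /dotF mulr_suml; apply: eq_bigr => i _; rewrite big_ord1 mulr_sumr.
by apply: eq_bigr => j _; rewrite !mxE !big_ord1 !mxE; ring.
Qed.

Lemma normF_scalar n (a : R) : normF (a%:M : 'M[R]_n) <= (n * n)%:R * `|a|.
Proof.
apply: normF_le_entries => i j; rewrite mxE.
by case: (i == j); rewrite ?mulr1n ?mulr0n ?normr0.
Qed.

Lemma normF_eq0 m n (A : 'M[R]_(m, n)) : normF A = 0 -> A = 0.
Proof.
move=> A0; apply/matrixP => i j; rewrite mxE; apply/eqP.
by rewrite -normr_le0 -A0 normF_coord.
Qed.

End frobenius.

(** * Projection onto a Frobenius ball *)

Section projection.
Context {R : realType} {m n : nat}.
Implicit Types (A C : 'M[R]_(m, n)) (b : R).

Definition clipF b A := if normF A <= b then A else (b / normF A) *: A.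

(** With [t = b / normF A], the right side minus the left side is [2 * (1 - t) * (t * normF A ^+ 2 -
    dotF A C)], nonnegative by Cauchy-Schwarz. Minimality, uniqueness and nonexpansiveness of the
    projection are all read off this inequality. *)
Lemma clipF_pythagoras b A C : 0 <= b -> normF C <= b ->
  normF (A - clipF b A) ^+ 2 + normF (clipF b A - C) ^+ 2 <= normF (A - C) ^+ 2.
Proof.
move=> b0 Cb; rewrite /clipF; case: ifPn => Ab.
  by rewrite subrr normF0 expr0n /= add0r.
rewrite -ltNge in Ab.
have A0 : 0 < normF A by apply: le_lt_trans Ab.
set t := b / normF A.
have t1 : t <= 1 by rewrite ler_pdivrMr// mul1r ltW.
have tA : t * normF A = b by rewrite /t divfK// gt_eqF.
rewrite !normF_sqr !(dotFBl, dotFBr, dotFZl, dotFZr) (dotFC C A) -!normF_sqr.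
have h : dotF A C <= t * normF A ^+ 2.
  by rewrite expr2 mulrA tA mulrC (le_trans (dotF_le _ _))// ler_wpM2l// normF_ge0.
rewrite -subr_ge0.
set X := (X in 0 <= X).
have -> : X = 2 * (1 - t) * (t * normF A ^+ 2 - dotF A C) by rewrite /X; ring.
by rewrite !mulr_ge0// subr_ge0.
Qed.

Lemma clipF_ball b A : 0 <= b -> normF (clipF b A) <= b.
Proof.
move=> b0; rewrite /clipF; case: ifPn => // Ab; rewrite -ltNge in Ab.
have A0 : 0 < normF A by apply: le_lt_trans Ab.
by rewrite normFZ ger0_norm ?divr_ge0 ?normF_ge0// divfK// gt_eqF.
Qed.

(** [get] returns some minimiser [N]; the previous inequality at [C := N] forces
    [normF (clipF b A - N)] to vanish. *)
Lemma projFE b A : 0 <= b -> projF b A = clipF b A.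
Proof.
move=> b0; rewrite /projF.
have clip_proj : is_projF b A (clipF b A).
  split=> [|C Cb]; first exact: clipF_ball.
  rewrite -(@ler_pXn2r _ 2) ?nnegrE ?normF_ge0//.
  by apply: le_trans (clipF_pythagoras A b0 Cb); rewrite lerDl sqr_ge0.
have [Nb /(_ _ (clipF_ball A b0))] := getPex (ex_intro _ _ clip_proj).
set N := get _ in Nb * => Nmin.
have := clipF_pythagoras A b0 Nb.
rewrite -(@ler_pXn2r _ 2) ?nnegrE ?normF_ge0// in Nmin.
move=> h; have h0 : normF (clipF b A - N) ^+ 2 <= 0 by lra.
apply/esym/eqP; rewrite -subr_eq0; apply/eqP/normF_eq0/eqP.
by rewrite -sqrf_eq0 eq_le h0 sqr_ge0.
Qed.

Lemma projF_nonexp b A C : 0 <= b -> normF C <= b ->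
  normF (projF b A - C) <= normF (A - C).
Proof.
move=> b0 Cb; rewrite projFE// -(@ler_pXn2r _ 2) ?nnegrE ?normF_ge0//.
by apply: le_trans (clipF_pythagoras A b0 Cb); rewrite lerDr sqr_ge0.
Qed.

Lemma projF_id b A : normF A <= b -> projF b A = A.
Proof.
by move=> Ab; rewrite projFE ?(le_trans (normF_ge0 A))// /clipF Ab.
Qed.

End projection.

Lemma projF_sym (R : realType) n (b : R) (A : 'M[R]_n) : 0 <= b ->
  A^T = A -> (projF b A)^T = projF b A.
Proof.
by move=> b0 As; rewrite projFE// /clipF; case: ifP; rewrite ?linearZ /= As.
Qed.

(** * Positive definite matrices and the Lyapunov operator *)

Section posdef.
Context {R : realType} {d : nat}.
Implicit Types X Y : 'M[R]_d.

Lemma dotF_tr m n (A B : 'M[R]_(m, n)) : dotF A B = \tr (A^T *m B).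
Proof.
rewrite dotF_mulmx_col; apply: eq_bigr => j _; rewrite mxE.
by apply: eq_bigr => i _; rewrite mxE.
Qed.

Lemma dotF_mull (A X Y : 'M[R]_d) : dotF (A *m X) Y = dotF X (A^T *m Y).
Proof. by rewrite !dotF_tr trmx_mul mulmxA. Qed.

Lemma dotF_trmx m n (A B : 'M[R]_(m, n)) : dotF A^T B^T = dotF A B.
Proof.
by rewrite dotF_mulmx_col; do 2 apply: eq_bigr => ? _; rewrite !mxE.
Qed.

Variable H : 'M[R]_d.
Hypothesis H_posdef : posdef H.

Lemma posdef_unit : H \in unitmx.
Proof.
rewrite unitmxE unitfE; apply/negP => /det0P [v v0 vH].
have /(H_posdef.2) : v^T != 0.
  by apply: contra v0 => /eqP/(congr1 trmx); rewrite trmxK trmx0 => ->.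
by rewrite trmxK vH mul0mx mxE ltxx.
Qed.

(** The form on matrices is the sum of the quadratic forms of the columns of [X]. *)
Lemma posdef_dotF_ge0 X : 0 <= dotF X (H *m X).
Proof.
rewrite dotF_mulmx_col; apply: sumr_ge0 => j _.
have -> : \sum_i X i j * (H *m X) i j = ((col j X)^T *m H *m col j X) 0 0.
  rewrite -mulmxA mxE; apply: eq_bigr => i _; rewrite !mxE; congr (_ * _).
  by apply: eq_bigr => k _; rewrite mxE.
have [->|X0] := eqVneq (col j X) 0; first by rewrite mulmx0 mxE.
exact: ltW (H_posdef.2 _ X0).
Qed.

Lemma invmx_posdef_sym : (invmx H)^T = invmx H.
Proof. by rewrite trmx_inv H_posdef.1. Qed.

(* Expand [0 <= <Y, H Y>] at [Y = X - c^-1 H^-1 X], with [c > |H^-1|]. *)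
Lemma posdef_coercive : exists2 lam : R, 0 < lam &
  forall X, lam * normF X ^+ 2 <= dotF X (H *m X).
Proof.
set c := normF (invmx H) + 1.
have c0 : 0 < c by rewrite ltr_wpDl ?normF_ge0.
exists c^-1 => [|X]; first by rewrite invr_gt0.
have := posdef_dotF_ge0 (X - c^-1 *: (invmx H *m X)).
rewrite mulmxBr -scalemxAr mulKVmx ?posdef_unit//.
rewrite !(dotFBl, dotFBr, dotFZl, dotFZr) dotF_mull.
rewrite invmx_posdef_sym mulKmx ?posdef_unit// -normF_sqr.
have h : dotF (invmx H *m X) X <= c * normF X ^+ 2.
  apply: le_trans (dotF_le _ _) _; rewrite expr2 mulrA ler_wpM2r ?normF_ge0//.
  apply: le_trans (normF_mul _ _) _; rewrite ler_wpM2r ?normF_ge0//.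
  by rewrite lerDl.
have h1 : c^-1 * (c^-1 * dotF (invmx H *m X) X) <= c^-1 * normF X ^+ 2.
  by rewrite ler_pM2l ?invr_gt0// mulrC ler_pdivrMr// mulrC.
lra.
Qed.

(** The Lyapunov operator of [H], which is the linear part of the mean increment as a function of
    [A - invmx H]. *)
Definition lyap X := X *m H + H *m X.

Lemma lyapB X Y : lyap (X - Y) = lyap X - lyap Y.
Proof. by rewrite /lyap mulmxBr mulmxBl opprD addrACA. Qed.

Lemma lyapD X Y : lyap (X + Y) = lyap X + lyap Y.
Proof. by rewrite /lyap mulmxDr mulmxDl addrACA. Qed.

Lemma normF_lyap X : normF (lyap X) <= 2 * normF H * normF X.
Proof.
apply: le_trans (normFD (normF_mul _ _) (normF_mul _ _)) _.
by rewrite le_eqVlt; apply/orP; left; apply/eqP; ring.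
Qed.

Lemma dotF_lyap lam : (forall X, lam * normF X ^+ 2 <= dotF X (H *m X)) ->
  forall X, 2 * lam * normF X ^+ 2 <= dotF X (lyap X).
Proof.
move=> hlam X; rewrite dotFDr -(dotF_trmx X (X *m H)) trmx_mul H_posdef.1.
have := hlam X; have := hlam X^T; rewrite normF_tr; lra.
Qed.

(** Quantitative injectivity, from coercivity and Cauchy-Schwarz: a bound on [lyap] of the summed
    errors becomes a bound on the sum itself. *)
Lemma lyap_inv lam : 0 < lam ->
  (forall X, 2 * lam * normF X ^+ 2 <= dotF X (lyap X)) ->
  forall X, 2 * lam * normF X <= normF (lyap X).
Proof.
move=> lam0 hlam X; have [->|X0] := eqVneq (normF X) 0.
  by rewrite mulr0 normF_ge0.
have X1 : 0 < normF X by rewrite lt_def X0 normF_ge0.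
rewrite -(ler_pM2l X1) (le_trans _ (dotF_le _ _))// (le_trans _ (hlam X))//.
by rewrite le_eqVlt; apply/orP; left; apply/eqP; ring.
Qed.

(** Relative to [normF X ^+ 2], the cross term of the expanded square gains [4 * lam * c] and the
    quadratic term costs at most [2 * lam * c], by the smallness of [c]. The remainder
    [1 - 2 * lam * c] is below [(1 - lam * c) ^+ 2]. *)
Lemma lyap_contraction lam c : 0 < lam -> 0 <= c -> lam * c <= 1 ->
  4 * normF H ^+ 2 * c <= 2 * lam ->
  (forall X, 2 * lam * normF X ^+ 2 <= dotF X (lyap X)) ->
  forall X, normF (X - c *: lyap X) <= (1 - lam * c) * normF X.
Proof.
move=> lam0 c0 c1 c2 hlam X.
rewrite -(@ler_pXn2r _ 2) ?nnegrE ?mulr_ge0 ?normF_ge0 ?subr_ge0//.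
rewrite normF_sqr !(dotFBl, dotFBr, dotFZl, dotFZr) -!normF_sqr (dotFC (lyap X)).
have h1 := hlam X.
have h2 : normF (lyap X) ^+ 2 <= 4 * normF H ^+ 2 * normF X ^+ 2.
  rewrite (_ : 4 * _ * _ = (2 * normF H * normF X) ^+ 2); last by ring.
  by rewrite ler_pXn2r ?nnegrE ?mulr_ge0 ?normF_ge0 ?normF_lyap.
have h3 : c * (2 * lam * normF X ^+ 2) <= c * dotF X (lyap X) by rewrite ler_wpM2l.
have h4 : c * (c * normF (lyap X) ^+ 2) <=
    c * (c * (4 * normF H ^+ 2 * normF X ^+ 2)) by rewrite !ler_wpM2l.
have h5 : c * normF X ^+ 2 * (4 * normF H ^+ 2 * c) <= c * normF X ^+ 2 * (2 * lam).
  by rewrite ler_wpM2l// mulr_ge0// sqr_ge0.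
have h6 : 0 <= (lam * c) ^+ 2 * normF X ^+ 2 by rewrite mulr_ge0 ?sqr_ge0.
rewrite exprMn; nra.
Qed.

End posdef.

(** Each entry is a coordinate of the image of a basis vector. The assumptions on the Hessian of G
    use the operator norm and the analysis uses [normF]; the dimension factor does not affect
    rates. *)
Lemma normF_normop (R : realType) n (A : 'M[R]_n) :
  normF A <= (n * n)%:R * normop A.
Proof.
apply: normF_le_entries => i j; rewrite /normop.
have e1 : normF (delta_mx j 0 : 'cV[R]_n) = 1.
  rewrite normFE /dotF (bigD1 j)//= big_ord1 big1 ?addr0.
    by rewrite !mxE eqxx /= mulr1 sqrtr1.
  by move=> k /negPf kj; rewrite big1// => l _; rewrite mxE kj mulr0.
have -> : A i j = (A *m (delta_mx j 0 : 'cV[R]_n)) i 0.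
  by rewrite -colE mxE.
apply: le_trans (normF_coord _ _ _) _; apply: ub_le_sup.
  exists (normF A) => _ [x /= x1 <-]; apply: le_trans (normF_mul _ _) _.
  by rewrite ler_piMr ?normF_ge0.
by exists (delta_mx j 0) => //=; rewrite e1.
Qed.

(** * Growth rates and scalar recursions *)

Section power_asymptotics.
Context {R : realType}.
Implicit Types (s p e c k x : R) (n : nat).

Lemma powR_expR (x s : R) : 0 < x -> x `^ s = expR (s * ln x).
Proof. by move=> x0; rewrite /powR gt_eqF. Qed.

Lemma natr_gt0 n : (0 < n)%N -> 0 < n%:R :> R.
Proof. by rewrite ltr0n. Qed.

Lemma powRn_gt0 n s : (0 < n)%N -> 0 < n%:R `^ s :> R.
Proof. by move=> n0; rewrite powR_gt0 ?ltr0n. Qed.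

Lemma powRnD n s e : (0 < n)%N -> n%:R `^ (s + e) = n%:R `^ s * n%:R `^ e :> R.
Proof. by move=> n0; rewrite powRD// pnatr_eq0 -lt0n n0 implybT. Qed.

(** Invert and square [1 - x / 2 <= expR (- (x / 2))], then use that
    [(1 + x + x ^+ 2) * (1 - x / 2) ^+ 2 - 1] is a quarter of [x ^+ 2 * (1 - 3 * x + x ^+ 2)]. The
    threshold [1 / 3] keeps [1 - 3 * x] nonnegative. *)
Lemma expR_le_quad x : x <= 1 / 3 -> expR x <= 1 + x + x ^+ 2.
Proof.
move=> x3.
have h : 1 - x / 2 <= expR (- (x / 2)) by rewrite (le_trans _ (expR_ge1Dx _))//; lra.
have y0 : 0 < 1 - x / 2 by lra.
have -> : expR x = (expR (- (x / 2)) ^+ 2)^-1.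
  by rewrite -expRM_natl -expRN; congr expR; field.
apply: (@le_trans _ _ ((1 - x / 2) ^+ 2)^-1).
  by rewrite lef_pV2 ?posrE ?exprn_gt0 ?expR_gt0// ler_pXn2r ?nnegrE ?expR_ge0// ltW.
rewrite invf_ple ?posrE ?exprn_gt0//; last by nra.
rewrite -[X in X <= _]mul1r ler_pdivrMr; last by nra.
have : 0 <= x ^+ 2 * (1 - 3 * x + x ^+ 2).
  by rewrite mulr_ge0 ?sqr_ge0//; nra.
lra.
Qed.

Lemma ln_succ_le n : (0 < n)%N -> ln n.+1%:R - ln n%:R <= n%:R^-1 :> R.
Proof.
move=> n0; have n1 := natr_gt0 n0.
rewrite -ln_div ?posrE ?ltr0n//.
have -> : n.+1%:R / n%:R = 1 + n%:R^-1 :> R.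
  by rewrite -natr1 mulrDl mul1r divff// gt_eqF.
by apply: le_ln1Dx; rewrite (lt_trans (ltrN10 _))// invr_gt0.
Qed.

Lemma ln_succ_ge n : (0 < n)%N -> n.+1%:R^-1 <= ln n.+1%:R - ln n%:R :> R.
Proof.
move=> n0; have n1 := natr_gt0 n0; have n2 : 0 < n.+1%:R :> R by rewrite ltr0n.
have : ln (1 + (- n.+1%:R^-1)) <= - n.+1%:R^-1 :> R.
  apply: le_ln1Dx; rewrite ltrN2 invf_lt1// ltr1n.
  by [].
have -> : 1 + - n.+1%:R^-1 = n%:R / n.+1%:R :> R.
  by rewrite -natr1; field; rewrite natr1 gt_eqF.
rewrite ln_div ?posrE//. by move=> h; rewrite -lerN2 opprB.
Qed.

(** In place of the mean value theorem: n^(-s) is (n+1)^(-s) times the exponential of s times the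
    increment of the logarithm. It lets a bounded potential compensate the squared steps. *)
Lemma powRn_telescope s n : 0 < s -> (0 < n)%N ->
  n.+1%:R `^ (- s - 1) <= s^-1 * (n%:R `^ (- s) - n.+1%:R `^ (- s)) :> R.
Proof.
move=> s0 n0; rewrite ler_pdivlMl// powRnD// powR_inv1//.
have n1 := natr_gt0 n0; have n2 : 0 < n.+1%:R :> R by rewrite ltr0n.
have -> : n%:R `^ (- s) = n.+1%:R `^ (- s) * expR (s * (ln n.+1%:R - ln n%:R)) :> R.
  by rewrite !powR_expR// -expRD; congr expR; ring.
rewrite -[X in _ <= _ * _ - X]mulr1 -mulrBr mulrCA ler_pM2l ?powR_gt0//.
apply: (@le_trans _ _ (s * (ln n.+1%:R - ln n%:R))).
  by rewrite ler_pM2l// ln_succ_ge.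
by rewrite lerBrDl expR_ge1Dx.
Qed.

Lemma powRn_le1 s n : 0 <= s -> (0 < n)%N -> n%:R `^ (- s) <= 1 :> R.
Proof.
move=> s0 n0; rewrite powR_expR ?ltr0n// expR_le1 mulNr oppr_le0.
by rewrite mulr_ge0// ln_ge0// ler1n.
Qed.

(** [1 + u <= expR u] at u = (e / p) ln n, multiplied by [p / e] and raised to the power [p]; hence
    the constant (p / e)^p. *)
Lemma ln_powR_le (p e : R) : 0 <= p -> 0 < e -> exists2 C : R, 0 < C &
  forall n, (0 < n)%N -> ln n%:R `^ p <= C * n%:R `^ e.
Proof.
move=> p0 e0; have [->|pn0] := eqVneq p 0.
  exists 1 => // n n0; rewrite powRr0 mul1r powR_expR ?ltr0n// -[leLHS]expR0 ler_expR.
  by rewrite mulr_ge0 ?(ltW e0)// ln_ge0// ler1n.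
have p1 : 0 < p by rewrite lt_def pn0.
exists ((p / e) `^ p) => [|n n0]; first by rewrite powR_gt0// divr_gt0.
have l0 : 0 <= ln n%:R :> R by rewrite ln_ge0// ler1n.
have -> : n%:R `^ e = (n%:R `^ (e / p)) `^ p :> R by rewrite -powRrM divfK.
have pe0 : 0 <= p / e by rewrite ltW// divr_gt0.
rewrite -powRM ?powR_ge0//.
apply: (ge0_ler_powR p0); rewrite ?nnegrE//.
  by rewrite mulr_ge0// powR_ge0.
rewrite powR_expR ?ltr0n//.
have := expR_ge1Dx (e / p * ln n%:R : R).
rewrite -(@ler_pM2l _ (p / e)) ?divr_gt0// mulrDr mulrA.
have -> : p / e * (e / p) = 1 by field; rewrite !gt_eqF.
have : 0 < p / e by rewrite divr_gt0.
lra.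
Qed.

Lemma near_powRn_ge e (M : R) : 0 < e -> \forall n \near \oo, M <= n%:R `^ e.
Proof.
move=> e0; near=> n.
have n0 : (0 < n)%N by near: n; exact: nbhs_infty_gt.
have : (`|M| + 1) `^ e^-1 <= n%:R by near: n; exact: nbhs_infty_ger.
move=> /(ge0_ler_powR (ltW e0)); rewrite !nnegrE powR_ge0 => /(_ isT).
rewrite ler0n => /(_ isT); rewrite -powRrM mulVf ?gt_eqF// powRr1 ?addr_ge0//.
by apply: le_trans; rewrite ler_wpDr// ler_norm.
Unshelve. all: by end_near. Qed.

Lemma near_powRNn_le e (eps : R) : 0 < e -> 0 < eps ->
  \forall n \near \oo, n%:R `^ (- e) <= eps.
Proof.
move=> e0 eps0; near=> n.
have : eps^-1 <= n%:R `^ e by near: n; exact: near_powRn_ge.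
by rewrite powRN invf_ple ?posrE ?invr_gt0// powRn_gt0//; near: n; exact: nbhs_infty_gt.
Unshelve. all: by end_near. Qed.

Lemma near_ln_ge (M : R) : \forall n \near \oo, M <= ln n%:R.
Proof.
near=> n; rewrite -[M]expRK ler_ln ?posrE ?expR_gt0 ?ltr0n//.
  by near: n; exact: nbhs_infty_ger.
by near: n; exact: nbhs_infty_gt.
Unshelve. all: by end_near. Qed.

Lemma near_ln_powR_ge e (M : R) : 0 < e -> \forall n \near \oo, M <= ln n%:R `^ e.
Proof.
move=> e0; near=> n.
have l0 : 0 <= ln n%:R :> R by near: n; exact: near_ln_ge.
have : (`|M| + 1) `^ e^-1 <= ln n%:R by near: n; exact: near_ln_ge.
move=> /(ge0_ler_powR (ltW e0)); rewrite !nnegrE powR_ge0 => /(_ isT l0).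
rewrite -powRrM mulVf ?gt_eqF// powRr1 ?addr_ge0//.
by apply: le_trans; rewrite ler_wpDr// ler_norm.
Unshelve. all: by end_near. Qed.

Lemma near_polylog_le p e (eps : R) : 0 <= p -> 0 < e -> 0 < eps ->
  \forall n \near \oo, ln n%:R `^ p * n%:R `^ (- e) <= eps.
Proof.
move=> p0 e0 eps0; have e2 : 0 < e / 2 by rewrite divr_gt0.
have [C C0 hC] := ln_powR_le p0 e2.
near=> n.
have n0 : (0 < n)%N by near: n; exact: nbhs_infty_gt.
have : n%:R `^ (- (e / 2)) <= eps / C.
  by near: n; apply: near_powRNn_le => //; rewrite divr_gt0.
rewrite ler_pdivlMr// mulrC; apply: le_trans.
have -> : n%:R `^ (- e) = n%:R `^ (- (e / 2)) * n%:R `^ (- (e / 2)) :> R.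
  by rewrite -powRnD//; congr (_ `^ _); field.
rewrite mulrA ler_pM2r ?powRn_gt0//.
apply: le_trans (ler_wpM2r (powR_ge0 _ _) (hC _ n0)) _.
by rewrite -mulrA -powRnD// subrr powRr0 mulr1.
Unshelve. all: by end_near. Qed.

(** The scale for norms, not for their squares. It may vanish at [n <= 1], so comparisons with it
    are made for large [n]. *)
Definition rate (s p : R) n : R := ln n%:R `^ p * n%:R `^ (- s).

Lemma rate_ge0 s p n : 0 <= rate s p n.
Proof. by rewrite mulr_ge0 ?powR_ge0. Qed.

Lemma ln_gt0n n : (1 < n)%N -> 0 < ln n%:R :> R.
Proof. by move=> n1; rewrite ln_gt0// ltr1n. Qed.

Lemma rate_gt0 s p n : (1 < n)%N -> 0 < rate s p n.
Proof. by move=> n1; rewrite mulr_gt0 ?powR_gt0 ?ln_gt0n ?ltr0n// ltnW. Qed.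

(** In one step n^(-s) decreases by a relative amount O(1/n), negligible against n^(-gam) since
    [gam < 1], while the logarithm is nondecreasing. Hence a contraction with steps of order
    n^(-gam) can follow any such rate. *)
Lemma rate_slow s p gam k : 0 <= s -> 0 <= p -> gam < 1 -> 0 < k ->
  \forall n \near \oo, rate s p n <= (1 + k * n.+1%:R `^ (- gam)) * rate s p n.+1.
Proof.
move=> s0 p0 gam1 k0; near=> n.
have n0 : (0 < n)%N by near: n; exact: nbhs_infty_gt.
have n1 := natr_gt0 n0; have n2 : 0 < n.+1%:R :> R by rewrite ltr0n.
rewrite /rate mulrCA; apply: ler_pM; rewrite ?powR_ge0//.
  apply: ge0_ler_powR; rewrite ?nnegrE ?ln_ge0 ?ler1n//.
  by rewrite ler_ln ?posrE// ler_nat.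
have -> : n%:R `^ (- s) = expR (s * (ln n.+1%:R - ln n%:R)) * n.+1%:R `^ (- s) :> R.
  by rewrite !powR_expR// -expRD; congr expR; ring.
rewrite ler_pM2r ?powRn_gt0//.
have h1 : s * (ln n.+1%:R - ln n%:R) <= 2 * s * n.+1%:R^-1 :> R.
  rewrite mulrAC [leRHS]mulrC ler_wpM2l// (le_trans (ln_succ_le n0))//.
  rewrite -[leRHS]invrK lef_pV2 ?posrE ?invr_gt0 ?mulr_gt0 ?invr_gt0//.
  rewrite invfM invrK mulrC ler_pdivrMr// -natr1.
  have : 1 <= n%:R :> R by rewrite ler1n.
  lra.
have h2 : (2 * (2 * s + 1)) / k <= n.+1%:R `^ (1 - gam).
  apply: (@le_trans _ _ (n%:R `^ (1 - gam))).
    by near: n; apply: near_powRn_ge; rewrite subr_gt0.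
  by apply: ge0_ler_powR; rewrite ?nnegrE ?subr_ge0 ?(ltW gam1)// ler_nat.
have h3 : 1 / 3 >= 2 * s * n.+1%:R^-1 :> R.
  rewrite ler_pdivrMr//.
  have : 6 * s <= n%:R by near: n; exact: nbhs_infty_ger.
  by rewrite -natr1; lra.
have s1 : 0 <= 2 * s * n.+1%:R^-1 by rewrite !mulr_ge0// invr_ge0 ltW.
apply: (@le_trans _ _ (expR (2 * s * n.+1%:R^-1))); first by rewrite ler_expR.
apply: le_trans (expR_le_quad h3) _; rewrite -addrA lerD2l.
set x := 2 * s * n.+1%:R^-1 in s1 h3 *.
apply: (@le_trans _ _ (2 * x)); first by nra.
have e1 : n.+1%:R `^ (1 - gam) = n.+1%:R * n.+1%:R `^ (- gam) :> R.
  by rewrite powRnD// powRr1 ?(ltW n2).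
move: h2; rewrite e1 ler_pdivrMr// /x => h2.
rewrite !mulrA ler_pdivrMr//; move: h2.
set w := n.+1%:R `^ _; set m := n.+1%:R; lra.
Unshelve. all: by end_near. Qed.

(** The variation of [v] uses up at most half of the contraction, so the bound [C' * v] is
    reproduced with a surplus of at least [c / 2 * C'] times [g * v]. This pays for the forcing once
    [2 * C / c <= C']; the other summand of [C'] serves the initial index. *)
Lemma contraction_bound (r v g : nat -> R) (c C : R) n0 :
  0 < c -> 0 <= C ->
  (forall n, (n0 <= n)%N -> 0 < v n) ->
  (forall n, (n0 <= n)%N -> 0 <= g n.+1 /\ c * g n.+1 <= 1) ->
  (forall n, (n0 <= n)%N -> v n <= (1 + c / 2 * g n.+1) * v n.+1) ->
  (forall n, (n0 <= n)%N ->
     r n.+1 <= (1 - c * g n.+1) * r n + g n.+1 * (C * v n.+1)) ->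
  exists2 C', 0 <= C' & forall n, (n0 <= n)%N -> r n <= C' * v n.
Proof.
move=> c0 C0 v0 g0 vs rs.
set C' := `|r n0 / v n0| + 2 * C / c.
have C'0 : 0 <= C' by rewrite addr_ge0// divr_ge0 ?(ltW c0)// mulr_ge0.
exists C' => //; elim=> [|n IH].
  rewrite leqn0 => /eqP n00; have := v0 _ (leqnn n0).
  rewrite n00 => v00; rewrite -ler_pdivrMr// /C' n00.
  by rewrite (le_trans (ler_norm _))// lerDl divr_ge0 ?(ltW c0)// mulr_ge0.
rewrite leq_eqVlt => /predU1P[<-|].
  rewrite -ler_pdivrMr ?v0// /C'.
  by rewrite (le_trans (ler_norm _))// lerDl divr_ge0 ?(ltW c0)// mulr_ge0.
rewrite ltnS => nn; have {}IH := IH nn.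
have [g1 g2] := g0 _ nn; have v1 := v0 _ (leqW nn).
apply: le_trans (rs _ nn) _.
have h1 : (1 - c * g n.+1) * r n <=
    (1 - c * g n.+1) * (C' * ((1 + c / 2 * g n.+1) * v n.+1)).
  rewrite ler_wpM2l ?subr_ge0// (le_trans IH)// ler_wpM2l//; exact: vs.
apply: le_trans (lerD h1 (lexx _)) _.
have hC : 2 * C <= c * C'.
  rewrite /C' mulrDr [X in _ <= _ + X]mulrC divfK ?gt_eqF// lerDr.
  by rewrite mulr_ge0// ltW.
rewrite -subr_ge0.
set X := (X in 0 <= X).
have -> : X = v n.+1 * g n.+1 * ((c * C' - 2 * C) / 2 + C' * c ^+ 2 / 2 * g n.+1).
  by rewrite /X; field.
rewrite mulr_ge0//; first by rewrite mulr_ge0// ltW.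
apply: addr_ge0; first by rewrite divr_ge0// subr_ge0.
by apply: mulr_ge0 => //; apply: divr_ge0 => //; apply: mulr_ge0 => //; exact: sqr_ge0.
Qed.

End power_asymptotics.

(** * Eventual domination up to a constant *)

Section domination.
Context {R : realType}.
Implicit Types (u v : nat -> R) (s p : R).

Definition dominated u v :=
  exists2 C : R, 0 <= C & \forall n \near \oo, u n <= C * v n.

Lemma dominated_near u v : (\forall n \near \oo, u n <= v n) -> dominated u v.
Proof. by move=> h; exists 1 => //; apply: filterS h => n; rewrite mul1r. Qed.

Lemma dominated_trans u v w : dominated u v -> dominated v w -> dominated u w.
Proof.
move=> [C C0 h1] [D D0 h2]; exists (C * D); first by rewrite mulr_ge0.
apply: filterS2 h1 h2 => n h1 h2; rewrite (le_trans h1)// -mulrA ler_wpM2l//.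
Qed.

Lemma dominated_add u1 u2 v : dominated u1 v -> dominated u2 v ->
  dominated (fun n => u1 n + u2 n) v.
Proof.
move=> [C C0 h1] [D D0 h2]; exists (C + D); first by rewrite addr_ge0.
by apply: filterS2 h1 h2 => n h1 h2; rewrite mulrDl lerD.
Qed.

Lemma dominated_scale c u v : 0 <= c -> dominated u v ->
  dominated (fun n => c * u n) v.
Proof.
move=> c0 [C C0 h]; exists (c * C); first by rewrite mulr_ge0.
by apply: filterS h => n h; rewrite -mulrA ler_wpM2l.
Qed.

Lemma dominated_le u1 u2 v : (\forall n \near \oo, u1 n <= u2 n) ->
  dominated u2 v -> dominated u1 v.
Proof. by move=> /dominated_near; exact: dominated_trans. Qed.

Lemma nbhs_infty_succ (Q : nat -> Prop) :
  (\forall n \near \oo, Q n) -> \forall n \near \oo, Q n.+1.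
Proof.
by move=> [N _ h]; exists N => // n /= Nn; apply: h; rewrite /= ltnW.
Qed.

Lemma rate_mono s s' p p' : s' <= s -> p <= p' ->
  \forall n \near \oo, rate s p n <= rate s' p' n :> R.
Proof.
move=> ss pp; near=> n.
have n0 : (0 < n)%N by near: n; exact: nbhs_infty_gt.
have l1 : 1 <= ln n%:R :> R by near: n; exact: near_ln_ge.
apply: ler_pM; rewrite ?powR_ge0//; first exact: ler_powR.
by apply: ler_powR; rewrite ?ler1n// lerN2.
Unshelve. all: by end_near. Qed.

Lemma rate_succ s p : 0 <= s -> 0 <= p ->
  \forall n \near \oo, rate s p n.+1 <= 2 `^ p * rate s p n :> R.
Proof.
move=> s0 p0; near=> n.
have n0 : (0 < n)%N by near: n; exact: nbhs_infty_gt.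
have n1 := @natr_gt0 R _ n0.
have l1 : 1 <= ln n%:R :> R by near: n; exact: near_ln_ge.
rewrite /rate mulrA; apply: ler_pM; rewrite ?powR_ge0//.
  rewrite -powRM//; last by rewrite (le_trans _ l1).
  apply: (ge0_ler_powR p0); rewrite ?nnegrE ?mulr_ge0 ?(le_trans _ l1)//.
    by rewrite ln_ge0// ler1n.
  have := ln_succ_le n0 (R := R); have : n%:R^-1 <= 1 :> R by rewrite invf_le1 ?ler1n.
  lra.
rewrite !powRN lef_pV2 ?posrE ?powRn_gt0//.
by apply: (ge0_ler_powR s0); rewrite ?nnegrE ?ler_nat.
Unshelve. all: by end_near. Qed.

Lemma rate_pred s p : 0 <= s -> 0 <= p ->
  \forall n \near \oo, rate s p n <= 2 * rate s p n.+1 :> R.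
Proof.
move=> s0 p0; near=> n.
have h : rate s p n <= (1 + 1 * n.+1%:R `^ (- 0)) * rate s p n.+1 :> R.
  by near: n; apply: rate_slow.
by move: h; rewrite oppr0 powRr0 mulr1.
Unshelve. all: by end_near. Qed.

Lemma rateM s s' p p' n : (1 < n)%N ->
  rate s p n * rate s' p' n = rate (s + s') (p + p') n :> R.
Proof.
move=> n1; have l0 := @ln_gt0n R _ n1; have n0 := @natr_gt0 R _ (ltnW n1).
have powD (x r t : R) : 0 < x -> x `^ (r + t) = x `^ r * x `^ t.
  by move=> x0; rewrite powRD ?(gt_eqF x0) ?implybT.
by rewrite /rate opprD !powD//; ring.
Qed.

(** Unlike an additive forcing, a maximum does not accumulate: [(1 - x) * (1 + x / 2) <= 1]
    preserves [C' * v], and [b] only asks for [C <= C']. Therefore [b] carries no factor [g]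
    here. *)
Lemma max_bound (m v g b : nat -> R) (c C : R) n0 :
  0 < c -> 0 <= C ->
  (forall n, (n0 <= n)%N -> 0 < v n) ->
  (forall n, (n0 <= n)%N -> 0 <= g n.+1 /\ c * g n.+1 <= 1) ->
  (forall n, (n0 <= n)%N -> v n <= (1 + c / 2 * g n.+1) * v n.+1) ->
  (forall n, (n0 <= n)%N -> b n <= C * v n.+1) ->
  (forall n, (n0 <= n)%N -> m n.+1 = Num.max ((1 - c * g n.+1) * m n) (b n)) ->
  exists2 C', 0 <= C' & forall n, (n0 <= n)%N -> m n <= C' * v n.
Proof.
move=> c0 C0 v0 g0 vs bv mE.
set C' := `|m n0 / v n0| + C.
have C'0 : 0 <= C' by rewrite addr_ge0.
have base : m n0 <= C' * v n0.
  by rewrite -ler_pdivrMr ?v0// /C' (le_trans (ler_norm _))// lerDl.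
exists C' => //; elim=> [|n IH]; first by rewrite leqn0 => /eqP <-.
rewrite leq_eqVlt => /predU1P[<-//|]; rewrite ltnS => nn; have {}IH := IH nn.
have [g1 g2] := g0 _ nn; have v1 := v0 _ (leqW nn).
rewrite mE// ge_max; apply/andP; split; last first.
  by apply: le_trans (bv _ nn) _; rewrite ler_pM2r// /C' lerDr.
apply: (@le_trans _ _ ((1 - c * g n.+1) * (C' * ((1 + c / 2 * g n.+1) * v n.+1)))).
  by rewrite ler_wpM2l ?subr_ge0// (le_trans IH)// ler_wpM2l//; exact: vs.
rewrite mulrCA mulrA -mulrA ler_wpM2l// mulrA ler_piMl ?(ltW v1)//.
have : 0 <= c * g n.+1 by rewrite mulr_ge0// ltW.
have : c / 2 * g n.+1 = c * g n.+1 / 2 by ring.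
move=> ->; set x := c * g n.+1 => x0; nra.
Qed.

(** Discrete integration: n times the rate is (ln n)^p n^(1-s), whose increments are at least (1 -
    s) / 2 times the rate. The 2 comes from 1/(n+1) >= 1/(2n). *)
Lemma sum_bound (y : nat -> R) (C s p : R) : 0 <= C -> 0 <= s -> s < 1 -> 0 <= p ->
  (\forall n \near \oo, y n.+1 <= y n + C * rate s p n) ->
  dominated y (fun n => n%:R * rate s p n).
Proof.
move=> C0 s0 s1 p0 hy.
pose v n : R := n%:R * rate s p n.
set t := 1 - s; have t0 : 0 < t by rewrite /t; lra.
have vE n : (0 < n)%N -> v n = ln n%:R `^ p * n%:R `^ t.
  move=> n0; rewrite /v /rate mulrCA; congr (_ * _).
  by rewrite -[X in X * _]powRr1// -powRnD.
have incr_v n : (0 < n)%N -> t / 2 * rate s p n <= v n.+1 - v n.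
  move=> n0; have n1 := @natr_gt0 R _ n0; have n2 := @natr_gt0 R _ (ltn0Sn n).
  rewrite !vE//.
  have hl : ln n%:R `^ p <= ln n.+1%:R `^ p :> R.
    apply: (ge0_ler_powR p0); rewrite ?nnegrE ?ln_ge0 ?ler1n//.
    by rewrite ler_ln ?posrE// ler_nat.
  apply: (@le_trans _ _ (ln n%:R `^ p * (n.+1%:R `^ t - n%:R `^ t))); last first.
    by rewrite mulrBr lerB// ler_wpM2r// powR_ge0.
  rewrite /rate mulrCA ler_wpM2l ?powR_ge0//.
  have -> : n.+1%:R `^ t = n%:R `^ t * expR (t * (ln n.+1%:R - ln n%:R)) :> R.
    by rewrite !powR_expR// -expRD; congr expR; ring.
  rewrite -[X in _ <= _ - X]mulr1 -mulrBr.
  have -> : n%:R `^ (- s) = n%:R `^ t / n%:R :> R.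
    have -> : - s = t - 1 by rewrite /t; ring.
    by rewrite powRnD// powR_inv1// ltW.
  rewrite mulrCA ler_wpM2l ?powR_ge0//.
  apply: (@le_trans _ _ (t * n.+1%:R^-1)).
    rewrite -mulrA ler_pM2l// -invfM lef_pV2 ?posrE ?mulr_gt0//.
    by rewrite -natr1 mulr_natl mulr2n lerD2l ler1n.
  rewrite lerBrDl (le_trans _ (expR_ge1Dx _))// lerD2l ler_pM2l// ln_succ_ge//.
have [N _ hN] := hy.
pose N' := maxn N 2.
have vN0 n : (N' <= n)%N -> 0 < v n.
  move=> h; have n1 : (1 < n)%N by exact: leq_trans (leq_maxr _ _) h.
  by rewrite mulr_gt0 ?rate_gt0// ltr0n ltnW.
exists (`|y N' / v N'| + 2 * C / t).
  by rewrite addr_ge0// divr_ge0 ?mulr_ge0// ltW.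
exists N' => // n /=; elim: n => [|n IH].
  by rewrite leqn0 /N' => /eqP h; have := leq_maxr N 2; rewrite h.
have base : y N' <= (`|y N' / v N'| + 2 * C / t) * v N'.
  rewrite -ler_pdivrMr ?vN0// (le_trans (ler_norm _))// lerDl divr_ge0 ?mulr_ge0//.
  exact: ltW.
rewrite leq_eqVlt => /predU1P[<-//|]; rewrite ltnS => nn; have {}IH := IH nn.
have n0 : (0 < n)%N by exact: leq_trans (leq_trans _ (leq_maxr N 2)) nn.
have h1 : y n.+1 <= y n + C * rate s p n by apply: hN; exact: leq_trans (leq_maxl _ _) nn.
apply: (le_trans h1); apply: (le_trans (lerD IH (lexx _))).
rewrite -/(v n) -/(v n.+1) -lerBrDl -mulrBr.
have hv := incr_v _ n0.
have h2 : 2 * C / t * (t / 2 * rate s p n) <= 2 * C / t * (v n.+1 - v n).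
  by rewrite ler_wpM2l// divr_ge0 ?mulr_ge0// ltW.
have -> : C * rate s p n = 2 * C / t * (t / 2 * rate s p n).
  by field; rewrite gt_eqF.
apply: (le_trans h2); rewrite ler_wpM2r ?lerDr//.
by apply: le_trans hv; rewrite mulr_ge0 ?rate_ge0// divr_ge0// ltW.
Qed.

Lemma powRn_increment (e : R) n : 0 <= e -> e <= 1 -> (0 < n)%N ->
  n.+1%:R `^ e - n%:R `^ e <= n%:R `^ (e - 1) :> R.
Proof.
move=> e0 e1 n0; have n1 := @natr_gt0 R _ n0.
have -> : n.+1%:R = n%:R * (1 + n%:R^-1) :> R.
  by rewrite mulrDr mulr1 divff ?gt_eqF// natr1.
rewrite powRM ?addr_ge0 ?invr_ge0// powRnD// powR_inv1//.
rewrite -[X in _ - X]mulr1 -mulrBr ler_wpM2l ?powR_ge0// lerBlDl.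
by apply: ler1_powR => //; rewrite lerDl invr_ge0.
Qed.

(** Squaring the bound leaves the logarithm with exponent 1 + delta/2; the missing factor (ln
    n)^(delta/2) eventually exceeds [C ^+ 2 / eps], which turns O into o. *)
Lemma littleo_of_dominated (f : nat -> R^o) (sig delta : R) : 0 < delta ->
  (forall n, 0 <= f n) ->
  dominated f (fun n => rate (sig / 2) ((1 + delta / 2) / 2) n) ->
  (fun n => f n ^+ 2 : R^o) =o_\oo
  (fun n => ln n%:R `^ (1 + delta) / n%:R `^ sig : R^o).
Proof.
move=> d0 f0 [C C0 hC]; apply/eqoP => eps eps0.
near=> n.
have n1 : (1 < n)%N by near: n; exact: nbhs_infty_gt.
have l0 := @ln_gt0n R _ n1.
have hf : f n <= C * rate (sig / 2) ((1 + delta / 2) / 2) n by near: n.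
rewrite ger0_norm ?sqr_ge0// ger0_norm ?divr_ge0 ?powR_ge0//.
have hl : C ^+ 2 / eps <= ln n%:R `^ (delta / 2).
  by near: n; apply: near_ln_powR_ge; rewrite divr_gt0.
apply: (@le_trans _ _ ((C * rate (sig / 2) ((1 + delta / 2) / 2) n) ^+ 2)).
  by rewrite ler_pXn2r ?nnegrE// mulr_ge0// rate_ge0.
rewrite exprMn [_ ^+ 2 in X in _ * X]expr2 rateM//.
have -> : sig / 2 + sig / 2 = sig by field.
have -> : (1 + delta / 2) / 2 + (1 + delta / 2) / 2 = 1 + delta / 2 by field.
rewrite /rate -powRN mulrA [leRHS]mulrA ler_wpM2r ?powR_ge0//.
have -> : 1 + delta = (1 + delta / 2) + delta / 2 by field.
have -> : ln n%:R `^ (1 + delta / 2 + delta / 2) =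
    ln n%:R `^ (1 + delta / 2) * ln n%:R `^ (delta / 2) :> R.
  by rewrite powRD ?(gt_eqF l0) ?implybT.
rewrite mulrC [leRHS]mulrCA ler_wpM2l ?powR_ge0//.
by rewrite mulrC -ler_pdivrMr.
Unshelve. all: by end_near. Qed.

End domination.

(** * Pathwise error bounds *)

Section step_sizes.
Context {R : realType}.
Variables (cgamma gamma : R).
Hypotheses (cgamma_gt0 : 0 < cgamma) (gamma_gt : 1 / 2 < gamma) (gamma_lt1 : gamma < 1).
Let gam := power_seq cgamma (- gamma).

Lemma power_seq_gt0 (c e : R) n : 0 < c -> 0 < power_seq c e n.+1.
Proof. by move=> c0; rewrite mulr_gt0 ?powRn_gt0. Qed.

Lemma near_step_le (eps : R) : 0 < eps -> \forall n \near \oo, gam n.+1 <= eps.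
Proof.
move=> e0; apply: (@nbhs_infty_succ (fun n => gam n <= eps)).
near=> n; rewrite -ler_pdivlMl// mulrC; near: n; apply: near_powRNn_le.
  by move: gamma_gt; lra.
by rewrite divr_gt0.
Unshelve. all: by end_near. Qed.

Lemma rate_slow_step (s p k : R) : 0 <= s -> 0 <= p -> 0 < k ->
  \forall n \near \oo, rate s p n <= (1 + k / 2 * gam n.+1) * rate s p n.+1.
Proof.
move=> s0 p0 k0; have k1 : 0 < k / 2 * cgamma by rewrite mulr_gt0// divr_gt0.
apply: filterS (rate_slow s0 p0 gamma_lt1 k1) => n; rewrite /gam /power_seq.
by rewrite mulrA.
Qed.

Lemma dominated_contraction (r : nat -> R) (s p c C : R) : 0 < c -> 0 <= C ->
  0 <= s -> 0 <= p ->
  (\forall n \near \oo,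
     r n.+1 <= (1 - c * gam n.+1) * r n + gam n.+1 * (C * rate s p n.+1)) ->
  dominated r (rate s p).
Proof.
move=> c0 C0 s0 p0 hr.
have h : \forall n \near \oo, [/\ 0 < rate s p n,
    c * gam n.+1 <= 1, rate s p n <= (1 + c / 2 * gam n.+1) * rate s p n.+1 &
    r n.+1 <= (1 - c * gam n.+1) * r n + gam n.+1 * (C * rate s p n.+1)].
  near=> n; split.
  - by apply: rate_gt0; near: n; exact: nbhs_infty_gt.
  - rewrite mulrC -ler_pdivlMr//; near: n; apply: near_step_le; exact: divr_gt0.
  - by near: n; exact: rate_slow_step.
  - by near: n.
case: h => n0 _ hn.
have [||||C' C'0 hC'] := @contraction_bound R r (rate s p) gam c C n0 c0 C0.
- by move=> n /hn[].
- by move=> n /hn[_ ? _ _]; split => //; apply: ltW; exact: power_seq_gt0.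
- by move=> n /hn[].
- by move=> n /hn[].
by exists C' => //; exists n0.
Unshelve. all: by end_near. Qed.

Lemma dominated_max (m b : nat -> R) (s c C : R) : 0 < c -> 0 <= C -> 0 <= s ->
  (\forall n \near \oo, b n <= C * rate s 0 n.+1) ->
  (\forall n \near \oo, m n.+1 = Num.max ((1 - c * gam n.+1) * m n) (b n)) ->
  dominated m (rate s 0).
Proof.
move=> c0 C0 s0 hb hm.
have h : \forall n \near \oo, [/\ 0 < rate s 0 n,
    c * gam n.+1 <= 1, rate s 0 n <= (1 + c / 2 * gam n.+1) * rate s 0 n.+1,
    b n <= C * rate s 0 n.+1 &
    m n.+1 = Num.max ((1 - c * gam n.+1) * m n) (b n)].
  near=> n; split.
  - by apply: rate_gt0; near: n; exact: nbhs_infty_gt.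
  - rewrite mulrC -ler_pdivlMr//; near: n; apply: near_step_le; exact: divr_gt0.
  - by near: n; exact: rate_slow_step.
  - by near: n.
  - by near: n.
case: h => n0 _ hn.
have [|||||C' C'0 hC'] := @max_bound R m (rate s 0) gam b c C n0 c0 C0.
- by move=> n /hn[].
- by move=> n /hn[_ ? _ _]; split => //; apply: ltW; exact: power_seq_gt0.
- by move=> n /hn[].
- by move=> n /hn[].
- by move=> n /hn[].
by exists C' => //; exists n0.
Unshelve. all: by end_near. Qed.

Section pathwise.
Context {d : nat}.
Variables (H : 'M[R]_d) (lam : R).
Hypotheses (H_posdef : posdef H) (lam_gt0 : 0 < lam).
Hypothesis coercive : forall X : 'M[R]_d, lam * normF X ^+ 2 <= dotF X (H *m X).
Variables (D e eta S1 S2 : nat -> 'M[R]_d) (sig p : R).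
Hypotheses (sig_gt0 : 0 < sig) (p_ge : 1 / 2 <= p).
Hypothesis D_rec : \forall n \near \oo,
  D n.+1 = D n - gam n.+1 *: lyap H (D n) - gam n.+1 *: e n + gam n.+1 *: eta n.
Hypothesis S1_rec : \forall n \near \oo,
  S1 n.+1 = S1 n - gam n.+1 *: lyap H (S1 n) + gam n.+1 *: eta n.
Hypothesis S2_rec : forall n, S2 n.+1 = S2 n + eta n.
Hypothesis S1_rate : dominated (fun n => normF (S1 n)) (rate (gamma / 2) (1 / 2)).
Hypothesis S2_rate :
  dominated (fun n => normF (S2 n)) (fun n => n%:R * rate (1 / 2) (1 / 2) n).
Hypothesis e_rate : dominated (fun n => normF (e n)) (rate (sig / 2) p).

Let s := Num.min gamma sig.
Let s1 := Num.min 1 sig.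

Let p_ge0 : 0 <= p. Proof. by move: p_ge; lra. Qed.
Let s_gt0 : 0 < s. Proof. by rewrite lt_min sig_gt0 andbT; move: gamma_gt; lra. Qed.
Let s1_gt0 : 0 < s1. Proof. by rewrite lt_min sig_gt0 ltr01. Qed.
Let s1_le1 : s1 <= 1. Proof. by rewrite ge_min lexx. Qed.

Let lyap_coercive := dotF_lyap H_posdef coercive.

Let near_contraction : \forall n \near \oo, forall X : 'M[R]_d,
  normF (X - gam n.+1 *: lyap H X) <= (1 - lam * gam n.+1) * normF X.
Proof.
near=> n => X; apply: lyap_contraction => //.
- by apply: ltW; exact: power_seq_gt0.
- by rewrite mulrC -ler_pdivlMr//; near: n; apply: near_step_le; exact: divr_gt0.
- have h0 : 0 < 4 * normF H ^+ 2 + 1 by rewrite ltr_wpDl// mulr_ge0 ?sqr_ge0.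
  apply: (@le_trans _ _ ((4 * normF H ^+ 2 + 1) * gam n.+1)).
    by rewrite ler_wpM2r ?lerDl//; apply: ltW; exact: power_seq_gt0.
  rewrite mulrC -ler_pdivlMr//; near: n; apply: near_step_le.
  by apply: divr_gt0; [exact: mulr_gt0|rewrite ltr_wpDl// mulr_ge0 ?sqr_ge0].
Unshelve. all: by end_near. Qed.

(** [D - S1] satisfies the recursion of [D] without the noise, so it is a contraction driven by [e]
    alone. *)
Lemma error_rate : dominated (fun n => normF (D n)) (rate (s / 2) p).
Proof.
have hs1 : \forall n \near \oo, rate (sig / 2) p n <= rate (s / 2) p n :> R.
  by apply: rate_mono => //; rewrite ler_pM2r// ge_min lexx orbT.
have hr : dominated (fun n => normF (D n - S1 n)) (rate (s / 2) p).
  case: e_rate => C C0 hC.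
  (* The factor 2 pays for moving the rate of [e n] from index [n] to [n.+1]. *)
  apply: (@dominated_contraction _ _ _ lam (2 * C)) => //.
  - by rewrite mulr_ge0.
  - by rewrite divr_ge0// ltW.
  near=> n.
  have g0 : 0 < gam n.+1 by exact: power_seq_gt0.
  have -> : D n.+1 - S1 n.+1 =
      (D n - S1 n) - gam n.+1 *: lyap H (D n - S1 n) - gam n.+1 *: e n.
    have -> : D n.+1 = D n - gam n.+1 *: lyap H (D n) - gam n.+1 *: e n + gam n.+1 *: eta n.
      by near: n.
    have -> : S1 n.+1 = S1 n - gam n.+1 *: lyap H (S1 n) + gam n.+1 *: eta n by near: n.
    by rewrite lyapB; apply/matrixP => i j; rewrite !mxE; ring.
  apply: le_trans (normF_triangleB _ _) _; apply: lerD.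
    by near: n; apply: filterS near_contraction => n; apply.
  rewrite normFZ gtr0_norm// ler_wpM2l ?(ltW g0)//.
  have h1 : normF (e n) <= C * rate (sig / 2) p n by near: n.
  have h2 : rate (sig / 2) p n <= rate (s / 2) p n by near: n.
  have h3 : rate (s / 2) p n <= 2 * rate (s / 2) p n.+1.
    by near: n; apply: rate_pred => //; rewrite divr_ge0// ltW.
  apply: (le_trans h1); rewrite [2 * C]mulrC -mulrA ler_wpM2l//.
  exact: le_trans h2 h3.
have hS : dominated (fun n => normF (S1 n)) (rate (s / 2) p).
  apply: dominated_trans S1_rate _; apply: dominated_near; apply: rate_mono => //.
  by rewrite ler_pM2r// ge_min lexx.
apply: dominated_le (dominated_add hr hS); near=> n.
by rewrite -[X in normF X <= _](subrK (S1 n)) normF_triangle.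
Unshelve. all: by end_near. Qed.

(** In the summed recursion the boundary term [(gam n)^-1 *: D n] has order n^(gamma - s/2), and the
    increments of 1 / gam contribute n^(gamma - 1 - s/2) at each step. This inequality keeps both
    within the averaged rate. *)
Let gamma_s1 : gamma - 1 - s / 2 <= - (s1 / 2).
Proof.
rewrite /s /s1; have [h|h] := leP gamma sig.
  have : Num.min 1 sig <= 1 by rewrite ge_min lexx.
  by move: gamma_lt1; lra.
by rewrite min_r; move: gamma_lt1 h; lra.
Qed.

Let Q n := \sum_(0 <= k < n) D k.

Lemma sum_error_rate :
  dominated (fun n => normF (Q n)) (fun n => n%:R * rate (s1 / 2) p n).
Proof.
have hD := error_rate.
(* Summing the recursion of [D]: up to the increments of [1 / gam], which are slow,
   and up to the noise, [lyap H (Q n)] telescopes. *)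
pose Y n := lyap H (Q n) + (gam n)^-1 *: D n - S2 n.
have Yrec : \forall n \near \oo,
    Y n.+1 = Y n + ((gam n.+1)^-1 - (gam n)^-1) *: D n - e n.
  near=> n; have g0 : 0 < gam n.+1 by exact: power_seq_gt0.
  have hrec : D n.+1 = D n - gam n.+1 *: lyap H (D n) - gam n.+1 *: e n + gam n.+1 *: eta n.
    by near: n.
  rewrite /Y /Q big_nat_recr//= lyapD S2_rec.
  have -> : (gam n.+1)^-1 *: D n.+1 = (gam n.+1)^-1 *: D n - lyap H (D n) - e n + eta n.
    rewrite hrec; set Ly := lyap H (D n).
    by apply/matrixP => i j; rewrite !mxE; field; rewrite gt_eqF.
  by apply/matrixP => i j; rewrite !mxE; ring.
(* Concavity of n^gamma bounds the increments of 1 / gam by a multiple of n^(gamma - 1). *)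
have Dgam : \forall n \near \oo,
    ((gam n.+1)^-1 - (gam n)^-1) * rate (s / 2) p n <= cgamma^-1 * rate (s1 / 2) p n.
  near=> n; have n0 : (0 < n)%N by near: n; exact: nbhs_infty_gt.
  have gV m : (0 < m)%N -> (gam m)^-1 = cgamma^-1 * m%:R `^ gamma.
    by move=> m0; rewrite /gam /power_seq invfM powRN invrK.
  rewrite !gV// -mulrBr -mulrA ler_pM2l ?invr_gt0//.
  apply: (@le_trans _ _ (n%:R `^ (gamma - 1) * rate (s / 2) p n)).
    rewrite ler_wpM2r ?rate_ge0//; apply: powRn_increment => //; last exact: ltW.
    by move: gamma_gt; lra.
  rewrite /rate mulrCA ler_wpM2l ?powR_ge0// -powRnD//.
  by apply: ler_powR; rewrite ?ler1n.
have es1 : \forall n \near \oo, rate (sig / 2) p n <= rate (s1 / 2) p n :> R.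
  by apply: rate_mono => //; rewrite ler_pM2r// ge_min lexx orbT.
have gam_dec : \forall n \near \oo, 0 <= (gam n.+1)^-1 - (gam n)^-1.
  near=> n; have n0 : (0 < n)%N by near: n; exact: nbhs_infty_gt.
  have gV m : (0 < m)%N -> (gam m)^-1 = cgamma^-1 * m%:R `^ gamma.
    by move=> m0; rewrite /gam /power_seq invfM powRN invrK.
  rewrite !gV// -mulrBr mulr_ge0 ?invr_ge0 ?(ltW cgamma_gt0)// subr_ge0.
  have gamma0 : 0 <= gamma by move: gamma_gt; lra.
  by apply: (ge0_ler_powR gamma0); rewrite ?nnegrE// ler_nat.
have hY : dominated (fun n => normF (Y n)) (fun n => n%:R * rate (s1 / 2) p n).
  case: hD => CD CD0 hCD; case: e_rate => Ce Ce0 hCe.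
  apply: (@sum_bound _ _ (CD * cgamma^-1 + Ce)).
  - by rewrite addr_ge0// mulr_ge0// invr_ge0 ltW.
  - by rewrite divr_ge0// ltW.
  - by move: s1_le1; lra.
  - exact: p_ge0.
  near=> n.
  have -> : Y n.+1 = Y n + ((gam n.+1)^-1 - (gam n)^-1) *: D n - e n by near: n.
  rewrite -addrA; apply: normFD => //; rewrite mulrDl.
  apply: le_trans (normF_triangleB _ _) _.
  have gd : 0 <= (gam n.+1)^-1 - (gam n)^-1 by near: n.
  apply: lerD.
    rewrite normFZ ger0_norm//.
    have h1 : normF (D n) <= CD * rate (s / 2) p n by near: n.
    apply: le_trans (ler_wpM2l gd h1) _; rewrite mulrCA -mulrA ler_wpM2l//.
    by near: n.
  have h1 : normF (e n) <= Ce * rate (sig / 2) p n by near: n.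
  by apply: (le_trans h1); rewrite ler_wpM2l//; near: n.
have hDg : dominated (fun n => normF ((gam n)^-1 *: D n)) (fun n => n%:R * rate (s1 / 2) p n).
  case: hD => CD CD0 hCD; exists (cgamma^-1 * CD).
    by rewrite mulr_ge0// invr_ge0 ltW.
  near=> n; have n0 : (0 < n)%N by near: n; exact: nbhs_infty_gt.
  have gV : (gam n)^-1 = cgamma^-1 * n%:R `^ gamma.
    by rewrite /gam /power_seq invfM powRN invrK.
  rewrite normFZ ger0_norm; last by rewrite gV mulr_ge0 ?powR_ge0// invr_ge0 ltW.
  have h1 : normF (D n) <= CD * rate (s / 2) p n by near: n.
  rewrite gV -!mulrA ler_pM2l ?invr_gt0//.
  apply: le_trans (ler_wpM2l (powR_ge0 _ _) h1) _; rewrite mulrCA ler_wpM2l//.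
  rewrite /rate mulrCA [leRHS]mulrCA ler_wpM2l ?powR_ge0// -powRnD//.
  have -> : n%:R * n%:R `^ (- (s1 / 2)) = n%:R `^ (1 - s1 / 2) :> R.
    by rewrite powRnD// powRr1.
  by apply: ler_powR; rewrite ?ler1n//; move: gamma_s1; lra.
have hS2 : dominated (fun n => normF (S2 n)) (fun n => n%:R * rate (s1 / 2) p n).
  apply: dominated_trans S2_rate _; apply: dominated_near.
  near=> n; rewrite ler_wpM2l//; near: n; apply: rate_mono => //.
  by rewrite ler_pM2r.
(* [lyap H (Q n)] is recovered from the definition of [Y n], and [lyap_inv] removes the operator at
   the cost of [(2 * lam)^-1]. *)
apply: (@dominated_le _ _ (fun n => (2 * lam)^-1 *
    (normF (Y n) + normF ((gam n)^-1 *: D n) + normF (S2 n)))).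
  near=> n; rewrite ler_pdivlMl ?mulr_gt0//.
  apply: le_trans (lyap_inv lam_gt0 lyap_coercive (Q n)) _.
  have -> : lyap H (Q n) = Y n - (gam n)^-1 *: D n + S2 n.
    by rewrite /Y; apply/matrixP => i j; rewrite !mxE; ring.
  by apply: normFD => //; exact: normF_triangleB.
apply: dominated_scale; first by rewrite invr_ge0 mulr_ge0// ltW.
by apply: dominated_add => //; exact: dominated_add.
Unshelve. all: by end_near. Qed.

End pathwise.
End step_sizes.

(** * Weighted averages *)

Section weighted.
Context {R : realType} {d : nat}.
Variable tau : R.
Hypothesis tau_ge0 : 0 <= tau.
Let w n := log_weight tau n.
Let ws n : R := \sum_(0 <= i < n.+1) w i.

Let w_ge0 n : 0 <= w n. Proof. exact: powR_ge0. Qed.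

Let w_mono m n : (m <= n)%N -> w m <= w n.
Proof.
move=> mn; apply: (ge0_ler_powR tau_ge0); rewrite ?nnegrE ?ln_ge0 ?ler1n//.
by rewrite ler_ln ?posrE ?ltr0n// ler_nat.
Qed.

Let w_gt0 n : (0 < n)%N -> 0 < w n.
Proof. by move=> n0; rewrite powR_gt0// ln_gt0n. Qed.

Let wsS n : ws n.+1 = ws n + w n.+1.
Proof. by rewrite /ws big_nat_recr. Qed.

Let ws_gt0 n : (0 < n)%N -> 0 < ws n.
Proof.
case: n => // n _; rewrite wsS ltr_wpDl ?w_gt0//.
by apply: sumr_ge0 => i _; exact: w_ge0.
Qed.

(** Multiplied by the total weight rather than divided, because for [tau > 0] that weight is zero at
    [n = 0], where the logarithm is [ln 1]. *)
Lemma weighted_averageE (A : nat -> 'M[R]_d) n :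
  ws n *: weighted_average tau A n = \sum_(0 <= i < n.+1) w i *: A i.
Proof.
elim: n => [|n IH]; first by rewrite /ws !big_nat1.
rewrite big_nat_recr//= -IH -/(ws n.+1) -/(w n.+1) scalerDr !scalerA.
have h : ws n.+1 != 0 by rewrite gt_eqF// ws_gt0.
have -> : ws n.+1 * (w n.+1 / ws n.+1) = w n.+1 by field.
by congr (_ *: _ + _); rewrite mulrBr mulr1 wsS -wsS; rewrite wsS in h *; field.
Qed.

(** Keep the indices from [m = n./2] on, at least half of [n] in number. As n + 1 <= (m + 1)^2,
    their logarithms are at least half of the last one, so each weight is at least 2^(-tau) times
    [w n]. *)
Lemma log_weight_sum_ge n : (2 < n)%N -> n%:R / 2 * (2 `^ tau)^-1 * w n <= ws n.
Proof.
move=> n2; set m := n./2.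
have mn : (m <= n)%N by rewrite /m -{2}[n]odd_double_half -addnn addnA leq_addl.
have mn2 : (n <= m.*2.+1)%N by rewrite /m -{1}[n]odd_double_half; case: (odd n).
have hw : (2 `^ tau)^-1 * w n <= w m.
  rewrite ler_pdivrMl ?powR_gt0// /w /log_weight -powRM//; last first.
    by rewrite ln_ge0// ler1n.
  apply: (ge0_ler_powR tau_ge0); rewrite ?nnegrE ?mulr_ge0 ?ln_ge0 ?ler1n//.
  rewrite mulr_natl -lnXn ?ltr0n// ler_ln ?posrE ?exprn_gt0 ?ltr0n//.
  rewrite -natrX ler_nat -mulnn.
  have m1 : (1 <= m)%N by rewrite /m; case: (n) n2 => [|[|k]].
  apply: (@leq_trans (2 * m.+1)); first by rewrite mul2n doubleS ltnS.
  by rewrite leq_mul2r ltnS m1.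
rewrite /ws (big_cat_nat (n := m))//=; last exact: leqW.
apply: (@le_trans _ _ (\sum_(m <= i < n.+1) w m)).
  rewrite sumr_const_nat -[leRHS]mulr_natl -mulrA; apply: ler_pM => //.
    by rewrite mulr_ge0 ?invr_ge0 ?powR_ge0.
  rewrite ler_pdivrMr// -natrM ler_nat.
  by rewrite mulnC mul2n -addnn; move: mn mn2; rewrite -addnn; lia.
rewrite ler_wpDl//; first by apply: sumr_ge0 => i _; exact: w_ge0.
rewrite !big_nat; apply: ler_sum => i /andP[mi _]; exact: w_mono.
Qed.

(** Abel summation: up to a constant, the weighted sum is [w n *: Q n.+1] minus a sum of terms
    [(w k.+1 - w k) *: Q k.+1]. As the weights and the bound [v] are nondecreasing, that sum is at
    most the last weight times the last bound. The total weight is at least a multiple of [n * w n],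
    and dividing by it restores the rate. *)
Lemma weighted_average_rate (A : nat -> 'M[R]_d) K (s p : R) :
  0 <= s -> s < 1 -> 0 <= p ->
  dominated (fun n => normF (\sum_(0 <= k < n) (A k - K))) (fun n => n%:R * rate s p n) ->
  dominated (fun n => normF (weighted_average tau A n - K)) (rate s p).
Proof.
move=> s0 s1 p0; pose Q n := \sum_(0 <= k < n) (A k - K).
pose v n : R := n%:R * rate s p n.
pose Y n := \sum_(0 <= i < n.+1) w i *: (A i - K).
rewrite -/Q => -[B B0 [N1 _ hQ]].
pose N := maxn N1 2.
have {}hQ n : (N <= n)%N -> normF (Q n) <= B * v n.
  by move=> h; apply: hQ; exact: leq_trans (leq_maxl _ _) h.
have v0 n : 0 <= v n by rewrite mulr_ge0 ?rate_ge0.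
have v_mono n : (0 < n)%N -> v n <= v n.+1.
  move=> n0; have vE m : (0 < m)%N -> v m = ln m%:R `^ p * m%:R `^ (1 - s).
    by move=> m0; rewrite /v /rate mulrCA; congr (_ * _); rewrite powRnD// powRr1.
  have n1 := @natr_gt0 R _ n0; have n2 := @natr_gt0 R _ (ltn0Sn n).
  have s2 : 0 <= 1 - s by rewrite subr_ge0 ltW.
  rewrite !vE//; apply: ler_pM; rewrite ?powR_ge0//.
    apply: (ge0_ler_powR p0); rewrite ?nnegrE ?ln_ge0 ?ler1n//.
    by rewrite ler_ln ?posrE// ler_nat.
  by apply: (ge0_ler_powR s2); rewrite ?nnegrE// ler_nat.
pose U n := Y n - w n *: Q n.+1.
have US n : U n.+1 = U n - (w n.+1 - w n) *: Q n.+1.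
  have QS : Q n.+2 = Q n.+1 + (A n.+1 - K) by rewrite /Q big_nat_recr.
  have YS : Y n.+1 = Y n + w n.+1 *: (A n.+1 - K) by rewrite /Y big_nat_recr.
  by rewrite /U YS QS; apply/matrixP => i j; rewrite !mxE; ring.
have hU n : (N <= n)%N -> normF (U n) <= normF (U N) + w n * (B * v n.+1).
  elim: n => [|n IH]; first by rewrite leqn0 => /eqP h; have := leq_maxr N1 2; rewrite -/N h.
  rewrite leq_eqVlt => /predU1P[<-|]; first by rewrite lerDl; apply: mulr_ge0 => //; apply: mulr_ge0.
  rewrite ltnS => nn; have n0 : (0 < n)%N by exact: leq_trans (leq_trans _ (leq_maxr N1 2)) nn.
  rewrite US; apply: le_trans (normF_triangleB _ _) _.
  have h1 : normF ((w n.+1 - w n) *: Q n.+1) <= (w n.+1 - w n) * (B * v n.+1).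
    have ww : 0 <= w n.+1 - w n by rewrite subr_ge0 w_mono.
    by rewrite normFZ ger0_norm// ler_wpM2l// hQ// leqW.
  apply: le_trans (lerD (IH nn) h1) _; rewrite -addrA lerD2l -mulrDl subrKC.
  by rewrite ler_wpM2l// ler_wpM2l// v_mono.
have hY n : (N <= n)%N -> normF (Y n) <= normF (U N) + 2 * (w n * (B * v n.+1)).
  move=> nn; rewrite -[Y n](subrK (w n *: Q n.+1)); apply: le_trans (normF_triangle _ _) _.
  rewrite -/(U n) [2 * _]mulr_natl mulr2n addrA; apply: lerD; first exact: hU.
  by rewrite normFZ ger0_norm// ler_wpM2l// hQ// leqW.
have avgE n : (0 < n)%N -> weighted_average tau A n - K = (ws n)^-1 *: Y n.
  move=> n0; have h : ws n != 0 by rewrite gt_eqF// ws_gt0.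
  have -> : Y n = ws n *: (weighted_average tau A n - K).
    rewrite scalerBr weighted_averageE /Y /ws scaler_suml -sumrB.
    by apply: eq_bigr => i _; rewrite scalerBr.
  by rewrite scalerA mulVf// scale1r.
pose c := 2 * 2 `^ tau.
have c0 : 0 <= c by rewrite mulr_ge0 ?powR_ge0.
exists (c * (normF (U N) + 2 * (B * (2 * 2 `^ p)))).
  by rewrite mulr_ge0// addr_ge0 ?normF_ge0// !mulr_ge0 ?powR_ge0.
near=> n.
have n2 : (2 < n)%N by near: n; exact: nbhs_infty_gt.
have n0 : (0 < n)%N by exact: ltn_trans n2.
have n0R := @natr_gt0 R _ n0.
have Nn : (N <= n)%N by near: n; exact: nbhs_infty_ge.
rewrite avgE// normFZ ger0_norm ?invr_ge0 ?(ltW (ws_gt0 n0))//.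
rewrite ler_pdivrMl ?ws_gt0//.
have w1 : 1 <= w n.
  have l1 : 1 <= ln n%:R :> R by near: n; exact: near_ln_ge.
  have -> : 1 = 1 `^ tau :> R by rewrite powR1.
  apply: (ge0_ler_powR tau_ge0); rewrite ?nnegrE ?ln_ge0 ?ler1n//.
  by rewrite (le_trans l1)// ler_ln ?posrE// ler_nat.
(* The initial part [normF (U N)] is constant, hence O(1/n) after the division by the total weight;
   this is where [s < 1] absorbs it. *)
have rn : n%:R^-1 <= rate s p n.
  have h : rate 1 0 n <= rate s p n :> R.
    by near: n; apply: rate_mono => //; exact: ltW.
  by move: h; rewrite /rate powRr0 mul1r powR_inv1.
have vn : v n.+1 <= 2 * 2 `^ p * v n.
  rewrite /v (_ : 2 * 2 `^ p * _ = (2 * n%:R) * (2 `^ p * rate s p n)); last by ring.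
  apply: ler_pM; rewrite ?rate_ge0//.
    by rewrite -(natr1 n) [leRHS]mulr_natl mulr2n lerD2l ler1n.
  by near: n; exact: rate_succ.
apply: le_trans (hY _ Nn) _.
have hw := log_weight_sum_ge n2.
set T := rate s p n in rn *.
have h2 : w n * n%:R <= c * ws n.
  have t0 : 0 < 2 `^ tau :> R by rewrite powR_gt0.
  rewrite /c mulrC; move: hw; rewrite -mulrA -(ler_pM2l (_ : 0 < 2 * 2 `^ tau)) ?mulr_gt0//.
  by congr (_ <= _); field; rewrite gt_eqF.
set k1 := normF (U N); set k2 := B * (2 * 2 `^ p).
have k10 : 0 <= k1 by exact: normF_ge0.
have k20 : 0 <= k2 by rewrite mulr_ge0// mulr_ge0 ?powR_ge0.
apply: (@le_trans _ _ (w n * n%:R * T * (k1 + 2 * k2))); last first.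
  rewrite (_ : ws n * _ = (c * ws n) * (T * (k1 + 2 * k2))); last by ring.
  rewrite -mulrA ler_wpM2r// mulr_ge0 ?rate_ge0// addr_ge0// mulr_ge0//.
rewrite mulrDr; apply: lerD.
  rewrite -[leLHS]mul1r ler_wpM2r//.
  apply: (@le_trans _ _ (w n * (n%:R * n%:R^-1))); first by rewrite divff ?gt_eqF// mulr1.
  by rewrite -mulrA ler_wpM2l// ler_wpM2l.
rewrite (_ : w n * n%:R * T * _ = 2 * (w n * (B * (2 * 2 `^ p * v n)))); last first.
  by rewrite /k2 /v -/T; ring.
by rewrite ler_wpM2l// ler_wpM2l// ler_wpM2l.
Unshelve. all: by end_near. Qed.

End weighted.

(** * Independence *)

Section independence.
Context {disp : measure_display} {T : measurableType disp} {R : realType}.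
Variable P : probability T R.
Local Open Scope ereal_scope.

Lemma independent2C (S1 S2 : set (set T)) :
  independent2 P S1 S2 -> independent2 P S2 S1.
Proof. by move=> h A B SA SB; rewrite setIC h// muleC. Qed.

(** Dynkin's argument at fixed [B]: the sets that satisfy the product formula form a lambda-system
    containing the pi-system [S1]. *)
Lemma independent2_sigma (S1 S2 : set (set T)) :
  setI_closed S1 -> S1 `<=` measurable -> S2 `<=` measurable ->
  independent2 P S1 S2 -> independent2 P <<s S1>> S2.
Proof.
move=> S1I S1m S2m S12 A B SA SB.
have mB := S2m _ SB.
pose L : set (set T) := [set A | measurable A /\ P (A `&` B) = P A * P B].
suff : <<s S1>> `<=` L by move=> /(_ _ SA)[].
apply: lambda_system_subset => //; last first.
- by move=> C SC; split; [exact: S1m|exact: S12].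
- split => //.
  + by split; [exact: measurableT|rewrite setTI probability_setT mul1e].
  + move=> C D DC [mC hC] [mD hD]; split; first exact: measurableD.
    have -> : (C `\` D) `&` B = (C `&` B) `\` (D `&` B).
      rewrite eqEsubset; split => x /=; first by move=> [[? nD] ?]; split => // -[].
      by move=> [[? ?] nD]; split => //; split => // ?; exact: nD.
    have pfin E : measurable E -> P E < +oo.
      by move=> mE; rewrite ltey_eq fin_num_measure.
    rewrite !measureD//; [|exact: pfin|exact: measurableI|exact: measurableI|
      by apply: pfin; exact: measurableI].
    rewrite (_ : C `&` B `&` (D `&` B) = D `&` B); last first.
      by rewrite setIACA setIid (setIidr DC).
    rewrite (setIidr DC); transitivity (P C * P B - P D * P B).
      exact: (congr2 (fun x y => x - y) hC hD).
    by rewrite muleBl// ?fin_num_measure// fin_num_adde_defl// fin_numN fin_num_measure.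
  + move=> F ndF LF.
    have mF i : measurable (F i) by case: (LF i).
    have mUF : measurable (\bigcup_i F i) by exact: bigcup_measurable.
    split => //; rewrite setI_bigcupl.
    have h1 : (fun i => P (F i `&` B)) @ \oo --> P (\bigcup_i (F i `&` B)).
      apply: nondecreasing_cvg_mu => [i||i j ij]; first exact: measurableI.
        by apply: bigcup_measurable => i _; exact: measurableI.
      by apply/subsetPset; apply: setSI; apply/subsetPset; exact: ndF.
    have h2 : (fun i => P (F i) * P B) @ \oo --> P (\bigcup_i F i) * P B.
      apply: cvgeZr; first by rewrite fin_num_measure.
      exact: nondecreasing_cvg_mu.
    have h3 : (fun i => P (F i `&` B)) = (fun i => P (F i) * P B).
      by apply/funext => i; case: (LF i).
    have h4 : (fun i => P (F i `&` B)) @ \oo --> P (\bigcup_i F i) * P B.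
      by rewrite h3.
    exact: cvg_unique h1 h4.
Qed.

Section independent_pair.
Context {d1 d2 : measure_display} {E1 : measurableType d1} {E2 : measurableType d2}.
Variables (Y : {mfun T >-> E1}) (V : {mfun T >-> E2}).
Hypothesis YV : forall A B, measurable A -> measurable B ->
  P (Y @^-1` A `&` V @^-1` B) = P (Y @^-1` A) * P (V @^-1` B).

Let YVf w := (Y w, V w).
Let mYV : measurable_fun setT YVf.
Proof. exact: measurable_fun_pair. Qed.

Lemma distribution_pair (C : set (E1 * E2)) : measurable C ->
  (distribution P Y \x distribution P V) C = P (YVf @^-1` C).
Proof.
move=> mC.
pose YVm : {mfun T >-> (E1 * E2)%type} := HB.pack YVf (isMeasurableFun.Build _ _ _ _ _ mYV).
rewrite -[RHS]/(distribution P YVm C).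
by apply: product_measure_unique.
Qed.

(** The joint law is the product of the laws, so Tonelli lets [Y] be frozen while [V] is integrated
    out. *)
Lemma integral_independent_pair (phi : E1 * E2 -> \bar R) :
  measurable_fun [set: (E1 * E2)%type] phi -> (forall x, 0 <= phi x) ->
  \int[P]_w phi (Y w, V w) = \int[P]_w' \int[P]_w phi (Y w', V w).
Proof.
move=> mphi phi0.
have -> : \int[P]_w phi (Y w, V w) = \int[distribution P Y \x distribution P V]_x phi x.
  transitivity (\int[pushforward P YVf]_x phi x).
    by rewrite ge0_integral_pushforward.
  by apply: eq_measure_integral => C mC _; exact: esym (distribution_pair mC).
rewrite fubini_tonelli1// ge0_integral_pushforward//.
- apply: eq_integral => w _ /=; rewrite /fubini_F ge0_integral_pushforward//.
  exact: measurableT_comp mphi _.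
- exact: measurable_fun_fubini_tonelli_F.
- by move=> x _; apply: integral_ge0.
Qed.

Lemma measurable_independent_integral (phi : E1 * E2 -> \bar R) :
  measurable_fun [set: (E1 * E2)%type] phi -> (forall x, 0 <= phi x) ->
  measurable_fun setT (fun w' => \int[P]_w phi (Y w', V w)).
Proof.
move=> mphi phi0.
have -> : (fun w' => \int[P]_w phi (Y w', V w)) =
    fubini_F (distribution P V) phi \o Y.
  apply/funext => w' /=; rewrite /fubini_F ge0_integral_pushforward//.
  exact: measurableT_comp mphi _.
by apply: measurableT_comp => //; exact: measurable_fun_fubini_tonelli_F.
Qed.

Lemma integrable_independent_mul (u : E1 -> R) (v : E2 -> R) :
  measurable_fun setT u -> measurable_fun setT v ->
  P.-integrable setT (fun w => (u (Y w))%:E) ->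
  P.-integrable setT (fun w => (v (V w))%:E) ->
  P.-integrable setT (fun w => (u (Y w) * v (V w))%:E) /\
  \int[P]_w (u (Y w) * v (V w))%:E =
    (\int[P]_w (u (Y w))%:E) * (\int[P]_w (v (V w))%:E).
Proof.
move=> mu mv iu iv.
pose f (x : E1 * E2) := (u x.1 * v x.2)%:E.
have mf : measurable_fun [set: (E1 * E2)%type] f.
  apply/measurable_EFinP; apply: measurable_funM.
    exact: measurableT_comp mu measurable_fst.
  exact: measurableT_comp mv measurable_snd.
have mYV1 : measurable_fun setT (fun w => (u (Y w) * v (V w))%:E).
  exact: measurableT_comp mf mYV.
have [_ iu'] := integrableP _ _ _ iu; have [_ iv'] := integrableP _ _ _ iv.
have iuv : P.-integrable setT (fun w => (u (Y w) * v (V w))%:E).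
  apply/integrableP; split => //.
  rewrite (integral_independent_pair (phi := fun x => `|f x|))//; last first.
    exact: measurableT_comp (@abse_measurable _ _) mf.
  rewrite (eq_integral (fun w => `|(u (Y w))%:E| * \int[P]_w `|(v (V w))%:E|)).
    rewrite ge0_integralZr//; last by apply: integral_ge0.
      by rewrite lte_mul_pinfty// ?ge0_fin_numE// integral_ge0.
    exact: measurableT_comp (@abse_measurable _ _) (measurable_int _ iu).
  move=> w _; rewrite -ge0_integralZl//.
    by apply: eq_integral => x _; rewrite /f /= normrM EFinM.
  exact: measurableT_comp (@abse_measurable _ _) (measurable_int _ iv).
split => //.
have ifp : (pushforward P YVf).-integrable [set: (E1 * E2)%type] f.
  exact: integrable_pushforward.
transitivity (\int[pushforward P YVf]_x f x).
  by rewrite integral_pushforward.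
have eqm C : measurable C -> C `<=` setT ->
    pushforward P YVf C = (distribution P Y \x distribution P V) C.
  by move=> mC _; exact: esym (distribution_pair mC).
have ifp2 : (distribution P Y \x distribution P V).-integrable
    [set: (E1 * E2)%type] f.
  have [_ fp] := integrableP _ _ _ ifp; apply/integrableP; split => //.
  by rewrite (eq_measure_integral (pushforward P YVf))// => C mC CT; exact: esym (eqm _ mC CT).
rewrite (eq_measure_integral (distribution P Y \x distribution P V)%E)//.
rewrite -integral12_prod_meas1//.
set c := \int[P]_w (v (V w))%:E.
have cfin : c \is a fin_num by exact: integrable_fin_num.
have FE : fubini_F (distribution P V) f = fun x => (u x)%:E * c.
  apply/funext => x; rewrite /fubini_F integral_pushforward//.
  - by rewrite /c -integralZl.
  - exact: measurableT_comp mf _.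
  - by rewrite preimage_setT; exact: (integrableZl measurableT (u x) iv).
rewrite FE -(fineK cfin) -integralZr// integral_pushforward//.
  by apply/measurable_EFinP; apply: measurable_funM.
by rewrite preimage_setT; exact: (integrableZr measurableT (fine c) iu).
Qed.

End independent_pair.

(** The finitely many events where the bound may fail are replaced by the empty set; the series
    telescopes through 1/(a+1)^2 <= 1/a - 1/(a+1). *)
Lemma borel_cantelli_sqr (E : nat -> set T) (C : R) :
  (forall n, measurable (E n)) ->
  (\forall n \near \oo, P (E n) <= (C * (n%:R ^+ 2)^-1)%:E) ->
  {ae P, forall w, \forall n \near \oo, ~ E n w}.
Proof.
move=> mE [n0 _ hE].
pose F n := if (maxn n0 2 <= n)%N then E n else set0.
have mF n : measurable (F n) by rewrite /F; case: ifP.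
have C0 : (0 <= C)%R.
  have h : (n0 <= maxn n0 2)%N by exact: leq_maxl.
  have p0 : (0 < ((maxn n0 2)%:R ^+ 2)^-1 :> R)%R.
    by rewrite invr_gt0 exprn_gt0// ltr0n (leq_trans _ (leq_maxr _ _)).
  by have := le_trans (measure_ge0 P _) (hE _ h); rewrite lee_fin (pmulr_lge0 _ p0).
have PF n : P (F n.+2) <= (C * (n.+2%:R ^+ 2)^-1)%:E.
  rewrite /F; case: ifPn => h; first by apply: hE; exact: leq_trans (leq_maxl _ _) h.
  by rewrite measure0 lee_fin mulr_ge0// invr_ge0 sqr_ge0.
have sumF m : \sum_(0 <= k < m.+2) P (F k) <= (C * (1 - m.+1%:R^-1))%:E.
  elim: m => [|m IH].
    rewrite !big_nat_recr//= big_nil invr1 subrr mulr0.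
    by rewrite /F !geq_max !andbF !measure0 !addr0.
  rewrite big_nat_recr//=; apply: le_trans (leeD IH (PF m)) _.
  rewrite -EFinD lee_fin -mulrDr ler_wpM2l//.
  have a0 : (0 < m.+1%:R :> R)%R by rewrite ltr0n.
  rewrite -(natr1 m.+1); set a := m.+1%:R%R in a0 *.
  rewrite -subr_ge0 (_ : _ - _ = (a * (a + 1) ^+ 2)^-1)%R; last first.
    by field; rewrite !gt_eqF// addr_gt0.
  by rewrite invr_ge0 mulr_ge0 ?sqr_ge0 ?ltW.
have lim0 : P (lim_sup_set F) = 0.
  apply: lim_sup_set_cvg0 => //; apply: (@le_lt_trans _ _ C%:E); last exact: ltry.
  apply: lime_le; first by apply: is_cvg_nneseries.
  near=> m; have m2 : (2 <= m)%N by near: m; exact: nbhs_infty_ge.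
  rewrite -(subnKC m2) add2n; apply: le_trans (sumF _) _.
  by rewrite lee_fin ler_piMr// gerBl invr_ge0.
exists (lim_sup_set F); split => //.
  apply: bigcapT_measurable => n; apply: bigcup_measurable => k _; exact: mF.
move=> w /= notE n _; apply: contrapT => notF; apply: notE.
exists (maxn n (maxn n0 2)) => // k /= hk Ek; apply: notF.
exists k; first exact: leq_trans (leq_maxl _ _) hk.
by rewrite /F (leq_trans (leq_maxr _ _) hk).
Unshelve. all: by end_near. Qed.

Section same_law.
Context {dE : measure_display} {E : measurableType dE}.
Variables (U V : {RV P >-> E}) (f : E -> R).
Hypotheses (UV : same_law V U) (mf : measurable_fun setT f).

Lemma same_law_ge0_integral : (forall x, (0 <= f x)%R) ->
  \int[P]_w (f (V w))%:E = \int[P]_w (f (U w))%:E.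
Proof.
move=> f0; have h (Y : {RV P >-> E}) :
    \int[P]_w (f (Y w))%:E = \int[distribution P Y]_x (f x)%:E.
  rewrite [RHS]ge0_integral_pushforward//; first exact/measurable_EFinP.
  by move=> x _; rewrite lee_fin.
rewrite !h; apply: eq_measure_integral => A mA _; exact: UV.
Qed.

Lemma same_law_integral : P.-integrable setT (fun w => (f (U w))%:E) ->
  P.-integrable setT (fun w => (f (V w))%:E) /\
  \int[P]_w (f (V w))%:E = \int[P]_w (f (U w))%:E.
Proof.
move=> iU; have mfE : measurable_fun setT (EFin \o f) by exact/measurable_EFinP.
have iV : P.-integrable setT (fun w => (f (V w))%:E).
  have mfV : measurable_fun setT (fun w => f (V w)) by exact: measurableT_comp mf _.
  apply/integrableP; split; first exact/measurable_EFinP.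
  have [_] := integrableP _ _ _ iU.
  suff -> : \int[P]_w `|(f (V w))%:E| = \int[P]_w `|(f (U w))%:E| by [].
  have hn (Y : {RV P >-> E}) :
      \int[P]_w `|(f (Y w))%:E| = \int[distribution P Y]_x `|(f x)%:E|.
    rewrite [RHS]ge0_integral_pushforward//.
    exact: measurableT_comp (@abse_measurable _ _) mfE.
  by rewrite !hn; apply: eq_measure_integral => A mA _; exact: UV.
split => //.
have h (Y : {RV P >-> E}) : P.-integrable setT (fun w => (f (Y w))%:E) ->
    \int[P]_w (f (Y w))%:E = \int[distribution P Y]_x (f x)%:E.
  by move=> iY; rewrite [RHS]integral_pushforward.
rewrite !h//; apply: eq_measure_integral => A mA _; exact: UV.
Qed.

End same_law.

End independence.

(** * Independence of the fresh pair from the past *)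

Section fresh_noise.
Context {disp : measure_display} {T : measurableType disp} {R : realType}.
Variable P : probability T R.
Context {d1 d2 : measure_display} {E1 : measurableType d1} {E2 : measurableType d2}.
Variables (X : nat -> {RV P >-> E1}) (Z : nat -> {RV P >-> E2}).
Hypotheses (X_iid : iid X) (Z_iid : iid Z).
Hypothesis XZ_indep : independent2 P (sigma_seq X) (sigma_seq Z).
Local Open Scope ereal_scope.

Let idx n : {fset nat} := [fset k in iota 1 n]%fset.

Let idxE n : [set` idx n] = [set k | (1 <= k <= n)%N].
Proof.
by apply/seteqP; split => k /=; rewrite !inE /= mem_iota add1n ltnS.
Qed.

(** Intersection-stable generators of [sigma_upto X Z n], split into an [X] part and a [Z] part so
    that [XZ_indep] can separate the two. *)
Let cylinders n : set (set T) := [set A | exists U V,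
  [/\ forall k, measurable (U k), forall k, measurable (V k) &
      A = \bigcap_(k in [set` idx n]) (X k @^-1` U k) `&`
          \bigcap_(k in [set` idx n]) (Z k @^-1` V k)]].

Let rectangles n : set (set T) := [set A | exists U V,
  [/\ measurable U, measurable V & A = X n @^-1` U `&` Z n @^-1` V]].

Let cylindersI n : setI_closed (cylinders n).
Proof.
move=> _ _ [U [V [mU mV ->]]] [U' [V' [mU' mV' ->]]].
exists (fun k => U k `&` U' k), (fun k => V k `&` V' k).
split; [by move=> k; exact: measurableI|by move=> k; exact: measurableI|].
by rewrite setIACA -!bigcapI.
Qed.

Let rectanglesI n : setI_closed (rectangles n).
Proof.
move=> _ _ [U [V [mU mV ->]]] [U' [V' [mU' mV' ->]]].
exists (U `&` U'), (V `&` V'); split; [exact: measurableI|exact: measurableI|].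
by rewrite setIACA !preimage_setI.
Qed.

Let mpre d (E : measurableType d) (Y : {RV P >-> E}) (U : set E) :
  measurable U -> measurable (Y @^-1` U).
Proof. by move=> mU; exact: measurable_funPTI. Qed.

Let cylinders_measurable n : cylinders n `<=` measurable.
Proof.
move=> _ [U [V [mU mV ->]]]; apply: measurableI.
  by apply: fin_bigcap_measurable => // k _; exact: mpre.
by apply: fin_bigcap_measurable => // k _; exact: mpre.
Qed.

Let rectangles_measurable n : rectangles n `<=` measurable.
Proof. by move=> _ [U [V [mU mV ->]]]; apply: measurableI; exact: mpre. Qed.

Let g_pre d (E : measurableType d) (Y : {RV P >-> E}) (U : set E) :
  measurable U -> g_sigma_algebra_preimage Y (Y @^-1` U).
Proof. by move=> mU; exists U => //; rewrite setTI. Qed.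

Let sigma_seq_cap d (E : measurableType d) (Y : nat -> {RV P >-> E}) n U :
  (forall k, measurable (U k)) ->
  sigma_seq Y (\bigcap_(k in [set` idx n]) (Y k @^-1` U k)).
Proof.
move=> mU.
pose G := \bigcup_(k in [set k | (1 <= k)%N]) g_sigma_algebra_preimage (Y k).
suff : (@measurable _ (g_sigma_algebraType G))
   (\bigcap_(k in [set` idx n]) (Y k @^-1` U k)) by [].
apply: bigcap_measurableType => k; rewrite idxE => /andP[k1 _].
by apply: sub_sigma_algebra; exists k => //; exact: g_pre.
Qed.

Let sigma_seqI d (E : measurableType d) (Y : nat -> {RV P >-> E}) A B :
  sigma_seq Y A -> sigma_seq Y B -> sigma_seq Y (A `&` B).
Proof.
pose G := \bigcup_(k in [set k | (1 <= k)%N]) g_sigma_algebra_preimage (Y k).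
exact: (@measurableI _ (g_sigma_algebraType G)).
Qed.

Let sigma_seq_pre d (E : measurableType d) (Y : nat -> {RV P >-> E}) n U :
  measurable U -> sigma_seq Y (Y n.+1 @^-1` U).
Proof. by move=> mU; apply: sub_sigma_algebra; exists n.+1 => //; exact: g_pre. Qed.

Let iid_cap d (E : measurableType d) (Y : nat -> {RV P >-> E}) n U V : iid Y ->
  (forall k, measurable (U k)) -> measurable V ->
  P (\bigcap_(k in [set` idx n]) (Y k @^-1` U k) `&` Y n.+1 @^-1` V) =
  P (\bigcap_(k in [set` idx n]) (Y k @^-1` U k)) * P (Y n.+1 @^-1` V).
Proof.
move=> [Yind _] mU mV.
pose F k := if k == n.+1 then Y n.+1 @^-1` V else Y k @^-1` U k.
have nidx : n.+1 \notin idx n by rewrite !inE /= mem_iota add1n ltnn andbF.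
have FE k : k \in idx n -> F k = Y k @^-1` U k.
  by move=> kn; rewrite /F; case: eqP => // kE; rewrite -kE kn in nidx.
have Fg (J : {fset nat}) k : k \in J -> g_sigma_algebra_preimage (Y k) (F k).
  by rewrite /F; case: eqP => [->|_] _; exact: g_pre.
have Jn : [set` idx n] `<=` [set k | (1 <= k)%N].
  by rewrite idxE => k /andP[].
have h1 := Yind (idx n) Jn F (@Fg _).
have h2 := Yind (n.+1 |` idx n)%fset _ F (@Fg _).
rewrite big_fsetU1//= in h2.
have -> : \bigcap_(k in [set` idx n]) (Y k @^-1` U k) = \bigcap_(k in [set` idx n]) F k.
  by apply: eq_bigcapr => k /FE.
have -> : Y n.+1 @^-1` V = F n.+1 by rewrite /F eqxx.
rewrite h1 muleC -h2; last first.
  by move=> k /= /fset1UP[->//|kn]; exact: Jn.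
by rewrite bigcap_fsetU1 setIC.
Qed.

(** After regrouping the [X] sets and the [Z] sets, [XZ_indep] separates the two sequences, and
    [iid_cap] separates time [n.+1] from the earlier times within each of them. *)
Let cylinders_rectangles n : independent2 P (cylinders n) (rectangles n.+1).
Proof.
move=> _ _ [U [V [mU mV ->]]] [U' [V' [mU' mV' ->]]].
rewrite setIACA.
have sX := @sigma_seq_cap _ _ X n _ mU; have sZ := @sigma_seq_cap _ _ Z n _ mV.
have sX1 := @sigma_seq_pre _ _ X n _ mU'; have sZ1 := @sigma_seq_pre _ _ Z n _ mV'.
rewrite (XZ_indep (sigma_seqI sX sX1) (sigma_seqI sZ sZ1)).
by rewrite (XZ_indep sX sZ) (XZ_indep sX1 sZ1) !iid_cap// muleACA.
Qed.

(** Two passages from a pi-system to its sigma-algebra: one for the past, generated by the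
    cylinders, and one for the fresh pair, generated by the rectangles. *)
Lemma sigma_upto_fresh n (A : set T) (B : set (E1 * E2)) :
  sigma_upto X Z n A -> measurable B ->
  P (A `&` (fun w => (X n.+1 w, Z n.+1 w)) @^-1` B) =
  P A * P ((fun w => (X n.+1 w, Z n.+1 w)) @^-1` B).
Proof.
move=> sA mB.
have h1 : independent2 P <<s cylinders n>> (rectangles n.+1).
  apply: independent2_sigma; [exact: cylindersI|exact: cylinders_measurable|
    exact: rectangles_measurable|exact: cylinders_rectangles].
have sm : <<s cylinders n>> `<=` measurable.
  apply: smallest_sub; first exact: sigma_algebra_measurable.
  exact: cylinders_measurable.
have h2 : independent2 P <<s rectangles n.+1>> <<s cylinders n>>.
  apply: independent2_sigma; [exact: rectanglesI|exact: rectangles_measurable|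
    exact: sm|exact: independent2C].
rewrite setIC muleC; apply: h2.
  pose G := rectangles n.+1.
  have : measurable_fun setT
     (fun w : g_sigma_algebraType G => (X n.+1 w, Z n.+1 w)).
    apply: measurable_fun_pair => _ U mU; rewrite setTI; apply: sub_sigma_algebra.
      by exists U, setT; split => //; rewrite preimage_setT setIT.
    by exists setT, U; split => //; rewrite preimage_setT setTI.
  by move=> /(_ measurableT _ mB); rewrite setTI.
apply: smallest_sub sA; first exact: smallest_sigma_algebra.
move=> C [k /= kn].
have kidx : [set` idx n] k by rewrite idxE.
have cap1 d (E : measurableType d) (Y : nat -> {RV P >-> E}) (U : set E) :
    Y k @^-1` U = \bigcap_(j in [set` idx n])
      (Y j @^-1` (if j == k then U else setT)).
  apply/seteqP; split => [w Uw j _|w /(_ _ kidx)] /=; last by rewrite eqxx.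
  by case: eqP => [->|].
case=> -[U mU <-]; rewrite setTI; apply: sub_sigma_algebra.
  exists (fun j => if j == k then U else setT), (fun=> setT).
  split => //; first by move=> j; case: ifP.
  by rewrite -cap1 bigcapT ?setIT.
exists (fun=> setT), (fun j => if j == k then U else setT).
split => //; first by move=> j; case: ifP.
by rewrite -cap1 bigcapT ?setTI.
Qed.

(** Phrased by preimages, as the hypothesis on [thetah] is; [adaptedP] translates it to
    measurability on the generated sigma-algebra, from which pairing and composition are
    inherited. *)
Definition adapted n {dS} {S : measurableType dS} (Y : T -> S) :=
  forall B, measurable B -> sigma_upto X Z n (Y @^-1` B).

Let gen n := \bigcup_(k in [set k | (1 <= k <= n)%N])
  (g_sigma_algebra_preimage (X k) `|` g_sigma_algebra_preimage (Z k)).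

Lemma adaptedP n {dS} {S : measurableType dS} (Y : T -> S) :
  adapted n Y <-> measurable_fun [set: g_sigma_algebraType (gen n)] Y.
Proof.
split=> [h _ B mB|h B mB]; first by rewrite setTI; exact: h.
by have := h measurableT _ mB; rewrite setTI.
Qed.

Lemma adapted_pair n {dS dU} {S : measurableType dS} {U : measurableType dU}
  (Y : T -> S) (V : T -> U) :
  adapted n Y -> adapted n V -> adapted n (fun w => (Y w, V w)).
Proof.
by move=> /adaptedP hY /adaptedP hV; apply/adaptedP; exact: measurable_fun_pair.
Qed.

Lemma adapted_comp n {dS dU} {S : measurableType dS} {U : measurableType dU}
  (f : S -> U) (Y : T -> S) :
  measurable_fun setT f -> adapted n Y -> adapted n (fun w => f (Y w)).
Proof.
by move=> mf /adaptedP hY; apply/adaptedP; exact: measurableT_comp mf hY.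
Qed.

Lemma adapted_cst n {dS} {S : measurableType dS} (c : S) : adapted n (fun=> c).
Proof. by apply/adaptedP; exact: measurable_cst. Qed.

Lemma adaptedS n {dS} {S : measurableType dS} (Y : T -> S) :
  adapted n Y -> adapted n.+1 Y.
Proof.
move=> h B mB; apply: sub_smallest2r (h B mB) => //.
by move=> C [k /= /andP[k1 kn] hC]; exists k => //=; rewrite k1 leqW.
Qed.

Lemma adapted_fresh n : adapted n.+1 (fun w => (X n.+1 w, Z n.+1 w)).
Proof.
by apply: adapted_pair => B mB; apply: sub_sigma_algebra;
  exists n.+1; rewrite /= ?leqnn//; [left|right]; exact: g_pre.
Qed.

Lemma adapted_measurable n {dS} {S : measurableType dS} (Y : T -> S) :
  adapted n Y -> measurable_fun setT Y.
Proof.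
move=> h _ B mB; rewrite setTI; have := h B mB.
apply: smallest_sub; first exact: sigma_algebra_measurable.
by move=> C [k _ [[D mD <-]|[D mD <-]]]; rewrite setTI; exact: mpre.
Qed.

(** Conditioning on the first [n] steps in disguise: [Y] gathers what is known at time [n], and the
    inner integral treats it as a constant. *)
Lemma integral_fresh n {dS} {S : measurableType dS} (Y : T -> S)
    (phi : S * (E1 * E2) -> \bar R) :
  adapted n Y -> measurable_fun [set: (S * (E1 * E2))%type] phi ->
  (forall x, 0 <= phi x) ->
  \int[P]_w phi (Y w, (X n.+1 w, Z n.+1 w)) =
  \int[P]_w' \int[P]_w phi (Y w', (X n.+1 w, Z n.+1 w)).
Proof.
move=> aY mphi phi0.
have mY := adapted_measurable aY.
have mxi : measurable_fun setT (fun w => (X n.+1 w, Z n.+1 w)).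
  exact: measurable_fun_pair.
pose Ym : {mfun T >-> S} := HB.pack Y (isMeasurableFun.Build _ _ _ _ _ mY).
pose xi : {mfun T >-> (E1 * E2)%type} :=
  HB.pack (fun w => (X n.+1 w, Z n.+1 w)) (isMeasurableFun.Build _ _ _ _ _ mxi).
apply: (@integral_independent_pair _ _ _ P _ _ _ _ Ym xi) => // A B mA mB.
by apply: sigma_upto_fresh => //; exact: aY.
Qed.

Lemma XZ_independent n A B : measurable A -> measurable B ->
  P (X n.+1 @^-1` A `&` Z n.+1 @^-1` B) = P (X n.+1 @^-1` A) * P (Z n.+1 @^-1` B).
Proof. by move=> mA mB; apply: XZ_indep; exact: sigma_seq_pre. Qed.

End fresh_noise.

(** * The truncated innovations *)

Section measurable_mx.
Context {d : measure_display} {T : measurableType d} {R : realType}.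
Implicit Types (m n : nat).

Lemma measurable_mx m n (f : T -> 'M[R]_(m, n)) :
  (forall i j, measurable_fun setT (fun w => f w i j)) -> measurable_fun setT f.
Proof.
move=> h; apply: (measurability (@mx_coordinates _ R m n)) => //.
move=> _ [_ [[i j] _ [B mB <-]] <-].
rewrite !setTI -comp_preimage.
by have := h i j measurableT B mB; rewrite setTI.
Qed.

Lemma measurable_entry m n (f : T -> 'M[R]_(m, n)) i j :
  measurable_fun setT f -> measurable_fun setT (fun w => f w i j).
Proof.
move=> mf _ B mB; rewrite setTI.
have := mf measurableT ((fun M : 'M[R]_(m, n) => M i j) @^-1` B); rewrite setTI; apply.
apply: sub_sigma_algebra; exists (i, j) => //; exists B => //.
by rewrite setTI.
Qed.

Lemma measurable_addmx m n (f g : T -> 'M[R]_(m, n)) :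
  measurable_fun setT f -> measurable_fun setT g ->
  measurable_fun setT (fun w => f w + g w).
Proof.
move=> mf mg; apply: measurable_mx => i j.
under eq_fun do rewrite mxE.
by apply: measurable_funD; exact: measurable_entry.
Qed.

Lemma measurable_scalemx m n (a : T -> R) (f : T -> 'M[R]_(m, n)) :
  measurable_fun setT a -> measurable_fun setT f ->
  measurable_fun setT (fun w => a w *: f w).
Proof.
move=> ma mf; apply: measurable_mx => i j.
under eq_fun do rewrite mxE.
by apply: measurable_funM => //; exact: measurable_entry.
Qed.

Lemma measurable_subrmx m n (f g : T -> 'M[R]_(m, n)) :
  measurable_fun setT f -> measurable_fun setT g ->
  measurable_fun setT (fun w => f w - g w).
Proof.
move=> mf mg; apply: measurable_addmx => //.
under eq_fun do rewrite -scaleN1r.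
by apply: measurable_scalemx.
Qed.

Lemma measurable_trmx m n (f : T -> 'M[R]_(m, n)) :
  measurable_fun setT f -> measurable_fun setT (fun w => (f w)^T).
Proof.
move=> mf; apply: measurable_mx => i j.
by under eq_fun do rewrite mxE; exact: measurable_entry.
Qed.

Lemma measurable_mulmx m n k (f : T -> 'M[R]_(m, n)) (g : T -> 'M[R]_(n, k)) :
  measurable_fun setT f -> measurable_fun setT g ->
  measurable_fun setT (fun w => f w *m g w).
Proof.
move=> mf mg; apply: measurable_mx => i j.
under eq_fun do rewrite mxE.
apply: measurable_sum => l.
by apply: measurable_funM; exact: measurable_entry.
Qed.

Lemma measurable_dotF m n (f g : T -> 'M[R]_(m, n)) :
  measurable_fun setT f -> measurable_fun setT g ->
  measurable_fun setT (fun w => dotF (f w) (g w)).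
Proof.
move=> mf mg; do 2 apply: measurable_sum => ?.
by apply: measurable_funM; exact: measurable_entry.
Qed.

Lemma measurable_normF m n (f : T -> 'M[R]_(m, n)) :
  measurable_fun setT f -> measurable_fun setT (fun w => normF (f w)).
Proof.
move=> mf; under eq_fun do rewrite normFE.
have ms : measurable_fun setT (@Num.sqrt R).
  by apply: nondecreasing_measurable => // x y xy; exact: ler_wsqrtr.
by apply: (measurableT_comp ms); exact: measurable_dotF.
Qed.

Lemma measurable_clipF m n b (f : T -> 'M[R]_(m, n)) :
  measurable_fun setT f -> measurable_fun setT (fun w => clipF b (f w)).
Proof.
move=> mf; apply: measurable_fun_ifT => //.
  by apply: measurable_fun_ler => //; exact: measurable_normF.
apply: measurable_scalemx => //; apply: measurable_funM => //.
under eq_fun do rewrite -powR_inv1 ?normF_ge0//.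
by apply: (measurableT_comp (measurable_powR _)); exact: measurable_normF.
Qed.

End measurable_mx.

Section real_expectation.
Context {disp : measure_display} {T : measurableType disp} {R : realType}.
Variable P : probability T R.
Implicit Types f g : T -> R.

Definition intg f := P.-integrable setT (EFin \o f).

Lemma intgD f g : intg f -> intg g -> intg (fun w => f w + g w).
Proof. by move=> hf hg; exact: (integrableD measurableT hf hg). Qed.

Lemma intgB f g : intg f -> intg g -> intg (fun w => f w - g w).
Proof. by move=> hf hg; exact: (integrableB measurableT hf hg). Qed.

Lemma intgZ c f : intg f -> intg (fun w => c * f w).
Proof. by move=> hf; exact: (integrableZl measurableT c hf). Qed.

Lemma intg_cst c : intg (fun=> c).
Proof. exact: finite_measure_integrable_cst. Qed.

Lemma intg_sum I (r : seq I) (f : I -> T -> R) :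
  (forall i, intg (f i)) -> intg (fun w => \sum_(i <- r) f i w).
Proof.
move=> h; elim: r => [|i r IH].
  by under eq_fun do rewrite big_nil; exact: intg_cst.
by under eq_fun do rewrite big_cons; exact: intgD.
Qed.

Lemma Rintegral_sum I (r : seq I) (f : I -> T -> R) :
  (forall i, intg (f i)) ->
  \int[P]_w (\sum_(i <- r) f i w) = \sum_(i <- r) \int[P]_w f i w.
Proof.
move=> h; elim: r => [|i r IH].
  under eq_fun do rewrite big_nil.
  by rewrite Rintegral_cst// mul0r big_nil.
under eq_fun do rewrite big_cons.
rewrite RintegralD//; [|exact: h|exact: intg_sum].
by rewrite big_cons IH.
Qed.

Lemma intg_le f g : measurable_fun setT f -> (forall w, `|f w| <= g w) ->
  intg g -> intg f.
Proof.
move=> mf fg; apply: le_integrable => //; first exact/measurable_EFinP.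
by move=> w _; rewrite lee_fin (le_trans (fg w))// ler_norm.
Qed.

Lemma EFin_Rintegral f : intg f ->
  (\int[P]_w f w)%:E = (\int[P]_w (f w)%:E)%E.
Proof. by move=> hf; rewrite /Rintegral fineK//; exact: integrable_fin_num. Qed.

Lemma intg_ge0 f c : measurable_fun setT f -> (forall w, 0 <= f w) ->
  (\int[P]_w (f w)%:E <= c%:E)%E -> intg f /\ \int[P]_w f w <= c.
Proof.
move=> mf f0 fc.
have i : intg f.
  apply/integrableP; split; first exact/measurable_EFinP.
  under eq_integral do rewrite gee0_abs ?lee_fin//.
  by rewrite (le_lt_trans fc)// ltry.
by split => //; rewrite -lee_fin EFin_Rintegral.
Qed.

Lemma Rintegral_1 c : \int[P]_w (cst c : T -> R) w = c.
Proof.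
rewrite Rintegral_cst// (_ : fine _ = 1) ?mulr1//.
exact: (congr1 fine (probability_setT P)).
Qed.

End real_expectation.

Section truncated_noise.
Context {R : realType} {p d : nat}.
Implicit Types (b : R) (hs : 'cV[R]_p -> 'M[R]_d) (xz : 'cV[R]_p * 'cV[R]_d).

(** This is Q Z^T with Q = hs(x) z. It has rank one, so its Frobenius norm is |Q| |Z| and [keep] is
    exactly the truncation test of the algorithm. *)
Definition raw hs xz : 'M[R]_d := hs xz.1 *m (xz.2 *m (xz.2)^T).
Definition keep b hs xz : R := (normF (raw hs xz) <= b)%R%:R.
Definition trunc b hs xz : 'M[R]_d := keep b hs xz *: raw hs xz.

Lemma keep_ge0 b hs xz : 0 <= keep b hs xz.
Proof. by rewrite /keep ler0n. Qed.

Lemma keep_le1 b hs xz : keep b hs xz <= 1.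
Proof. by rewrite /keep lern1 leq_b1. Qed.

Lemma normF_trunc b hs xz : 0 <= b -> normF (trunc b hs xz) <= b.
Proof.
move=> b0; rewrite /trunc /keep; case: (leP (normF (raw hs xz)) b) => h.
  by rewrite scale1r.
by rewrite scale0r normF0.
Qed.

Lemma normF_trunc_raw b hs xz : normF (trunc b hs xz) <= normF (raw hs xz).
Proof.
by rewrite /trunc normFZ ler_piMl ?normF_ge0// ger0_norm ?keep_ge0 ?keep_le1.
Qed.

Lemma normF_raw hs xz : normF (raw hs xz) <= normF (hs xz.1) * normF xz.2 ^+ 2.
Proof.
by apply: le_trans (normF_mul _ _) _; rewrite normF_col_row expr2.
Qed.

Context {dT : measure_display} {T : measurableType dT}.

Lemma measurable_raw hs (f : T -> 'cV[R]_p * 'cV[R]_d) :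
  measurable_fun setT (fun w => hs (f w).1) -> measurable_fun setT f ->
  measurable_fun setT (fun w => raw hs (f w)).
Proof.
move=> mhs mf; have mf2 : measurable_fun setT (fun w => (f w).2).
  exact: measurableT_comp measurable_snd mf.
by apply: measurable_mulmx => //; apply: measurable_mulmx => //; exact: measurable_trmx.
Qed.

End truncated_noise.

(** * Moments and biases of the truncated innovations *)

Section moments.
Context {disp : measure_display} {T : measurableType disp} {R : realType}.
Variable P : probability T R.
Context {p d : nat}.
Variables (X : {RV P >-> 'cV[R]_p}) (Z : {RV P >-> 'cV[R]_d}).
Hypothesis XZ : forall A B, measurable A -> measurable B ->
  P (X @^-1` A `&` Z @^-1` B) = (P (X @^-1` A) * P (Z @^-1` B))%E.
Variables (hs : 'cV[R]_p -> 'M[R]_d) (Hh : 'M[R]_d) (q Cq M : R).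
Hypotheses (mhs : measurable_fun setT hs) (q2 : 2 < q).
Hypothesis hs_int : forall i j, intg P (fun w => hs (X w) i j).
Hypothesis hs_mean : forall i j, \int[P]_w hs (X w) i j = Hh i j.
Hypothesis hs_moment : (\int[P]_w (normF (hs (X w)) `^ q)%:E <= Cq%:E)%E.
Hypothesis Z_bounded : {ae P, forall w, normF (Z w) <= M}.
Hypothesis Z_cov : expectation_mx P (fun w => Z w *m (Z w)^T) = 1%:M.

Let xz w := (X w, Z w).
Let B w := raw hs (xz w).
Let Kq := (M ^+ 2) `^ q * Cq.

Let mxz : measurable_fun setT xz.
Proof. exact: measurable_fun_pair. Qed.

Let mhsX : measurable_fun setT (fun w => hs (X w)).
Proof. exact: measurableT_comp mhs _. Qed.

Let mB : measurable_fun setT B.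
Proof. exact: measurable_raw. Qed.

Let mnB : measurable_fun setT (fun w => normF (B w)).
Proof. exact: measurable_normF. Qed.

Let nBq0 w : 0 <= normF (B w) `^ q.
Proof. exact: powR_ge0. Qed.

(** Almost surely |B| is at most [M ^+ 2] times the norm of the Hessian sample, whence the constant
    [Kq]. *)
Let raw_moment : intg P (fun w => normF (B w) `^ q) /\
  \int[P]_w (normF (B w) `^ q) <= Kq.
Proof.
have mq (f : T -> R) : measurable_fun setT f -> measurable_fun setT (fun w => f w `^ q).
  by move=> mf; exact: measurableT_comp (measurable_powR _) mf.
apply: intg_ge0 => //; first exact: mq.
apply: (@le_trans _ _ (\int[P]_w ((M ^+ 2) `^ q * normF (hs (X w)) `^ q)%:E)%E).
  apply: ae_ge0_le_integral => //.
  - by move=> w _; rewrite lee_fin.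
  - by apply/measurable_EFinP; exact: mq.
  - by move=> w _; rewrite lee_fin mulr_ge0 ?powR_ge0.
  - apply/measurable_EFinP; apply: measurable_funM => //; apply: mq.
    exact: measurable_normF.
  - apply: filterS Z_bounded => w ZM _; rewrite lee_fin.
    rewrite -powRM ?sqr_ge0 ?normF_ge0//.
    have q0 : 0 <= q by rewrite ltW// (lt_trans _ q2).
    apply: (ge0_ler_powR q0); rewrite ?nnegrE ?normF_ge0//.
      by rewrite mulr_ge0 ?sqr_ge0 ?normF_ge0.
    apply: le_trans (normF_raw _ _) _; rewrite mulrC ler_wpM2r ?normF_ge0//=.
    by rewrite ler_pXn2r ?nnegrE ?normF_ge0 ?(le_trans (normF_ge0 _) ZM).
under eq_integral do rewrite EFinM.
rewrite ge0_integralZl_EFin ?powR_ge0//.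
- by rewrite EFinM lee_wpmul2l ?lee_fin ?powR_ge0.
- by move=> w _; rewrite lee_fin powR_ge0.
- by apply/measurable_EFinP; apply: mq; exact: measurable_normF.
Qed.

Let le_powR_q (t : R) : 0 <= t -> t ^+ 2 <= 1 + t `^ q.
Proof.
move=> t0; have [t1|t1] := leP t 1.
  by rewrite (@le_trans _ _ 1)// ?exprn_ile1// lerDl powR_ge0.
rewrite -powR_mulrn// (@le_trans _ _ (t `^ q))//.
  by apply: ler_powR; rewrite ltW.
by rewrite lerDr ler01.
Qed.

Let nB2 : intg P (fun w => normF (B w) ^+ 2) /\
  \int[P]_w (normF (B w) ^+ 2) <= 1 + Kq.
Proof.
have i1 : intg P (fun w => 1 + normF (B w) `^ q).
  by apply: intgD; [exact: intg_cst|exact: raw_moment.1].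
have i2 : intg P (fun w => normF (B w) ^+ 2).
  apply: intg_le i1; first exact: measurable_funX.
  by move=> w; rewrite ger0_norm ?sqr_ge0// le_powR_q ?normF_ge0.
split => //.
apply: le_trans (le_Rintegral measurableT i2 i1 _) _.
  by move=> w _; rewrite le_powR_q ?normF_ge0.
rewrite RintegralD//; [|exact: intg_cst|exact: raw_moment.1].
by rewrite Rintegral_1 lerD2l raw_moment.2.
Qed.

Let iB i j : intg P (fun w => B w i j).
Proof.
apply: (@intg_le _ _ _ _ _ (fun w => 1 + normF (B w) ^+ 2)).
- exact: measurable_entry.
- move=> w; rewrite (le_trans (normF_coord _ _ _))//.
  by have := sqr_ge0 (normF (B w) - 1); have := normF_ge0 (B w); nra.
- by apply: intgD; [exact: intg_cst|exact: nB2.1].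
Qed.

Let Z_entry (w : T) i j : (Z w *m (Z w)^T) i j = Z w i 0 * Z w j 0.
Proof. by rewrite mxE big_ord1 !mxE. Qed.

Let iZ i j : intg P (fun w => Z w i 0 * Z w j 0).
Proof.
have mZ : measurable_fun setT (fun w => Z w i 0 * Z w j 0).
  by apply: measurable_funM; exact: measurable_entry.
apply/integrableP; split; first exact/measurable_EFinP.
apply: (@le_lt_trans _ _ (\int[P]_w ((M ^+ 2)%:E))%E); last first.
  by rewrite integral_cst// [X in (_ * X)%E](probability_setT P) mule1 ltry.
apply: ae_ge0_le_integral => //.
- by apply: measurableT_comp => //; exact/measurable_EFinP.
- by move=> w _; rewrite lee_fin sqr_ge0.
apply: filterS Z_bounded => w ZM _; rewrite lee_fin normrM expr2.
by apply: ler_pM => //; apply: le_trans (normF_coord _ _ _) ZM.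
Qed.

(** Independence of [X] and [Z] factors every term of the matrix product, and [Z_cov] turns the mean
    of Z Z^T into the identity. *)
Let mean_raw i j : \int[P]_w B w i j = Hh i j.
Proof.
have e w : B w i j = \sum_k hs (X w) i k * (Z w k 0 * Z w j 0).
  by rewrite /B /raw mxE; apply: eq_bigr => k _ /=; rewrite Z_entry.
have h k : intg P (fun w => hs (X w) i k * (Z w k 0 * Z w j 0)) /\
    \int[P]_w (hs (X w) i k * (Z w k 0 * Z w j 0)) = Hh i k * (k == j)%:R.
  have := @integrable_independent_mul _ _ _ P _ _ _ _ X Z XZ
    (fun x => hs x i k) (fun z : 'cV[R]_d => z k 0 * z j 0).
  have m1 : measurable_fun setT (fun x => hs x i k) by exact: measurable_entry.
  have m2 : measurable_fun setT (fun z : 'cV[R]_d => z k 0 * z j 0).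
    by apply: measurable_funM; apply: measurable_entry.
  move=> /(_ m1 m2 (hs_int _ _) (iZ _ _)) [h1 h2]; split => //.
  rewrite /Rintegral h2 -!EFin_Rintegral// -EFinM /= hs_mean; congr (_ * _).
  have /matrixP/(_ k j) := Z_cov; rewrite !mxE => <-.
  rewrite /Rintegral; congr fine; rewrite unlock; apply: eq_integral => w _.
  by rewrite Z_entry.
under eq_fun do rewrite e.
rewrite Rintegral_sum; last by move=> k; exact: (h k).1.
rewrite (bigD1 j)//= (h j).2 eqxx mulr1 big1 ?addr0// => k /negPf kj.
by rewrite (h k).2 kj mulr0.
Qed.

Variable b : R.
Hypothesis b0 : 0 < b.
Let W w := trunc b hs (xz w).
Let k w := keep b hs (xz w).

Lemma measurable_keep_fresh : measurable_fun setT k.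
Proof.
apply: (measurableT_comp (f := fun b : bool => b%:R : R)) => //.
exact: measurable_fun_ler.
Qed.

Lemma measurable_trunc_fresh : measurable_fun setT W.
Proof. by apply: measurable_scalemx => //; exact: measurable_keep_fresh. Qed.

Lemma intg_keep : intg P k.
Proof.
apply: (@intg_le _ _ _ _ _ (cst 1)); [exact: measurable_keep_fresh| |exact: intg_cst].
by move=> w; rewrite ger0_norm ?keep_ge0 ?keep_le1.
Qed.

Lemma intg_trunc i j : intg P (fun w => W w i j).
Proof.
apply: (@intg_le _ _ _ _ _ (cst b)); last exact: intg_cst.
  by apply: measurable_entry; exact: measurable_trunc_fresh.
by move=> w; apply: le_trans (normF_coord _ _ _) _; rewrite normF_trunc// ltW.
Qed.

Lemma trunc_second_moment : intg P (fun w => normF (W w) ^+ 2) /\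
  \int[P]_w (normF (W w) ^+ 2) <= 1 + Kq.
Proof.
have h w : normF (W w) ^+ 2 <= normF (B w) ^+ 2.
  by rewrite ler_pXn2r ?nnegrE ?normF_ge0// normF_trunc_raw.
have i : intg P (fun w => normF (W w) ^+ 2).
  apply: (@intg_le _ _ _ _ _ (fun w => normF (B w) ^+ 2)).
  - by apply: measurable_funX; apply: measurable_normF; exact: measurable_trunc_fresh.
  - by move=> w; rewrite ger0_norm ?sqr_ge0.
  - exact: nB2.1.
split => //; apply: le_trans nB2.2; apply: le_Rintegral => //; exact: nB2.1.
Qed.

(** Markov's inequality: the indicator of |B| > b is at most b^(-q) |B|^q. *)
Lemma keep_mean : 0 <= 1 - \int[P]_w k w <= Kq * b `^ (- q).
Proof.
have e : 1 - \int[P]_w k w = \int[P]_w (1 - k w).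
  rewrite RintegralB//; [|exact: intg_cst|exact: intg_keep].
  by rewrite Rintegral_1.
rewrite e; apply/andP; split.
  by apply: Rintegral_ge0 => w _; rewrite subr_ge0 keep_le1.
apply: (@le_trans _ _ (\int[P]_w (b `^ (- q) * normF (B w) `^ q))); last first.
  rewrite RintegralZl//; last exact: raw_moment.1.
  by rewrite mulrC ler_wpM2r ?powR_ge0// raw_moment.2.
apply: le_Rintegral => //.
- by apply: intgB; [exact: intg_cst|exact: intg_keep].
- by apply: intgZ; exact: raw_moment.1.
move=> w _; rewrite /k /keep -/(B w); case: (leP (normF (B w)) b) => Bb.
  by rewrite mulr1n subrr mulr_ge0 ?powR_ge0.
rewrite mulr0n subr0 powRN ler_pdivlMl ?powR_gt0// mulr1.
have q0 : 0 <= q by rewrite ltW// (lt_trans _ q2).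
by apply: (ge0_ler_powR q0); rewrite ?nnegrE ?normF_ge0// ltW.
Qed.

(** Where |B| > b one has |B| <= b^(1-q) |B|^q. Having one power of [b] more than the bias of
    [keep], this is the bias that enters the final rate. *)
Lemma trunc_mean i j : `|\int[P]_w W w i j - Hh i j| <= Kq * b `^ (1 - q).
Proof.
rewrite -mean_raw -RintegralB//; [|exact: intg_trunc|exact: iB].
have iD : intg P (fun w => W w i j - B w i j).
  by apply: intgB; [exact: intg_trunc|exact: iB].
apply: le_trans (le_normr_Rintegral _ _) _ => //.
apply: (@le_trans _ _ (\int[P]_w (b `^ (1 - q) * normF (B w) `^ q))); last first.
  rewrite RintegralZl//; last exact: raw_moment.1.
  by rewrite mulrC ler_wpM2r ?powR_ge0// raw_moment.2.
apply: le_Rintegral => //.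
- exact: (integrable_norm iD).
- by apply: intgZ; exact: raw_moment.1.
move=> w _; rewrite /W /trunc /keep -/(B w) mxE; case: (leP (normF (B w)) b) => Bb.
  by rewrite mulr1n mul1r subrr normr0 mulr_ge0 ?powR_ge0.
rewrite mulr0n mul0r sub0r normrN (le_trans (normF_coord _ _ _))//.
have B0 : 0 < normF (B w) by apply: lt_trans Bb.
have -> : normF (B w) `^ q = normF (B w) * normF (B w) `^ (q - 1).
  by rewrite mulr_powRB1 ?ltW// (lt_trans _ q2).
rewrite mulrCA ler_peMr ?normF_ge0//.
rewrite -[1 - q]opprB powRN ler_pdivlMl ?powR_gt0// mulr1.
have q0 : 0 <= q - 1 by rewrite subr_ge0 ltW// (lt_trans _ q2)// ltr1n.
by apply: (ge0_ler_powR q0); rewrite ?nnegrE ?normF_ge0// ltW.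
Qed.

Let EW : 'M[R]_d := \matrix_(i, j) \int[P]_w W w i j.

(** The interface for all means over a fresh pair, used for the energy and for exponential moments.
    It asks for a majorant that is affine in the truncated matrix, its indicator and its squared
    norm; finiteness of the integral of [phi] is part of the conclusion. *)
Lemma integral_affine_bound (phi : T -> R) c0 (C : 'M[R]_d) c1 c2 : 0 <= c2 ->
  measurable_fun setT phi -> (forall w, 0 <= phi w) ->
  (forall w, phi w <= c0 + dotF C (W w) + c1 * k w + c2 * normF (W w) ^+ 2) ->
  (\int[P]_w (phi w)%:E <=
    (c0 + dotF C EW + c1 * \int[P]_w k w + c2 * (1 + Kq))%:E)%E.
Proof.
move=> c20 mphi phi0 hphi.
have iC : intg P (fun w => dotF C (W w)).
  by apply: intg_sum => i; apply: intg_sum => j; apply: intgZ; exact: intg_trunc.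
have i1 := intgD (intg_cst P c0) iC.
have i2 := intgD i1 (intgZ c1 intg_keep).
pose f3 w := c0 + dotF C (W w) + c1 * k w + c2 * normF (W w) ^+ 2.
have i3 : intg P f3 by exact: intgD i2 (intgZ c2 trunc_second_moment.1).
apply: (@le_trans _ _ (\int[P]_w f3 w)%:E).
  rewrite EFin_Rintegral//; apply: ge0_le_integral => //.
  - by move=> w _; rewrite lee_fin.
  - exact/measurable_EFinP.
  - exact: (measurable_int P).
  - by move=> w _; rewrite lee_fin hphi.
rewrite lee_fin /f3.
rewrite RintegralD//; last exact: intgZ trunc_second_moment.1.
rewrite RintegralD//; last exact: intgZ intg_keep.
rewrite RintegralD//; last exact: intg_cst.
rewrite RintegralZl//; last exact: intg_keep.
rewrite RintegralZl//; last exact: trunc_second_moment.1.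
rewrite Rintegral_1 lerD ?ler_wpM2l ?trunc_second_moment.2//.
rewrite lerD2r lerD2l le_eqVlt; apply/orP; left; apply/eqP.
rewrite /dotF Rintegral_sum; last first.
  by move=> i; apply: intg_sum => j; apply: intgZ; exact: intg_trunc.
apply: eq_bigr => i _; rewrite Rintegral_sum; last first.
  by move=> j; apply: intgZ; exact: intg_trunc.
by apply: eq_bigr => j _; rewrite RintegralZl ?mxE//; exact: intg_trunc.
Qed.

End moments.

(** * One step of the recursion *)

Section recursion.
Context {R : realType} {p d : nat}.
Implicit Types (A W : 'M[R]_d) (c b : R).

(** With [W] the truncated Q Z^T and [c] its indicator, [A *m W^T] and [W *m A^T] are the truncated
    P Q^T and Q P^T, because P = A Z. Written this way the increment is affine in [W] and [c]
    jointly. *)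
Definition incr A W c : 'M[R]_d := A *m W^T + W *m A^T - (2 * c)%:M.

Definition step (g b b' : R) hs A (xz : 'cV[R]_p * 'cV[R]_d) : 'M[R]_d :=
  projF b' (A - g *: incr A (trunc b hs xz) (keep b hs xz)).

Lemma inv_hessian_estS gam bet bet' (hessg : 'cV[R]_p -> 'cV[R]_d -> 'M[R]_d)
    A0 x z th n :
  inv_hessian_est gam bet bet' hessg A0 x z th n.+1 =
  step (gam n.+1) (bet n.+1) (bet' n.+1) (hessg^~ (th n))
    (inv_hessian_est gam bet bet' hessg A0 x z th n) (x n.+1, z n.+1).
Proof.
rewrite /=; set A := inv_hessian_est _ _ _ _ _ _ _ _ n.
rewrite /step /incr /trunc /keep /raw /=.
rewrite -normF_col_row -mulmxA.
set B := _ *m (_ *m _); set c : R := _%:R.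
congr (projF _ (_ - _ *: _)).
have -> : (c *: B)^T = c *: B^T by rewrite linearZ.
rewrite -scalemxAl -scalemxAr.
rewrite scalerBr scalerDr; congr (_ + _ - _).
- by rewrite /B !trmx_mul trmxK !mulmxA.
- by rewrite /B !trmx_mul !mulmxA.
- by rewrite scale_scalar_mx mulrC.
Qed.

Lemma incr_sym A W c : (incr A W c)^T = incr A W c.
Proof.
by rewrite /incr linearB linearD /= !trmx_mul !trmxK tr_scalar_mx [W *m _ + _]addrC.
Qed.

Lemma step_sym g b b' hs A xz : 0 <= b' -> A^T = A ->
  (step g b b' hs A xz)^T = step g b b' hs A xz.
Proof.
by move=> b0 As; apply: projF_sym => //; rewrite linearB /= As linearZ /= incr_sym.
Qed.

Lemma normF_incr A W c : 0 <= c <= 1 ->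
  normF (incr A W c) <= 2 * normF A * normF W + 2 * (d * d)%:R.
Proof.
move=> /andP[c0 c1]; apply: le_trans (normF_triangleB _ _) _; apply: lerD.
  apply: le_trans (normFD (normF_mul _ _) (normF_mul _ _)) _.
  rewrite !normF_tr le_eqVlt; apply/orP; left; apply/eqP; ring.
apply: le_trans (normF_scalar _ _) _; rewrite mulrC ler_wpM2r ?ler0n//.
by rewrite ger0_norm ?mulr_ge0// ger_pMr.
Qed.

Lemma normF_incr_sqr A W c : 0 <= c <= 1 ->
  normF (incr A W c) ^+ 2 <= 8 * normF A ^+ 2 * normF W ^+ 2 + 8 * (d * d)%:R ^+ 2.
Proof.
move=> c01; set dd : R := (d * d)%:R.
apply: (@le_trans _ _ ((2 * normF A * normF W + 2 * dd) ^+ 2)).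
  rewrite ler_pXn2r ?nnegrE ?normF_ge0 ?normF_incr//.
  by rewrite addr_ge0// !mulr_ge0 ?normF_ge0// ler0n.
have := sqr_ge0 (2 * normF A * normF W - 2 * dd); nra.
Qed.

Lemma dotF_mulr (X Y A : 'M[R]_d) : dotF X (Y *m A) = dotF (X *m A^T) Y.
Proof. by rewrite -dotF_trmx trmx_mul -(dotF_trmx (X *m _)) trmx_mul trmxK dotF_mull. Qed.

Lemma dotF_incr_affine U A W c :
  dotF U (incr A W c) = dotF (U^T *m A + U *m A) W - 2 * c * dotF U 1%:M.
Proof.
rewrite /incr dotFBr dotFDr -scalemx1 dotFZr dotFDl; congr (_ + _ - _).
  by rewrite -dotF_trmx trmx_mul trmxK dotF_mulr trmxK.
by rewrite dotF_mulr trmxK.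
Qed.

Lemma dotF_incr D A W c : D^T = D -> A^T = A ->
  dotF D (incr A W c) = 2 * dotF (D *m A) W - 2 * c * dotF D 1%:M.
Proof.
move=> Ds As; rewrite /incr dotFBr dotFDr As -scalemx1 dotFZr; congr (_ - _).
rewrite -{1}Ds -{1}[A in A *m _]As -trmx_mul dotF_trmx dotF_mulr As.
by rewrite mulr_natl mulr2n.
Qed.

End recursion.

Section squared_distance.
Context {R : realType} {d : nat}.
Variable K : 'M[R]_d.
Implicit Types A : 'M[R]_d.

(* [1 + dist(A, ball(K, 1)) ^ 2] *)
Definition lyapf A : R := 1 + Num.max (normF (A - K) - 1) 0 ^+ 2.

(* [A - shrink A *: (A - K)] is the point of [ball(K, 1)] closest to [A]. *)
Definition shrink A : R := if normF (A - K) <= 1 then 0 else 1 - (normF (A - K))^-1.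

Lemma lyapf_ge1 A : 1 <= lyapf A.
Proof. by rewrite /lyapf lerDl sqr_ge0. Qed.

Lemma shrink_ge0 A : 0 <= shrink A.
Proof.
rewrite /shrink; case: (leP (normF (A - K)) 1) => // h.
by rewrite subr_ge0 invf_le1 ?(ltW h)// (lt_trans _ h).
Qed.

Lemma lyapf_shrink A : lyapf A = 1 + normF (shrink A *: (A - K)) ^+ 2.
Proof.
rewrite /lyapf normFZ ger0_norm ?shrink_ge0// /shrink.
case: (leP (normF (A - K)) 1) => h; first by rewrite mul0r max_r ?subr_le0.
rewrite max_l ?subr_ge0 ?(ltW h)// mulrBl mul1r mulVf//.
by rewrite gt_eqF// (lt_trans _ h).
Qed.

Lemma shrink_ball A : normF (A - shrink A *: (A - K) - K) <= 1.
Proof.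
rewrite addrAC -{1}[A - K]scale1r -scalerBl normFZ /shrink.
case: (leP (normF (A - K)) 1) => h; first by rewrite subr0 normr1 mul1r.
rewrite opprB addrC subrK ger0_norm ?invr_ge0 ?normF_ge0// mulVf//.
by rewrite gt_eqF// (lt_trans _ h).
Qed.

(** Compare with [pi], the point of ball(K, 1) closest to [A]. It lies in the ball of radius [b], so
    projecting does not increase the distance to it, and this distance bounds the distance to
    ball(K, 1). The terms come from the square of [shrink K A *: (A - K) + D]. *)
Lemma lyapf_projF b A D : normF K + 1 <= b ->
  lyapf (projF b (A + D)) <= lyapf A + 2 * shrink A * dotF (A - K) D + normF D ^+ 2.
Proof.
move=> Kb; set c := shrink A; set pi := A - c *: (A - K).
have piK := shrink_ball A; rewrite -/c -/pi in piK.
have pib : normF pi <= b.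
  apply: le_trans Kb; rewrite -[pi](subrK K) addrC.
  by apply: le_trans (normF_triangle _ _) _; rewrite lerD2l.
have b0 : 0 <= b by apply: le_trans (normF_ge0 _) pib.
set N := projF b _.
have h1 : normF (N - pi) <= normF (c *: (A - K) + D).
  apply: le_trans (projF_nonexp _ b0 pib) _.
  rewrite (_ : A + D - pi = c *: (A - K) + D)//.
  by apply/matrixP => i j; rewrite !mxE; ring.
have h2 : normF (N - K) - 1 <= normF (N - pi).
  rewrite lerBlDr -[N - K](subrKA pi); apply: le_trans (normF_triangle _ _) _.
  by rewrite lerD2l.
apply: (@le_trans _ _ (1 + normF (c *: (A - K) + D) ^+ 2)).
  rewrite /lyapf lerD2l ler_pXn2r ?nnegrE ?normF_ge0 ?le_max ?lexx ?orbT//.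
  by rewrite ge_max normF_ge0 andbT (le_trans h2).
rewrite (lyapf_shrink A) -/c -addrA -addrA lerD2l.
set X := A - K.
rewrite !normF_sqr dotFDl !dotFDr (dotFC D (c *: _)) !(dotFZl, dotFZr).
by rewrite le_eqVlt; apply/orP; left; apply/eqP; ring.
Qed.

(** [normF A] is at most [normF K + 1 + m], with [m ^+ 2 = lyapf K A - 1]. Thus terms quadratic in
    [A] are absorbed by the energy, and the summand 1 of the energy serves the constant terms. *)
Lemma normF_lyapf A : normF A ^+ 2 <= 2 * (normF K + 1) ^+ 2 * lyapf A.
Proof.
rewrite /lyapf; set m := Num.max _ _.
have m0 : 0 <= m by rewrite le_max lexx orbT.
have h : normF A <= normF K + 1 + m.
  rewrite -[A](subrK K); apply: le_trans (normF_triangle _ _) _.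
  rewrite addrC -addrA lerD2l -lerBlDl.
  by rewrite /m le_max lexx.
have K0 := normF_ge0 K.
apply: (@le_trans _ _ ((normF K + 1 + m) ^+ 2)).
  by rewrite ler_pXn2r ?nnegrE ?normF_ge0 ?addr_ge0.
have := sqr_ge0 (normF K + 1 - m); have : 0 <= normF K * m by rewrite mulr_ge0.
have : 0 <= normF K * m ^+ 2 by rewrite mulr_ge0 ?sqr_ge0.
have : 0 <= (normF K * m) ^+ 2 by rewrite sqr_ge0.
nra.
Qed.

Lemma lyapf_bound A r : normF (A - K) <= r -> lyapf A <= 1 + r ^+ 2.
Proof.
move=> Ar; have r0 : 0 <= r by apply: le_trans (normF_ge0 _) Ar.
rewrite /lyapf lerD2l ler_pXn2r ?nnegrE ?le_max ?lexx ?orbT//.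
by rewrite ge_max r0 andbT; lra.
Qed.

Lemma bound_lyapf A r : 0 <= r -> lyapf A < 1 + r ^+ 2 -> normF A <= normF K + 1 + r.
Proof.
move=> r0; rewrite /lyapf ltrD2l ltr_pXn2r ?nnegrE ?le_max ?lexx ?orbT//.
rewrite gt_max => /andP[h _]; rewrite -[A](subrK K).
by apply: le_trans (normF_triangle _ _) _; lra.
Qed.

End squared_distance.

(** * Drift of the energy towards the inverse Hessian *)

Section drift.
Context {R : realType} {d : nat}.
Variables (H : 'M[R]_d) (lam : R).
Hypotheses (H_posdef : posdef H) (lam_gt0 : 0 < lam).
Hypothesis coercive : forall X : 'M[R]_d, lam * normF X ^+ 2 <= dotF X (H *m X).
Let K := invmx H.
Let dd : R := (d * d)%:R.

(** Collects the terms of order [g ^+ 2]: those from the identity part of the increment, and those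
    from the second moment [K2], where [normF_lyapf] contributes the factor
    [2 * (normF K + 1) ^+ 2]. *)
Definition drift_const K2 : R := 8 * dd ^+ 2 + 16 * K2 * (normF K + 1) ^+ 2.

(* The linear part of the increment points towards [K] outside [ball(K, 1)],
   as soon as the biases of [EW] and [Ec] are small. *)
Lemma drift_bound g A EW Ec K2 : 0 <= g -> 0 <= K2 -> A^T = A ->
  normF (EW - H) * (1 + normF K) + `|Ec - 1| * dd <= lam ->
  lyapf K A + 8 * g ^+ 2 * dd ^+ 2 +
    dotF (- (4 * shrink K A * g) *: ((A - K) *m A)) EW +
    4 * shrink K A * g * dotF (A - K) 1%:M * Ec +
    8 * g ^+ 2 * normF A ^+ 2 * K2 <=
  (1 + drift_const K2 * g ^+ 2) * lyapf K A.
Proof.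
move=> g0 K20 As small.
set c := shrink K A; set D := A - K.
have Ks : K^T = K := invmx_posdef_sym H_posdef.
have Ds : D^T = D by rewrite /D linearB /= As Ks.
have quad : 8 * g ^+ 2 * dd ^+ 2 + 8 * g ^+ 2 * normF A ^+ 2 * K2 <=
    drift_const K2 * g ^+ 2 * lyapf K A.
  have hA := normF_lyapf K A; have l1 := lyapf_ge1 K A.
  have h1 : 8 * g ^+ 2 * K2 * normF A ^+ 2 <=
      8 * g ^+ 2 * K2 * (2 * (normF K + 1) ^+ 2 * lyapf K A).
    by rewrite ler_wpM2l// !mulr_ge0 ?sqr_ge0.
  have h2 : 8 * g ^+ 2 * dd ^+ 2 * 1 <= 8 * g ^+ 2 * dd ^+ 2 * lyapf K A.
    by rewrite ler_wpM2l// !mulr_ge0 ?sqr_ge0.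
  rewrite /drift_const; lra.
have lin : 0 <= c * g * (dotF (D *m A) EW - Ec * dotF D 1%:M).
  have cE : c = if normF D <= 1 then 0 else 1 - (normF D)^-1 by [].
  have [D1|D1] := leP (normF D) 1; first by rewrite cE D1 !mul0r.
  rewrite mulr_ge0 ?mulr_ge0 ?shrink_ge0//.
  have AE : A = D + K by rewrite /D subrK.
  (* As [A = D + K] and [H *m K] is the identity, the unbiased part is exactly the coercive form
     [dotF D (H *m D)]. *)
  have -> : dotF (D *m A) EW - Ec * dotF D 1%:M =
     dotF D (H *m D) + dotF (D *m A) (EW - H) - (Ec - 1) * dotF D 1%:M.
    have -> : dotF D (H *m D) = dotF (D *m A) H - dotF D 1%:M.
      have -> : dotF (D *m A) H = dotF D (H *m A) by rewrite dotF_mulr As.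
      by rewrite AE [H *m (D + K)]mulmxDr (mulmxV (posdef_unit H_posdef)) dotFDr addrK.
    by rewrite dotFBr; ring.
  have D0 : 0 <= normF D := normF_ge0 D.
  (* Outside the unit ball the constant [normF K] is at most [normF K * normF D]; so both biases are
     of order [normF D ^+ 2], as the coercive gain is. *)
  have hA : normF A <= (1 + normF K) * normF D.
    rewrite AE; apply: le_trans (normF_triangle _ _) _.
    by rewrite mulrDl mul1r lerD2l ler_peMr ?normF_ge0// ltW.
  have h1 : `|dotF (D *m A) (EW - H)| <=
      normF D ^+ 2 * (normF (EW - H) * (1 + normF K)).
    apply: le_trans (dotF_abs _ _) _.
    apply: (@le_trans _ _ (normF D * ((1 + normF K) * normF D) * normF (EW - H))).
      rewrite ler_wpM2r ?normF_ge0//; apply: le_trans (normF_mul _ _) _.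
      by rewrite ler_wpM2l.
    by rewrite le_eqVlt; apply/orP; left; apply/eqP; ring.
  have h2 : `|(Ec - 1) * dotF D 1%:M| <= normF D ^+ 2 * (`|Ec - 1| * dd).
    rewrite normrM mulrCA ler_wpM2l//; apply: le_trans (dotF_abs _ _) _.
    have := normF_scalar d (1 : R); rewrite normr1 mulr1 -/dd => h.
    apply: le_trans (ler_wpM2l D0 h) _.
    by rewrite ler_wpM2r ?ler0n// expr2 ler_peMr// ltW.
  have h3 : normF D ^+ 2 * (normF (EW - H) * (1 + normF K) + `|Ec - 1| * dd) <=
      normF D ^+ 2 * lam by rewrite ler_wpM2l ?sqr_ge0.
  have h4 := coercive D.
  move: h1 h2; rewrite !ler_norml => /andP[h1 _] /andP[_ h2]; lra.
rewrite dotFZl -/c -/D; lra.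
Qed.

End drift.

(** * Boundedness of the estimates *)

Section estimator.
Context {disp : measure_display} {T : measurableType disp} {R : realType}.
Variable P : probability T R.
Context {p d : nat}.
Variable hessg : 'cV[R]_p -> 'cV[R]_d -> 'M[R]_d.
Hypothesis hessg_meas : measurable_fun setT
  (fun xh : 'cV[R]_p * 'cV[R]_d => hessg xh.1 xh.2).
Variables (Xs : nat -> {RV P >-> 'cV[R]_p}) (Z : nat -> {RV P >-> 'cV[R]_d}).
Hypotheses (Xs_iid : iid Xs) (Z_iid : iid Z).
Hypothesis XZ_indep : independent2 P (sigma_seq Xs) (sigma_seq Z).
Variable thetah : nat -> T -> 'cV[R]_d.
Hypothesis thetah_adapted : forall n, adapted Xs Z n (thetah n).
Variables gam bet bet' : nat -> R.
Hypothesis gam_gt0 : forall n, 0 < gam n.+1.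
Hypothesis bet_gt0 : forall n, 0 < bet n.+1.
Hypothesis bet'_gt0 : forall n, 0 < bet' n.+1.
Variable A0 : 'M[R]_d.
Hypothesis A0_sym : A0^T = A0.

Let est n w := inv_hessian_est gam bet bet' hessg A0
  (fun k => Xs k w) (fun k => Z k w) (fun k => thetah k w) n.
Let xi n w := (Xs n.+1 w, Z n.+1 w).
Let W n h w := trunc (bet n.+1) (hessg^~ h) (xi n w).
Let kp n h w := keep (bet n.+1) (hessg^~ h) (xi n w).

Variables (EW : nat -> 'cV[R]_d -> 'M[R]_d) (Ek : nat -> 'cV[R]_d -> R) (K2 : R).
Hypothesis K2_ge0 : 0 <= K2.
Hypothesis fresh_mean : forall n h (phi : T -> R) c0 (C : 'M[R]_d) c1 c2,
  0 <= c2 -> measurable_fun setT phi -> (forall w, 0 <= phi w) ->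
  (forall w, phi w <= c0 + dotF C (W n h w) + c1 * kp n h w +
                      c2 * normF (W n h w) ^+ 2) ->
  (\int[P]_w (phi w)%:E <= (c0 + dotF C (EW n h) + c1 * Ek n h + c2 * K2)%:E)%E.

Let estS n w : est n.+1 w =
  step (gam n.+1) (bet n.+1) (bet' n.+1) (hessg^~ (thetah n w)) (est n w) (xi n w).
Proof. exact: inv_hessian_estS. Qed.

Lemma est_sym n w : (est n w)^T = est n w.
Proof.
by elim: n => [|n IH] //; rewrite estS step_sym// ltW// bet'_gt0.
Qed.

Lemma measurable_step_comp {dS} {S : measurableType dS} g b b' (A : S -> 'M[R]_d)
    (h : S -> 'cV[R]_d) (xz : S -> 'cV[R]_p * 'cV[R]_d) : 0 <= b' ->
  measurable_fun setT A -> measurable_fun setT h -> measurable_fun setT xz ->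
  [/\ measurable_fun setT (fun s => trunc b (hessg^~ (h s)) (xz s)),
      measurable_fun setT (fun s => keep b (hessg^~ (h s)) (xz s)) &
      measurable_fun setT (fun s => step g b b' (hessg^~ (h s)) (A s) (xz s))].
Proof.
move=> b'0 mA mh mxz.
have mx : measurable_fun setT (fun s => (xz s).1) by exact: measurableT_comp measurable_fst mxz.
have mz : measurable_fun setT (fun s => (xz s).2) by exact: measurableT_comp measurable_snd mxz.
have mhs : measurable_fun setT (fun s => hessg (xz s).1 (h s)).
  exact: (measurableT_comp hessg_meas (measurable_fun_pair mx mh)).
have mraw : measurable_fun setT (fun s => raw (hessg^~ (h s)) (xz s)).
  apply: measurable_mulmx => //; apply: measurable_mulmx => //.
  exact: measurable_trmx.
have mkeep : measurable_fun setT (fun s => keep b (hessg^~ (h s)) (xz s)).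
  apply: (measurableT_comp (f := fun b : bool => b%:R : R)) => //.
  by apply: measurable_fun_ler => //; exact: measurable_normF.
have mtrunc : measurable_fun setT (fun s => trunc b (hessg^~ (h s)) (xz s)).
  exact: measurable_scalemx.
split => //; rewrite /step; under eq_fun do rewrite projFE//.
apply: measurable_clipF; apply: measurable_subrmx => //.
apply: measurable_scalemx => //; apply: measurable_subrmx.
  by apply: measurable_addmx; apply: measurable_mulmx => //; exact: measurable_trmx.
under eq_fun do rewrite -scalemx1.
by apply: measurable_scalemx => //; apply: measurable_funM.
Qed.

Lemma est_adapted n : adapted Xs Z n (est n).
Proof.
elim: n => [|n IH]; first exact: adapted_cst.
have -> : est n.+1 = fun w => (fun y : 'M[R]_d * 'cV[R]_d * ('cV[R]_p * 'cV[R]_d) =>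
    step (gam n.+1) (bet n.+1) (bet' n.+1) (hessg^~ y.1.2) y.1.1 y.2)
    (est n w, thetah n w, xi n w).
  by apply/funext => w; rewrite estS.
apply: (adapted_comp (f := fun y : 'M[R]_d * 'cV[R]_d * ('cV[R]_p * 'cV[R]_d) =>
    step (gam n.+1) (bet n.+1) (bet' n.+1) (hessg^~ y.1.2) y.1.1 y.2)
    (Y := fun w => (est n w, thetah n w, xi n w))).
  have [] // := @measurable_step_comp _
    ('M[R]_d * 'cV[R]_d * ('cV[R]_p * 'cV[R]_d))%type (gam n.+1) (bet n.+1) (bet' n.+1)
    (fun y => y.1.1) (fun y => y.1.2) (fun y => y.2).
  - by rewrite ltW// bet'_gt0.
  - exact: measurableT_comp measurable_fst measurable_fst.
  - exact: measurableT_comp measurable_snd measurable_fst.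
  - exact: measurable_snd.
apply: adapted_pair; last exact: adapted_fresh.
by apply: adapted_pair; apply: adaptedS.
Qed.

Section boundedness.
Variables (H : 'M[R]_d) (lam : R).
Hypothesis H_posdef : posdef H.
Hypothesis coercive : forall X : 'M[R]_d, lam * normF X ^+ 2 <= dotF X (H *m X).
Let K := invmx H.
Let dd : R := (d * d)%:R.
Let Cd := drift_const H K2.

Variables (near_theta : pred 'cV[R]_d) (N : nat) (pot : nat -> R).
Hypothesis near_theta_meas : measurable_fun setT near_theta.
Hypothesis N_gt0 : (0 < N)%N.
Hypothesis small_bias : forall n h, (N <= n)%N -> near_theta h ->
  normF (EW n h - H) * (1 + normF K) + `|Ek n h - 1| * dd <= lam.
Hypothesis bet'_large : forall n, (N <= n)%N -> normF K + 1 <= bet' n.+1.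
Hypothesis pot_ge1 : forall n, (N <= n)%N -> 1 <= pot n.
Hypothesis pot_dec : forall n, (N <= n)%N ->
  (1 + Cd * gam n.+1 ^+ 2) * pot n.+1 <= pot n.

Let Cd_ge0 : 0 <= Cd.
Proof.
apply: addr_ge0; first by rewrite mulr_ge0 ?sqr_ge0.
by rewrite mulr_ge0 ?sqr_ge0// mulr_ge0.
Qed.

Lemma measurable_lyapf {dS} {S : measurableType dS} (A : S -> 'M[R]_d) :
  measurable_fun setT A -> measurable_fun setT (fun s => lyapf K (A s)).
Proof.
move=> mA; apply: measurable_funD => //; apply: measurable_funX.
apply: measurable_maxr => //; apply: measurable_funB => //.
by apply: measurable_normF; exact: measurable_subrmx.
Qed.

Lemma one_step_drift n A h : (N <= n)%N -> near_theta h -> A^T = A ->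
  (\int[P]_w (lyapf K (step (gam n.+1) (bet n.+1) (bet' n.+1) (hessg^~ h) A (xi n w)))%:E
   <= ((1 + Cd * gam n.+1 ^+ 2) * lyapf K A)%:E)%E.
Proof.
move=> Nn th As; have g0 := gam_gt0 n.
pose phi w := lyapf K (step (gam n.+1) (bet n.+1) (bet' n.+1) (hessg^~ h) A (xi n w)).
suff /le_trans : (\int[P]_w (phi w)%:E <=
  (lyapf K A + 8 * gam n.+1 ^+ 2 * dd ^+ 2 +
    dotF (- (4 * shrink K A * gam n.+1) *: ((A - K) *m A)) (EW n h) +
    4 * shrink K A * gam n.+1 * dotF (A - K) 1%:M * Ek n h +
    8 * gam n.+1 ^+ 2 * normF A ^+ 2 * K2)%:E)%E.
  apply; rewrite lee_fin; apply: drift_bound => //; [exact: ltW|exact: small_bias].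
apply: fresh_mean.
- by rewrite mulr_ge0 ?sqr_ge0// mulr_ge0 ?sqr_ge0.
- apply: measurable_lyapf.
  have [] // := @measurable_step_comp _ T (gam n.+1) (bet n.+1) (bet' n.+1)
    (fun=> A) (fun=> h) (xi n); first by rewrite ltW// bet'_gt0.
  exact: measurable_fun_pair.
- by move=> w; rewrite (le_trans ler01)// lyapf_ge1.
- move=> w; rewrite /phi /step -/(W n h w) -/(kp n h w) -scaleNr.
  apply: le_trans (lyapf_projF _ _ (bet'_large Nn)) _.
  have As' : (A - K)^T = A - K.
    by rewrite linearB /= As /K invmx_posdef_sym.
  rewrite dotFZr dotF_incr// dotFZl normFZ exprMn.
  have -> : `|- gam n.+1| ^+ 2 = gam n.+1 ^+ 2 by rewrite normrN ger0_norm// ltW.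
  set V := W n h w; set k := kp n h w.
  have hI : normF (incr A V k) ^+ 2 <= 8 * normF A ^+ 2 * normF V ^+ 2 + 8 * dd ^+ 2.
    by apply: normF_incr_sqr; rewrite keep_ge0 keep_le1.
  have := ler_wpM2l (sqr_ge0 (gam n.+1)) hI.
  set s := shrink K A; set a := dotF (_ *m _) _; set c := dotF _ 1%:M.
  set I2 := normF (incr A V k) ^+ 2; set A2 := normF A ^+ 2; set V2 := normF V ^+ 2.
  lra.
Qed.

(** A deterministic bound for the energy at time [N]: since [0 < N], the estimate there is the
    output of a projection. *)
Let G := 1 + (bet' N + normF K) ^+ 2.

Section crossing.
Variable lev : R.

Let ok n w := near_theta (thetah n w) && (lyapf K (est n w) < lev).
Let alive n w := all (fun k => ok k w) (index_iota N n.+1).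

Let aliveS n w : (N <= n.+1)%N -> alive n.+1 w = alive n w && ok n.+1 w.
Proof.
move=> Nn; rewrite /alive /index_iota subSn// -addn1 iotaD all_cat /= andbT.
by rewrite subnKC.
Qed.

Let ok_adapted n : adapted Xs Z n (ok n).
Proof.
have -> : ok n = fun w => (fun y : 'M[R]_d * 'cV[R]_d =>
   near_theta y.2 && (lyapf K y.1 < lev)) (est n w, thetah n w) by [].
apply: (adapted_comp (f := fun y : 'M[R]_d * 'cV[R]_d =>
   near_theta y.2 && (lyapf K y.1 < lev)) (Y := fun w => (est n w, thetah n w))).
  apply: measurable_and; first exact: measurableT_comp near_theta_meas measurable_snd.
  by apply: measurable_fun_ltr => //; apply: measurable_lyapf; exact: measurable_fst.
by apply: adapted_pair; [exact: est_adapted|exact: thetah_adapted].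
Qed.

Let alive_adapted n : (N <= n)%N -> adapted Xs Z n (alive n).
Proof.
elim: n => [|n IH].
  by rewrite leqn0 => /eqP N0; have := N_gt0; rewrite N0.
rewrite leq_eqVlt => /predU1P[NE|Nn].
  have -> : alive n.+1 = ok n.+1.
    by apply/funext => w; rewrite /alive -NE /index_iota subSn// subnn /= andbT.
  exact: ok_adapted.
have -> : alive n.+1 = fun w => (fun y : bool * bool => y.1 && y.2) (alive n w, ok n.+1 w).
  by apply/funext => w; rewrite aliveS// ltnW.
apply: (adapted_comp (f := fun y : bool * bool => y.1 && y.2)
  (Y := fun w => (alive n w, ok n.+1 w))).
  by apply: measurable_and.
by apply: adapted_pair => //; apply: adaptedS; exact: IH.
Qed.

(* [est] is killed when it reaches [lev] or when [thetah] leaves the neighbourhood of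
   [theta]. The killed energy is almost nonincreasing and each crossing costs [lev] of
   it, hence a crossing has probability O(1 / lev). *)
Let energy n := (\int[P]_w (if alive n w then lyapf K (est n w) else 0)%:E)%E.

Let crossing n := [set w | alive n w && (lev <= lyapf K (est n.+1 w))].

Let mset (b : T -> bool) : measurable_fun setT b -> measurable [set w | b w].
Proof. by move=> /(_ measurableT [set true]); rewrite setTI; apply. Qed.

Let mest n : measurable_fun setT (est n).
Proof. by apply: (adapted_measurable (X := Xs) (Z := Z) (n := n)); exact: est_adapted. Qed.

Let mlyapf n : measurable_fun setT (fun w => lyapf K (est n w)).
Proof. exact: measurable_lyapf. Qed.

Let malive n : (N <= n)%N -> measurable_fun setT (alive n).
Proof. by move=> Nn; apply: (adapted_measurable (X := Xs) (Z := Z) (n := n)); exact: alive_adapted. Qed.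

Let mcrossing n : (N <= n)%N -> measurable (crossing n).
Proof.
move=> Nn; apply: mset; apply: measurable_and; first exact: malive.
exact: measurable_fun_ler.
Qed.

Hypothesis lev_ge0 : 0 <= lev.

Let l0 n w : 0 <= lyapf K (est n w).
Proof. by rewrite (le_trans ler01)// lyapf_ge1. Qed.

Let next_energy n := (\int[P]_w (if alive n w then lyapf K (est n.+1 w) else 0)%:E)%E.

(** Pointwise: a trajectory alive at time [n] that crosses is no longer alive at [n.+1], and its
    energy there is at least [lev]; one that does not cross contributes at most its energy. *)
Let energy_next n : (N <= n)%N ->
  (energy n.+1 + lev%:E * P (crossing n) <= next_energy n)%E.
Proof.
move=> Nn.
have -> : (lev%:E * P (crossing n) = \int[P]_w (lev * \1_(crossing n) w)%:E)%E.
  under eq_integral do rewrite EFinM.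
  rewrite ge0_integralZl_EFin//; first by rewrite integral_indic ?setIT//; exact: mcrossing.
  by apply/measurable_EFinP; apply: measurable_indic; exact: mcrossing.
have m1 : measurable_fun setT (fun w => if alive n.+1 w then lyapf K (est n.+1 w) else 0).
  by apply: measurable_fun_ifT => //; apply: malive; exact: leqW.
have m2 : measurable_fun setT (fun w => lev * \1_(crossing n) w : R).
  by apply: measurable_funM => //; apply: measurable_indic; exact: mcrossing.
rewrite /energy -ge0_integralD//=.
- apply: ge0_le_integral => //.
  + by move=> w _; rewrite adde_ge0// lee_fin; [case: ifP|rewrite mulr_ge0].
  + by apply: emeasurable_funD; exact/measurable_EFinP.
  + apply/measurable_EFinP; apply: measurable_fun_ifT => //; exact: malive.
  + move=> w _; rewrite -EFinD lee_fin aliveS ?leqW//.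
    rewrite indicE; case: (boolP (alive n w)) => aw /=; last first.
      by rewrite memNset ?mulr0 ?addr0// /crossing /= (negPf aw).
    have [h|h] := ltP (lyapf K (est n.+1 w)) lev.
      rewrite memNset; last by rewrite /crossing /= aw leNgt h.
      by rewrite mulr0 addr0; case: ifP.
    rewrite mem_set; last by rewrite /crossing /= aw.
    by rewrite mulr1 /ok [_ < lev]ltNge h andbF add0r.
- by move=> w _; rewrite lee_fin; case: ifP.
- exact/measurable_EFinP.
- by move=> w _; rewrite lee_fin mulr_ge0.
- exact/measurable_EFinP.
Qed.

(** [alive n] is determined at time [n], so [integral_fresh] reduces the claim to [one_step_drift]
    with [est n] and [thetah n] frozen. *)
Let next_energy_le n : (N <= n)%N ->
  (next_energy n <= (1 + Cd * gam n.+1 ^+ 2)%:E * energy n)%E.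
Proof.
move=> Nn.
pose S := ('M[R]_d * 'cV[R]_d * bool)%type.
pose stp (y : S * ('cV[R]_p * 'cV[R]_d)) :=
  step (gam n.+1) (bet n.+1) (bet' n.+1) (hessg^~ y.1.1.2) y.1.1.1 y.2.
pose phi y := (if y.1.2 then lyapf K (stp y) else 0)%:E.
pose Y w : S := (est n w, thetah n w, alive n w).
have aY : adapted Xs Z n Y.
  apply: adapted_pair; last exact: alive_adapted.
  by apply: adapted_pair; [exact: est_adapted|exact: thetah_adapted].
have mstp : measurable_fun setT stp.
  have mf1 : measurable_fun setT (fun y : S * ('cV[R]_p * 'cV[R]_d) => y.1.1).
    exact: measurableT_comp measurable_fst measurable_fst.
  have [] // := @measurable_step_comp _ (S * ('cV[R]_p * 'cV[R]_d))%type
    (gam n.+1) (bet n.+1) (bet' n.+1)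
    (fun y => y.1.1.1) (fun y => y.1.1.2) (fun y => y.2).
  - by rewrite ltW// bet'_gt0.
  - exact: measurableT_comp measurable_fst mf1.
  - exact: measurableT_comp measurable_snd mf1.
  - exact: measurable_snd.
have mphi : measurable_fun [set: (S * ('cV[R]_p * 'cV[R]_d))%type] phi.
  apply/measurable_EFinP; apply: measurable_fun_ifT => //.
    exact: measurableT_comp measurable_snd measurable_fst.
  exact: measurable_lyapf.
have -> : next_energy n = (\int[P]_w phi (Y w, xi n w))%E.
  by apply: eq_integral => w _; rewrite /phi /= /stp /= -estS.
have phi0 y : (0 <= phi y)%E.
  by rewrite lee_fin; case: ifP => // _; rewrite (le_trans ler01)// lyapf_ge1.
rewrite (integral_fresh Xs_iid Z_iid XZ_indep aY)//.
have c0 : 0 <= 1 + Cd * gam n.+1 ^+ 2 by rewrite addr_ge0// mulr_ge0 ?sqr_ge0.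
rewrite /energy -ge0_integralZl_EFin//.
- apply: ge0_le_integral => //.
  + by move=> w _; apply: integral_ge0 => x _; rewrite lee_fin; case: ifP => // _;
      rewrite (le_trans ler01)// lyapf_ge1.
  + have mY : measurable_fun setT Y := adapted_measurable aY.
    pose Ym : {mfun T >-> S} := HB.pack Y (isMeasurableFun.Build _ _ _ _ _ mY).
    have mxi : measurable_fun setT (xi n) by exact: measurable_fun_pair.
    pose xm : {mfun T >-> ('cV[R]_p * 'cV[R]_d)%type} :=
      HB.pack (xi n) (isMeasurableFun.Build _ _ _ _ _ mxi).
    exact: (@measurable_independent_integral _ _ _ P _ _ _ _ Ym xm phi mphi phi0).
  + apply: measurable_funeM; apply/measurable_EFinP.
    by apply: measurable_fun_ifT => //; exact: malive.
  + move=> w _; rewrite -EFinM /phi /Y /=.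
    case: ifPn => aw; last by rewrite integral0 mulr0.
    apply: one_step_drift => //; last exact: est_sym.
    have : ok n w by move/allP: aw; apply; rewrite mem_index_iota Nn ltnSn.
    by case/andP.
- by move=> w _; rewrite lee_fin; case: ifP.
- by apply/measurable_EFinP; apply: measurable_fun_ifT => //; exact: malive.
Qed.

Let lyapf_start w : lyapf K (est N w) <= G.
Proof.
apply: lyapf_bound; apply: le_trans (normF_triangleB _ _) _; rewrite lerD2r.
case: N N_gt0 => // m _; rewrite estS /step projFE; last exact: ltW.
by apply: clipF_ball; exact: ltW.
Qed.

Let energy_ge0 n : (0 <= energy n)%E.
Proof. by apply: integral_ge0 => w _; rewrite lee_fin; case: ifP. Qed.

(** Discrete optional stopping: by [pot_dec] the product of [pot] and the energy does not increase,
    and each crossing removes at least [lev] times its probability because [pot] is at least 1. *)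
Let crossing_sum m :
  ((pot (N + m))%:E * energy (N + m) + lev%:E * \sum_(0 <= k < m) P (crossing (N + k))
    <= (pot N * G)%:E)%E.
Proof.
have pot_ge0 n : (N <= n)%N -> 0 <= pot n.
  by move=> Nn; rewrite (le_trans ler01)// pot_ge1.
elim: m => [|m IH].
  rewrite big_geq// mule0 adde0 addn0 EFinM lee_wpmul2l ?lee_fin ?pot_ge0//.
  apply: (@le_trans _ _ (\int[P]_w G%:E)%E).
    apply: ge0_le_integral => //.
    - by move=> w _; rewrite lee_fin; case: ifP.
    - by apply/measurable_EFinP; apply: measurable_fun_ifT => //; exact: malive.
    - move=> w _; rewrite lee_fin; case: ifP => _; first exact: lyapf_start.
      by rewrite addr_ge0// sqr_ge0.
  by rewrite integral_cst// [X in (_ * X)%E](probability_setT P) mule1.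
apply: le_trans IH.
rewrite big_nat_recr//=.
set s := (\sum_(0 <= k < m) _)%R.
have s0 : (0 <= s)%E by rewrite sume_ge0.
rewrite -[(s + _)%R]/(s + P (crossing (N + m)))%E (ge0_muleDr _ s0)//.
rewrite addeCA [leRHS]addeC; apply: leeD => //.
rewrite addnS.
have Nm : (N <= N + m)%N by exact: leq_addr.
have h1 := energy_next Nm; have h2 := next_energy_le Nm.
apply: (@le_trans _ _ ((pot (N + m).+1)%:E *
  (energy (N + m).+1 + lev%:E * P (crossing (N + m))))%E).
  have lP : (0 <= lev%:E * P (crossing (N + m)))%E by rewrite mule_ge0.
  rewrite (ge0_muleDr _ (energy_ge0 _) lP); apply: leeD => //.
  by rewrite -[leLHS]mul1e lee_wpmul2r ?mule_ge0// lee_fin pot_ge1// leqW.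
apply: le_trans (lee_wpmul2l _ (le_trans h1 h2)) _.
  by rewrite lee_fin pot_ge0// leqW.
rewrite muleA -EFinM lee_wpmul2r ?energy_ge0// lee_fin mulrC.
exact: pot_dec.
Qed.

Let crossing_union : (lev%:E * P (\bigcup_k crossing (N + k)) <= (pot N * G)%:E)%E.
Proof.
have mc k : measurable (crossing (N + k)) by apply: mcrossing; exact: leq_addr.
have mU : measurable (\bigcup_k crossing (N + k)) by exact: bigcup_measurable.
apply: (@le_trans _ _ (lev%:E * \sum_(0 <= k <oo) P (crossing (N + k)))%E).
  rewrite lee_wpmul2l ?lee_fin//.
  exact: (@measure_sigma_subadditive _ _ _ P _ (fun k => crossing (N + k)) mc mU (fun _ h => h)).
rewrite -nneseriesZl//; apply: lime_le; first by apply: is_cvg_nneseries => *; rewrite mule_ge0.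
apply: nearW => m; rewrite -ge0_sume_distrr//.
apply: le_trans (crossing_sum m); rewrite leeDr// mule_ge0// lee_fin.
by rewrite (le_trans ler01)// pot_ge1// leq_addr.
Qed.

(** The first index where the level is reached lies beyond [N], by [lyapf_start], and the trajectory
    is alive just before it. *)
Let crossingP w : G < lev -> (forall k, (N <= k)%N -> near_theta (thetah k w)) ->
  (exists2 k, (N <= k)%N & lev <= lyapf K (est k w)) ->
  (\bigcup_k crossing (N + k)) w.
Proof.
move=> Glev th [k Nk levk].
have ex : exists k, (N <= k)%N && (lev <= lyapf K (est k w)) by exists k; rewrite Nk.
case: (ex_minnP ex) => j /andP[Nj levj] jmin.
have NltJ : (N < j)%N.
  rewrite ltn_neqAle Nj andbT; apply/eqP => NE; move: levj; rewrite -NE leNgt.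
  by rewrite (le_lt_trans (lyapf_start w)).
case: j NltJ Nj levj jmin => // j; rewrite ltnS => Nj _ levj jmin.
exists (j - N)%N => //; rewrite /crossing /= subnKC// levj andbT.
apply/allP => i; rewrite mem_index_iota ltnS => /andP[Ni ij].
rewrite /ok th//= ltNge; apply/negP => levi.
by have := jmin i; rewrite Ni levi => /(_ isT); rewrite leqNgt ltnS ij.
Qed.

Lemma crossing_cover : G < lev -> exists V, [/\ measurable V,
  (lev%:E * P V <= (pot N * G)%:E)%E & forall w,
    (forall k, (N <= k)%N -> near_theta (thetah k w)) ->
    (exists2 k, (N <= k)%N & lev <= lyapf K (est k w)) -> V w].
Proof.
move=> Glev; exists (\bigcup_k crossing (N + k)); split.
- by apply: bigcup_measurable => k _; apply: mcrossing; exact: leq_addr.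
- exact: crossing_union.
- by move=> w; exact: crossingP.
Qed.

End crossing.

(** The covering event for level [m0 + m] has probability at most [pot N * G / (m0 + m)], so the
    intersection over [m] is null. The offset [m0] makes every level exceed [G]. *)
Lemma unbounded_negligible : P.-negligible [set w |
  (forall k, (N <= k)%N -> near_theta (thetah k w)) /\
  forall m : nat, exists2 k, (N <= k)%N & m%:R <= lyapf K (est k w)].
Proof.
pose m0 := (Num.truncn G).+1.
have Gm m : G < (m0 + m)%:R.
  by rewrite (lt_le_trans (truncnS_gt G))// ler_nat leq_addr.
have lev0 m : 0 <= (m0 + m)%:R :> R by [].
pose V m := sval (cid (crossing_cover (lev0 m) (Gm m))).
have VP m : [/\ measurable (V m), ((m0 + m)%:R%:E * P (V m) <= (pot N * G)%:E)%E &
    forall w, (forall k, (N <= k)%N -> near_theta (thetah k w)) ->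
    (exists2 k, (N <= k)%N & (m0 + m)%:R <= lyapf K (est k w)) -> V m w].
  by rewrite /V; case: cid.
exists (\bigcap_m V m); split.
- by apply: bigcapT_measurable => m; case: (VP m).
- have mV : measurable (\bigcap_m V m).
    by apply: bigcapT_measurable => m; case: (VP m).
  set x := P _; have xfin : x \is a fin_num by exact: fin_num_measure.
  apply/eqP; rewrite eq_le measure_ge0 andbT -(fineK xfin) lee_fin leNgt.
  apply/negP => x0.
  pose m := (Num.truncn (pot N * G / fine x)).+1.
  have h : (m%:R%:E * x <= (pot N * G)%:E)%E.
    have [mVm hm _] := VP m.
    apply: le_trans hm; apply: lee_pmul; rewrite ?lee_fin ?ler_nat ?leq_addl//.
    exact: measure_ge0.
    by apply: le_measure; rewrite ?inE//; exact: bigcap_inf.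
  move: h; rewrite -(fineK xfin) -EFinM lee_fin -ler_pdivlMr// leNgt.
  by rewrite truncnS_gt.
- by move=> w [th unb] m _; case: (VP m) => _ _; apply.
Qed.

End boundedness.

(** * Exponential moments of the noise *)

Section noise.
Variable lev : R.
Hypothesis lev_ge0 : 0 <= lev.
Let dd : R := (d * d)%:R.

Variable KE : R.
Hypothesis EW_bound : forall n h, normF (EW n h) <= KE.
Hypothesis Ek01 : forall n h, 0 <= Ek n h <= 1.
Hypothesis EW_meas : forall n, measurable_fun setT (EW n).
Hypothesis Ek_meas : forall n, measurable_fun setT (Ek n).

(* The cutoff makes the noise bounded, and does nothing to a trajectory bounded by [lev]. *)
Definition cutoff (A : 'M[R]_d) : 'M[R]_d := if normF A <= lev then A else 0.

(** Mean minus realised increment, so that the recursion, which subtracts the realised one, is the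
    mean recursion plus this noise. *)
Definition centred n A h (xz : 'cV[R]_p * 'cV[R]_d) : 'M[R]_d :=
  incr A (EW n h) (Ek n h) -
  incr A (trunc (bet n.+1) (hessg^~ h) xz) (keep (bet n.+1) (hessg^~ h) xz).

Definition noise n w := centred n (cutoff (est n w)) (thetah n w) (xi n w).

Lemma normF_cutoff A : normF (cutoff A) <= lev.
Proof. by rewrite /cutoff; case: ifP => //; rewrite normF0. Qed.

Let KE_ge0 : 0 <= KE.
Proof. exact: le_trans (normF_ge0 _) (EW_bound 0 0). Qed.

Definition noise_bound n : R := 2 * lev * (KE + bet n.+1) + 4 * dd.

Lemma noise_bounded n A h xz : normF A <= lev ->
  normF (centred n A h xz) <= noise_bound n.
Proof.
move=> Al; apply: le_trans (normF_triangleB _ _) _.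
have A0' := normF_ge0 A.
have k01 := keep_ge0 (bet n.+1) (hessg^~ h) xz.
have h1 := normF_incr A (EW n h) (Ek01 n h).
have h2 := @normF_incr _ _ A (trunc (bet n.+1) (hessg^~ h) xz) (keep (bet n.+1) (hessg^~ h) xz).
rewrite keep_ge0 keep_le1 in h2; have {}h2 := h2 isT.
have h3 : normF A * normF (EW n h) <= lev * KE by apply: ler_pM; rewrite ?normF_ge0.
have h4 : normF A * normF (trunc (bet n.+1) (hessg^~ h) xz) <= lev * bet n.+1.
  by apply: ler_pM; rewrite ?normF_ge0// normF_trunc// ltW.
by rewrite /noise_bound /dd; lra.
Qed.

(** Twice the bound of [normF_incr_sqr] for the mean increment plus twice the one for the realised
    increment, with [K2] as second moment. *)
Definition noise_var : R := 16 * lev ^+ 2 * (KE ^+ 2 + K2) + 32 * dd ^+ 2.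

Lemma noise_var_ge0 : 0 <= noise_var.
Proof.
apply: addr_ge0; last by rewrite mulr_ge0 ?sqr_ge0.
by rewrite mulr_ge0 ?addr_ge0 ?sqr_ge0// mulr_ge0 ?sqr_ge0.
Qed.

Lemma measurable_incr {dS} {S : measurableType dS} (A V : S -> 'M[R]_d) (c : S -> R) :
  measurable_fun setT A -> measurable_fun setT V -> measurable_fun setT c ->
  measurable_fun setT (fun s => incr (A s) (V s) (c s)).
Proof.
move=> mA mV mc; apply: measurable_subrmx.
  by apply: measurable_addmx; apply: measurable_mulmx => //; exact: measurable_trmx.
under eq_fun do rewrite -scalemx1.
by apply: measurable_scalemx => //; apply: measurable_funM.
Qed.

Lemma measurable_centred {dS} {S : measurableType dS} n (A : S -> 'M[R]_d)
    (h : S -> 'cV[R]_d) (xz : S -> 'cV[R]_p * 'cV[R]_d) :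
  measurable_fun setT A -> measurable_fun setT h -> measurable_fun setT xz ->
  measurable_fun setT (fun s => centred n (A s) (h s) (xz s)).
Proof.
move=> mA mh mxz.
have [//|//|//|//|m1 m2 _] := @measurable_step_comp _ S 0 (bet n.+1) (bet' n.+1) A h xz.
  by rewrite ltW// bet'_gt0.
apply: measurable_subrmx; apply: measurable_incr => //.
  exact: measurableT_comp (EW_meas n) mh.
exact: measurableT_comp (Ek_meas n) mh.
Qed.

Lemma measurable_cutoff {dS} {S : measurableType dS} (A : S -> 'M[R]_d) :
  measurable_fun setT A -> measurable_fun setT (fun s => cutoff (A s)).
Proof.
move=> mA; apply: measurable_fun_ifT => //.
by apply: measurable_fun_ler => //; exact: measurable_normF.
Qed.

Lemma exp_moment_step n A h (U : 'M[R]_d) a : normF A <= lev ->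
  normF U * noise_bound n <= 1 / 3 ->
  (\int[P]_w (expR a * expR (dotF U (centred n A h (xi n w))))%:E <=
   (expR a * (1 + noise_var * normF U ^+ 2))%:E)%E.
Proof.
move=> Al small; have A0' := normF_ge0 A; have U0 := normF_ge0 U.
set m := incr A (EW n h) (Ek n h).
set C := U^T *m A + U *m A.
set tI := dotF U 1%:M.
pose c0 := expR a * (1 + dotF U m + normF U ^+ 2 * (2 * normF m ^+ 2 + 16 * dd ^+ 2)).
pose c2 := expR a * (normF U ^+ 2 * (16 * normF A ^+ 2)).
have mE : dotF U m = dotF C (EW n h) - 2 * Ek n h * tI by exact: dotF_incr_affine.
suff /le_trans : (\int[P]_w (expR a * expR (dotF U (centred n A h (xi n w))))%:E <=
  (c0 + dotF (- expR a *: C) (EW n h) + expR a * 2 * tI * Ek n h + c2 * K2)%:E)%E.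
  apply; rewrite lee_fin dotFZl /c0 /c2.
  have -> : expR a * (1 + dotF U m + normF U ^+ 2 * (2 * normF m ^+ 2 + 16 * dd ^+ 2)) +
      - expR a * dotF C (EW n h) + expR a * 2 * tI * Ek n h +
      expR a * (normF U ^+ 2 * (16 * normF A ^+ 2)) * K2 =
    expR a * (1 + (2 * normF m ^+ 2 + 16 * dd ^+ 2 + 16 * normF A ^+ 2 * K2) *
       normF U ^+ 2) by rewrite mE; ring.
  rewrite ler_wpM2l ?expR_ge0// lerD2l ler_wpM2r ?sqr_ge0// /noise_var.
  have hm := normF_incr_sqr A (EW n h) (Ek01 n h).
  rewrite -/m -/dd in hm.
  have A2 : normF A ^+ 2 <= lev ^+ 2 by rewrite ler_pXn2r ?nnegrE.
  have h1 : normF A ^+ 2 * normF (EW n h) ^+ 2 <= lev ^+ 2 * KE ^+ 2.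
    by apply: ler_pM; rewrite ?sqr_ge0// ler_pXn2r ?nnegrE ?normF_ge0.
  have h2 : normF A ^+ 2 * K2 <= lev ^+ 2 * K2 by rewrite ler_wpM2r.
  by lra.
apply: fresh_mean.
- by rewrite /c2 mulr_ge0 ?expR_ge0// mulr_ge0 ?sqr_ge0// mulr_ge0 ?sqr_ge0.
- apply: measurable_funM => //; apply: (measurableT_comp (@measurable_expR R)).
  apply: measurable_dotF => //; apply: measurable_centred => //.
  exact: measurable_fun_pair.
- by move=> w; rewrite mulr_ge0 ?expR_ge0.
move=> w; rewrite -/(W n h w) -/(kp n h w).
set x := dotF U (centred _ _ _ _).
have x3 : x <= 1 / 3.
  apply: le_trans small; apply: le_trans (dotF_le _ _) _.
  by rewrite ler_wpM2l// noise_bounded.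
have xE : x = dotF U m - dotF C (W n h w) + 2 * kp n h w * tI.
  by rewrite /x /centred dotFBr -/m dotF_incr_affine -/C -/tI opprB addrA addrAC.
have x2 : x ^+ 2 <= normF U ^+ 2 *
    (2 * normF m ^+ 2 + 16 * normF A ^+ 2 * normF (W n h w) ^+ 2 + 16 * dd ^+ 2).
  rewrite -[x ^+ 2]real_normK ?num_real//.
  apply: (@le_trans _ _ ((normF U * normF (centred n A h (xi n w))) ^+ 2)).
    by rewrite ler_pXn2r ?nnegrE ?mulr_ge0 ?normF_ge0// dotF_abs.
  rewrite exprMn ler_wpM2l ?sqr_ge0//.
  set V := incr A (trunc (bet n.+1) (hessg^~ h) (xi n w))
     (keep (bet n.+1) (hessg^~ h) (xi n w)).
  have hV : normF V ^+ 2 <= 8 * normF A ^+ 2 * normF (W n h w) ^+ 2 + 8 * dd ^+ 2.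
    by apply: normF_incr_sqr; rewrite keep_ge0 keep_le1.
  have := normF_triangleB m V; rewrite -/(centred _ _ _ _).
  have := normF_ge0 (m - V); have := normF_ge0 m; have := normF_ge0 V.
  move=> v0 m0 mv0 tri.
  apply: (@le_trans _ _ ((normF m + normF V) ^+ 2)).
    by rewrite ler_pXn2r ?nnegrE ?addr_ge0.
  have := sqr_ge0 (normF m - normF V); lra.
apply: (@le_trans _ _ (expR a * (1 + x + x ^+ 2))).
  by rewrite ler_wpM2l ?expR_ge0// expR_le_quad.
apply: (@le_trans _ _ (expR a * (1 + x + normF U ^+ 2 *
    (2 * normF m ^+ 2 + 16 * normF A ^+ 2 * normF (W n h w) ^+ 2 + 16 * dd ^+ 2)))).
  by rewrite ler_wpM2l ?expR_ge0// lerD2l.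
rewrite xE dotFZl /c0 /c2 le_eqVlt; apply/orP; left; apply/eqP; ring.
Qed.

Section noise_recursion.
(** Used twice: with [L] the damping [X - gam n.+1 *: lyap H X] and [c] the step, and with [L] the
    identity and [c] equal to 1. Self-adjointness allows [L] to be moved onto the test matrix. *)
Variables (L : nat -> 'M[R]_d -> 'M[R]_d) (c rho : nat -> R).
Hypothesis c_ge0 : forall n, 0 <= c n.
Hypothesis L_adjoint : forall n U X, dotF U (L n X) = dotF (L n U) X.
Hypothesis L_norm : forall n U, normF (L n U) <= rho n * normF U.
Hypothesis rho_ge0 : forall n, 0 <= rho n.
Hypothesis L_meas : forall n, measurable_fun setT (L n).

Fixpoint noise_sum n w : 'M[R]_d :=
  if n is m.+1 then L m (noise_sum m w) + c m *: noise m w else 0.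

(* A bound for the individual noise terms that enter [noise_sum n], as damped by [L]. *)
Fixpoint noise_sup n : R :=
  if n is m.+1 then Num.max (rho m * noise_sup m) (c m * noise_bound m) else 0.

(** The counterpart of a quadratic variation, in units of [noise_var]. *)
Fixpoint noise_sqr n : R :=
  if n is m.+1 then rho m ^+ 2 * noise_sqr m + c m ^+ 2 else 0.

Lemma noise_sqr_ge0 n : 0 <= noise_sqr n.
Proof.
by elim: n => //= n IH; rewrite addr_ge0 ?sqr_ge0// mulr_ge0 ?sqr_ge0.
Qed.

Lemma noise_sum_adapted n : adapted Xs Z n (noise_sum n).
Proof.
elim: n => [|n IH]; first exact: adapted_cst.
pose S := ('M[R]_d * 'cV[R]_d * 'M[R]_d * ('cV[R]_p * 'cV[R]_d))%type.
pose f (y : S) := L n y.1.2 + c n *: centred n (cutoff y.1.1.1) y.1.1.2 y.2.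
apply: (adapted_comp (f := f) (Y := fun w => (est n w, thetah n w, noise_sum n w, xi n w))).
  have mf1 : measurable_fun setT (fun y : S => y.1) by exact: measurable_fst.
  have mf11 : measurable_fun setT (fun y : S => y.1.1).
    exact: measurableT_comp measurable_fst mf1.
  apply: measurable_addmx.
    exact: measurableT_comp (L_meas n) (measurableT_comp measurable_snd mf1).
  apply: measurable_scalemx => //; apply: measurable_centred.
  - by apply: measurable_cutoff; exact: measurableT_comp measurable_fst mf11.
  - exact: measurableT_comp measurable_snd mf11.
  - exact: measurable_snd.
apply: adapted_pair; last exact: adapted_fresh.
apply: adapted_pair; last exact: adaptedS.
apply: adapted_pair; apply: adaptedS; last exact: thetah_adapted.
exact: est_adapted.
Qed.

(** Induction over all test matrices at once: the newest term is integrated against [c n *: U] with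
    the past frozen, and the older ones are tested by [L n U]. The maximum in [noise_sup] provides
    the smallness condition for both. *)
Lemma exp_moment n (U : 'M[R]_d) : normF U * noise_sup n <= 1 / 3 ->
  (\int[P]_w (expR (dotF U (noise_sum n w)))%:E <=
   (expR (noise_var * normF U ^+ 2 * noise_sqr n))%:E)%E.
Proof.
elim: n U => [|n IH] U /= small.
  under eq_integral do rewrite -(scale0r (0 : 'M[R]_d)) dotFZr mul0r expR0.
  by rewrite integral_cst// [X in (_ * X)%E](probability_setT P) mule1 mulr0 expR0.
have U0 := normF_ge0 U.
have small1 : normF (L n U) * noise_sup n <= 1 / 3.
  have sup0 : 0 <= noise_sup n.
    by case: (n) => //= m; rewrite le_max orbC mulr_ge0// (le_trans (normF_ge0 (centred m 0 0 (0, 0))))//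
      noise_bounded// normF0.
  apply: le_trans small; apply: (@le_trans _ _ (normF U * (rho n * noise_sup n))).
    by rewrite mulrA ler_wpM2r// mulrC.
  by rewrite ler_wpM2l// le_max lexx.
have small2 : normF (c n *: U) * noise_bound n <= 1 / 3.
  apply: le_trans small; rewrite normFZ ger0_norm// mulrAC mulrC ler_wpM2l//.
  by rewrite le_max lexx orbT.
pose S := ('M[R]_d * 'cV[R]_d * 'M[R]_d)%type.
pose Y w : S := (est n w, thetah n w, noise_sum n w).
pose phi (y : S * ('cV[R]_p * 'cV[R]_d)) : \bar R :=
  (expR (dotF (L n U) y.1.2) *
   expR (dotF (c n *: U) (centred n (cutoff y.1.1.1) y.1.1.2 y.2)))%:E.
have aY : adapted Xs Z n Y.
  apply: adapted_pair; last exact: noise_sum_adapted.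
  by apply: adapted_pair; [exact: est_adapted|exact: thetah_adapted].
have mphi : measurable_fun [set: (S * ('cV[R]_p * 'cV[R]_d))%type] phi.
  have mf1 : measurable_fun setT (fun y : S * ('cV[R]_p * 'cV[R]_d) => y.1).
    exact: measurable_fst.
  have mf11 : measurable_fun setT (fun y : S * ('cV[R]_p * 'cV[R]_d) => y.1.1).
    exact: measurableT_comp measurable_fst mf1.
  apply/measurable_EFinP; apply: measurable_funM.
    apply: (measurableT_comp (@measurable_expR R)); apply: measurable_dotF => //.
    exact: measurableT_comp measurable_snd mf1.
  apply: (measurableT_comp (@measurable_expR R)); apply: measurable_dotF => //.
  apply: measurable_centred.
  - by apply: measurable_cutoff; exact: measurableT_comp measurable_fst mf11.
  - exact: measurableT_comp measurable_snd mf11.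
  - exact: measurable_snd.
have phi0 y : (0 <= phi y)%E by rewrite lee_fin mulr_ge0 ?expR_ge0.
have -> : (\int[P]_w (expR (dotF U (L n (noise_sum n w) + c n *: noise n w)))%:E =
    \int[P]_w phi (Y w, xi n w))%E.
  apply: eq_integral => w _; rewrite /phi /= -expRD; congr (expR _)%:E.
  by rewrite dotFDr L_adjoint dotFZr dotFZl.
rewrite (integral_fresh Xs_iid Z_iid XZ_indep aY)//.
set v := 1 + noise_var * normF (c n *: U) ^+ 2.
have v0 : 0 <= v by rewrite addr_ge0// mulr_ge0 ?sqr_ge0 ?noise_var_ge0.
have mS : measurable_fun setT (noise_sum n).
  exact: (adapted_measurable (X := Xs) (Z := Z) (n := n) (@noise_sum_adapted n)).
have mE : measurable_fun setT (fun w => expR (dotF (L n U) (noise_sum n w))).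
  by apply: (measurableT_comp (@measurable_expR R)); exact: measurable_dotF.
apply: (@le_trans _ _ (\int[P]_w (v%:E * (expR (dotF (L n U) (noise_sum n w)))%:E))%E).
  apply: ge0_le_integral => //.
  - by move=> w _; apply: integral_ge0.
  - have mY : measurable_fun setT Y := adapted_measurable aY.
    pose Ym : {mfun T >-> S} := HB.pack Y (isMeasurableFun.Build _ _ _ _ _ mY).
    have mxi : measurable_fun setT (xi n) by exact: measurable_fun_pair.
    pose xm : {mfun T >-> ('cV[R]_p * 'cV[R]_d)%type} :=
      HB.pack (xi n) (isMeasurableFun.Build _ _ _ _ _ mxi).
    exact: (@measurable_independent_integral _ _ _ P _ _ _ _ Ym xm phi mphi phi0).
  - by apply: measurable_funeM; exact/measurable_EFinP.
  - move=> w _; rewrite -EFinM [v * _]mulrC.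
    exact: (@exp_moment_step n (cutoff (est n w)) (thetah n w) (c n *: U)
      (dotF (L n U) (noise_sum n w)) (normF_cutoff _) small2).
rewrite ge0_integralZl_EFin//; last exact/measurable_EFinP.
have v0E : (0 <= v%:E)%E by rewrite lee_fin.
apply: (@le_trans _ _ (v%:E *
  (expR (noise_var * normF (L n U) ^+ 2 * noise_sqr n))%:E)%E).
  exact: (lee_wpmul2l v0E (IH _ small1)).
rewrite -EFinM lee_fin.
apply: (@le_trans _ _ (expR (noise_var * normF (c n *: U) ^+ 2) *
   expR (noise_var * normF (L n U) ^+ 2 * noise_sqr n))).
  by rewrite ler_wpM2r ?expR_ge0// expR_ge1Dx.
rewrite -expRD ler_expR normFZ exprMn ger0_norm//.
have h1 : normF (L n U) ^+ 2 <= rho n ^+ 2 * normF U ^+ 2.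
  by rewrite -exprMn ler_pXn2r ?nnegrE ?mulr_ge0 ?normF_ge0.
have h2 : noise_var * noise_sqr n * normF (L n U) ^+ 2 <=
    noise_var * noise_sqr n * (rho n ^+ 2 * normF U ^+ 2).
  by rewrite ler_wpM2l// mulr_ge0 ?noise_var_ge0 ?noise_sqr_ge0.
lra.
Qed.

(** Chernoff's bound: Markov's inequality for the exponential. *)
Lemma noise_tail n (U : 'M[R]_d) (x : R) : normF U * noise_sup n <= 1 / 3 ->
  (P [set w | (x <= dotF U (noise_sum n w))%R] <=
   (expR (noise_var * normF U ^+ 2 * noise_sqr n - x))%:E)%E.
Proof.
move=> small; set E := [set w | _].
have mS : measurable_fun setT (noise_sum n).
  exact: (adapted_measurable (X := Xs) (Z := Z) (n := n) (@noise_sum_adapted n)).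
have md : measurable_fun setT (fun w => dotF U (noise_sum n w)).
  exact: measurable_dotF.
have mE : measurable E.
  by rewrite -[E]setTI; exact: measurable_fun_le.
have h : ((expR x)%:E * P E <= (expR (noise_var * normF U ^+ 2 * noise_sqr n))%:E)%E.
  apply: le_trans (exp_moment small).
  have -> : ((expR x)%:E * P E = \int[P]_w (expR x * \1_E w)%:E)%E.
    under eq_integral do rewrite EFinM.
    rewrite ge0_integralZl_EFin ?expR_ge0//; first by rewrite integral_indic ?setIT.
    by apply/measurable_EFinP; exact: measurable_indic.
  apply: ge0_le_integral => //.
  - by apply/measurable_EFinP; apply: measurable_funM => //; exact: measurable_indic.
  - by apply/measurable_EFinP; exact: (measurableT_comp (@measurable_expR R)).
  - move=> w _; rewrite lee_fin indicE; case: (boolP (w \in E)) => [|_].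
      by rewrite inE /E /= => hx; rewrite mulr1 ler_expR.
    by rewrite mulr0 expR_ge0.
have Pfin : P E \is a fin_num by exact: fin_num_measure.
move: h; rewrite -(fineK Pfin) -EFinM !lee_fin expRD expRN mulrC.
by rewrite -ler_pdivlMr ?expR_gt0.
Qed.

Variables (t : nat -> R) (Cq : R).
Hypothesis t_ok : \forall n \near \oo, [/\ 0 < t n, t n * noise_sup n <= 1 / 3 &
  t n ^+ 2 * noise_sqr n <= Cq * ln n%:R].

(** At scale [t n] the exponential moment costs at most [noise_var * Cq * ln n]. The threshold
    exceeds this by 2 ln n, so the tail is at most n^(-2), which is summable. *)
Lemma noise_rate_functional (U : 'M[R]_d) : normF U <= 1 ->
  {ae P, forall w, \forall n \near \oo,
    dotF U (noise_sum n w) <= (noise_var * Cq + 2) * ln n%:R / t n}.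
Proof.
move=> U1; have U0 := normF_ge0 U.
pose x n := (noise_var * Cq + 2) * ln n%:R : R.
pose E n := [set w | x n <= dotF (t n *: U) (noise_sum n w)].
have sup0 n : 0 <= noise_sup n.
  by case: n => //= m; rewrite le_max orbC mulr_ge0// (le_trans (normF_ge0 (centred m 0 0 (0, 0))))//
    noise_bounded// normF0.
have mE n : measurable (E n).
  rewrite -[E n]setTI; apply: measurable_fun_le => //; apply: measurable_dotF => //.
  exact: (adapted_measurable (X := Xs) (Z := Z) (n := n) (@noise_sum_adapted n)).
have hE : \forall n \near \oo, (P (E n) <= (1 * (n%:R ^+ 2)^-1)%:E)%E.
  near=> n.
  have [t0 ts tq] : [/\ 0 < t n, t n * noise_sup n <= 1 / 3 &
    t n ^+ 2 * noise_sqr n <= Cq * ln n%:R] by near: n.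
  have n0 : 0 < n%:R :> R by rewrite ltr0n; near: n; exact: nbhs_infty_gt.
  have tU : normF (t n *: U) <= t n.
    by rewrite normFZ gtr0_norm// ler_piMr// ltW.
  apply: le_trans (noise_tail _ _) _.
    by apply: le_trans ts; rewrite ler_wpM2r.
  rewrite lee_fin mul1r -[_^-1]lnK ?posrE ?invr_gt0 ?exprn_gt0//.
  rewrite ler_expR lnV ?posrE ?exprn_gt0// lnXn// /x.
  have h1 : noise_var * normF (t n *: U) ^+ 2 * noise_sqr n <=
      noise_var * (Cq * ln n%:R).
    rewrite -mulrA ler_wpM2l ?noise_var_ge0// (le_trans _ tq)//.
    by rewrite ler_wpM2r ?noise_sqr_ge0// ler_pXn2r ?nnegrE ?normF_ge0// ltW.
  rewrite -mulr_natl; move: h1; set l := ln _; lra.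
apply: filterS (borel_cantelli_sqr mE hE) => w [n0 _ hn].
near=> n; have t0 : 0 < t n.
  have : [/\ 0 < t n, t n * noise_sup n <= 1 / 3 &
    t n ^+ 2 * noise_sqr n <= Cq * ln n%:R] by near: n.
  by case.
have : ~ E n w by apply: hn; near: n; exact: nbhs_infty_ge.
by rewrite /E /= dotFZl => /negP; rewrite -ltNge ler_pdivlMr// mulrC => /ltW.
Unshelve. all: by end_near. Qed.

(** Testing with plus and minus the matrix units reduces the norm to finitely many functionals, at
    the price of the factor [dd]. *)
Lemma noise_rate : {ae P, forall w, \forall n \near \oo,
  normF (noise_sum n w) <= dd * ((noise_var * Cq + 2) * ln n%:R / t n)}.
Proof.
have n1 i j : normF (delta_mx i j : 'M[R]_d) <= 1.
  rewrite normFE /dotF (bigD1 i)//= (bigD1 j)//= !big1 ?addr0.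
  - by rewrite mxE !eqxx mulr1 sqrtr1.
  - by move=> k /negPf ki; rewrite big1// => l _; rewrite mxE ki mulr0.
  - by move=> k /negPf kj; rewrite mxE kj andbF mulr0.
have dE i j (V : 'M[R]_d) : dotF (delta_mx i j) V = V i j.
  rewrite /dotF (bigD1 i)//= (bigD1 j)//= !big1 ?addr0.
  - by rewrite mxE !eqxx mul1r.
  - by move=> k /negPf ki; rewrite big1// => l _; rewrite mxE ki mul0r.
  - by move=> k /negPf kj; rewrite mxE kj andbF mul0r.
have hp (ij : 'I_d * 'I_d) : {ae P, forall w, \forall n \near \oo,
    `|noise_sum n w ij.1 ij.2| <= (noise_var * Cq + 2) * ln n%:R / t n}.
  have n1N : normF (- delta_mx ij.1 ij.2 : 'M[R]_d) <= 1 by rewrite normFN.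
  have h1 := noise_rate_functional (n1 ij.1 ij.2).
  have h2 := noise_rate_functional n1N.
  apply: filterS2 h1 h2 => w h1 h2; near=> n.
  rewrite ler_norml lerNl -[in X in X && _]dE -dotFNl -[in X in _ && X]dE.
  by apply/andP; split; near: n.
have : {ae P, forall w, forall ij : 'I_d * 'I_d, \forall n \near \oo,
    `|noise_sum n w ij.1 ij.2| <= (noise_var * Cq + 2) * ln n%:R / t n}.
  exact: filter_forall.
apply: filterS => w hw; near=> n; apply: normF_le_entries => i j.
suff : forall ij : 'I_d * 'I_d,
    `|noise_sum n w ij.1 ij.2| <= (noise_var * Cq + 2) * ln n%:R / t n by move=> /(_ (i, j)).
by near: n; exact: filter_forall.
Unshelve. all: by end_near. Qed.

End noise_recursion.
End noise.

(** * Almost sure rates *)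

Section rates.
Variables (H : 'M[R]_d) (lam : R) (theta : 'cV[R]_d).
Hypotheses (H_posdef : posdef H) (lam_gt0 : 0 < lam).
Hypothesis coercive : forall X : 'M[R]_d, lam * normF X ^+ 2 <= dotF X (H *m X).
Let K := invmx H.
Let dd : R := (d * d)%:R.
Variables cgamma gamma : R.
Hypotheses (cgamma_gt0 : 0 < cgamma) (gamma_gt : 1 / 2 < gamma) (gamma_lt1 : gamma < 1).
Hypothesis gamE : gam = power_seq cgamma (- gamma).
Hypothesis bet'_infty : forall x : R, \forall n \near \oo, x <= bet' n.+1.

Section bounded.
Variable r : R.
Hypothesis r_gt0 : 0 < r.
Hypothesis small_bias : \forall n \near \oo, forall h, normF (h - theta) <= r ->
  normF (EW n h - H) * (1 + normF K) + `|Ek n h - 1| * dd <= lam.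
Hypothesis thetah_cvg : {ae P, forall w,
  \forall n \near \oo, normF (thetah n w - theta) <= r}.

Let s := 2 * gamma - 1.
Let s_gt0 : 0 < s. Proof. by rewrite /s; move: gamma_gt; lra. Qed.
Let Cd := drift_const H K2.
(* Compensates the growth factors [1 + Cd * gam n ^ 2] of the energy. *)
Let pot n : R := expR (Cd * cgamma ^+ 2 / s * n%:R `^ (- s)).

Let Cd_ge0 : 0 <= Cd.
Proof.
apply: addr_ge0; first by rewrite mulr_ge0 ?sqr_ge0.
by rewrite mulr_ge0 ?sqr_ge0// mulr_ge0.
Qed.

Let pot_ge1 n : 1 <= pot n.
Proof.
rewrite -[leLHS]expR0 ler_expR mulr_ge0 ?powR_ge0// divr_ge0 ?(ltW s_gt0)//.
by rewrite mulr_ge0 ?sqr_ge0.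
Qed.

Let pot_dec n : (0 < n)%N -> (1 + Cd * gam n.+1 ^+ 2) * pot n.+1 <= pot n.
Proof.
move=> n0; apply: (@le_trans _ _ (expR (Cd * gam n.+1 ^+ 2) * pot n.+1)).
  by rewrite ler_wpM2r ?expR_ge0// expR_ge1Dx.
rewrite -expRD ler_expR -lerBrDr -mulrBr.
rewrite gamE /power_seq exprMn.
have -> : (n.+1%:R `^ (- gamma)) ^+ 2 = n.+1%:R `^ (- s - 1) :> R.
  by rewrite expr2 -powRnD//; congr (_ `^ _); rewrite /s; ring.
have h := powRn_telescope s_gt0 n0 (R := R).
have c0 : 0 <= Cd * cgamma ^+ 2 by rewrite mulr_ge0 ?sqr_ge0.
have := ler_wpM2l c0 h; rewrite !mulrA; apply: le_trans.
by rewrite -mulrA.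
Qed.

(** The time from which [thetah] stays near [theta] is random, so the exceptional sets of all
    starting times are discarded together. The finitely many estimates before that time are bounded
    trivially. *)
Lemma est_bounded : {ae P, forall w, exists m : nat, forall n, normF (est n w) <= m%:R}.
Proof.
have hb := bet'_infty (normF K + 1).
have [N0 _ hN0] : \forall n \near \oo, (forall h, normF (h - theta) <= r ->
  normF (EW n h - H) * (1 + normF K) + `|Ek n h - 1| * dd <= lam) /\
  normF K + 1 <= bet' n.+1.
  by near=> n; split; near: n.
pose near_theta (h : 'cV[R]_d) := normF (h - theta) <= r.
have mnear : measurable_fun setT near_theta.
  apply: measurable_fun_ler => //; apply: measurable_normF.
  by apply: measurable_subrmx.
pose bad N := [set w | (forall k, (N <= k)%N -> near_theta (thetah k w)) /\
  forall m : nat, exists2 k, (N <= k)%N & m%:R <= lyapf K (est k w)].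
have negl N : P.-negligible (bad (maxn (maxn N0 1) N)).
  set N' := maxn _ N.
  have N'0 : (N0 <= N')%N by rewrite !leq_max leqnn.
  have N'1 : (1 <= N')%N by rewrite !leq_max leqnn orbT.
  apply: (unbounded_negligible H_posdef coercive mnear (pot := pot)) => //.
  - by move=> n h nN hh; apply: (hN0 _ _).1 => //; exact: leq_trans nN.
  - by move=> n nN; apply: (hN0 _ _).2; exact: leq_trans nN.
  - by move=> n nN; apply: pot_dec; exact: leq_trans nN.
have : {ae P, forall w, forall N, ~ bad (maxn (maxn N0 1) N) w}.
  apply: ae_foralln => N.
  by case: (negl N) => V [mV V0 sV]; exists V; split => // w /= /contrapT /sV.
move=> hbad; apply: filterS2 hbad thetah_cvg => w hbad [N _ hN].
set N' := maxn (maxn N0 1) N in hbad.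
have [m hm] : exists m : nat, forall k, (N' <= k)%N -> lyapf K (est k w) < m%:R.
  apply: contrapT => /forallNP hne; apply: (hbad N); split.
    by move=> k hk; apply: hN; exact: leq_trans (leq_maxr _ _) hk.
  move=> m; apply: contrapT => hm; apply: (hne m) => k hk.
  by rewrite ltNge; apply/negP => h; apply: hm; exists k.
have big : exists B, forall k, normF (est k w) <= B.
  have [B1 hB1] : exists B, forall k, (k < N')%N -> normF (est k w) <= B.
    exists (\sum_(i < N') normF (est i w)) => k hk.
    rewrite (bigD1 (Ordinal hk))//= lerDl; apply: sumr_ge0 => i _; exact: normF_ge0.
  exists (Num.max B1 (normF K + 1 + m%:R)) => k; rewrite le_max.
  have [h|h] := leqP N' k; last by rewrite hB1.
  apply/orP; right; apply: bound_lyapf => //.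
  apply: (lt_le_trans (hm _ h)).
  have : m%:R <= m%:R ^+ 2 + 1 :> R.
    by have := sqr_ge0 (m%:R - 1 : R); nra.
  by rewrite addrC.
case: big => B hB; exists (Num.truncn B).+1 => k.
by apply: (le_trans (hB k)); apply: ltW; exact: truncnS_gt.
Unshelve. all: by end_near. Qed.

End bounded.

Variables (cbeta beta KE : R).
Hypotheses (cbeta_gt0 : 0 < cbeta) (beta_gt0 : 0 < beta) (beta_lt : beta < gamma - 1 / 2).
Hypothesis betE : bet = power_seq cbeta beta.
Hypothesis gam_bet : forall n, gam n.+1 * bet n.+1 <= 1 / 2.
Hypothesis EW_bound : forall n h, normF (EW n h) <= KE.
Hypothesis Ek01 : forall n h, 0 <= Ek n h <= 1.
Hypothesis EW_meas : forall n, measurable_fun setT (EW n).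
Hypothesis Ek_meas : forall n, measurable_fun setT (Ek n).

Let damp n (X : 'M[R]_d) := X - gam n.+1 *: lyap H X.
Let nodamp (n : nat) (X : 'M[R]_d) := X.

Section truncated_level.
Variable lev : R.
Hypothesis lev_ge0 : 0 <= lev.

Let KE_ge0 : 0 <= KE.
Proof. exact: le_trans (normF_ge0 _) (EW_bound 0 0). Qed.

Let bnd_c := 2 * lev * (KE + cbeta) + 4 * dd.

Let bnd_c_ge0 : 0 <= bnd_c.
Proof.
apply: addr_ge0; last by rewrite mulr_ge0.
by apply: mulr_ge0; [rewrite mulr_ge0|rewrite addr_ge0// ltW].
Qed.

Let noise_bound_le n : noise_bound lev KE n <= bnd_c * n.+1%:R `^ beta.
Proof.
rewrite -[noise_bound lev KE n]/(2 * lev * (KE + bet n.+1) + 4 * dd) betE /power_seq.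
have n1 : 1 <= n.+1%:R `^ beta :> R.
  by rewrite -[leLHS](powRr0 n.+1%:R); apply: ler_powR; [rewrite ler1n|exact: ltW].
set x := _ `^ _ in n1 *.
have h1 : 2 * lev * KE * 1 <= 2 * lev * KE * x by rewrite ler_wpM2l// !mulr_ge0.
have h2 : 4 * dd * 1 <= 4 * dd * x by rewrite ler_wpM2l// mulr_ge0.
rewrite /bnd_c; lra.
Qed.

Let ln_div_sqrt n (e : R) : (1 < n)%N ->
  ln n%:R / (ln n%:R `^ (1 / 2) * n%:R `^ e) = rate e (1 / 2) n.
Proof.
move=> n1; have l0 := @ln_gt0n R _ n1.
rewrite /rate powRN invfM mulrA; congr (_ / _).
apply: (mulIf (x := ln n%:R `^ (1 / 2))); first by rewrite gt_eqF ?powR_gt0.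
rewrite mulfVK ?gt_eqF ?powR_gt0// -powRD; last by rewrite (gt_eqF l0) implybT.
by rewrite (_ : 1 / 2 + 1 / 2 = 1) ?powRr1 ?(ltW l0)//; field.
Qed.

(** Take t n = sqrt(ln n) n^e. The variance condition then has order ln n, the condition on single
    terms holds because [e < f] leaves a negative power of n against the logarithm, and ln n / t n
    is the claimed rate. *)
Let noise_domination (L : nat -> 'M[R]_d -> 'M[R]_d) (c rho : nat -> R) (e f : R) :
  (forall n, 0 <= c n) ->
  (forall n U X, dotF U (L n X) = dotF (L n U) X) ->
  (forall n U, normF (L n U) <= rho n * normF U) ->
  (forall n, 0 <= rho n) ->
  (forall n, measurable_fun setT (L n)) ->
  dominated (noise_sqr c rho) (fun n => n%:R `^ (- (2 * e))) ->
  dominated (noise_sup lev KE c rho) (fun n => n%:R `^ (- f)) -> e < f ->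
  {ae P, forall w, dominated (fun n => normF (noise_sum lev L c n w)) (rate e (1 / 2))}.
Proof.
move=> c0 Ladj Lnorm rho0 Lmeas [Cs Cs0 hs] [Cm Cm0 hm] ef.
pose t n : R := ln n%:R `^ (1 / 2) * n%:R `^ e.
have ht : \forall n \near \oo, [/\ 0 < t n, t n * noise_sup lev KE c rho n <= 1 / 3 &
    t n ^+ 2 * noise_sqr c rho n <= Cs * ln n%:R].
  near=> n.
  have n1 : (1 < n)%N by near: n; exact: nbhs_infty_gt.
  have n0 : (0 < n)%N by exact: ltnW.
  have l0 := @ln_gt0n R _ n1.
  have t0 : 0 < t n by rewrite mulr_gt0 ?powRn_gt0 ?powR_gt0.
  split => //.
    have h1 : noise_sup lev KE c rho n <= Cm * n%:R `^ (- f) by near: n.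
    apply: (le_trans (ler_wpM2l (ltW t0) h1)).
    have h2 : ln n%:R `^ (1 / 2) * n%:R `^ (- (f - e)) <= (3 * (Cm + 1))^-1.
      near: n; apply: near_polylog_le; first by rewrite divr_ge0.
        by rewrite subr_gt0.
      by rewrite invr_gt0 mulr_gt0// ltr_wpDl.
    have -> : t n * (Cm * n%:R `^ (- f)) = Cm * (ln n%:R `^ (1 / 2) * n%:R `^ (- (f - e))).
      have -> : n%:R `^ (- (f - e)) = n%:R `^ e * n%:R `^ (- f) :> R.
        by rewrite -powRnD//; congr (_ `^ _); ring.
      by rewrite /t; ring.
    apply: (le_trans (ler_wpM2l Cm0 h2)).
    rewrite ler_pdivrMr ?mulr_gt0 ?ltr_wpDl//; lra.
  have h1 : noise_sqr c rho n <= Cs * n%:R `^ (- (2 * e)) by near: n.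
  apply: (le_trans (ler_wpM2l (sqr_ge0 _) h1)).
  have -> : t n ^+ 2 = ln n%:R * n%:R `^ (2 * e).
    rewrite /t exprMn !expr2 -powRnD// -powRD; last by rewrite (gt_eqF l0) implybT.
    rewrite (_ : 1 / 2 + 1 / 2 = 1) ?powRr1 ?(ltW l0)//; last by field.
    by rewrite (_ : e + e = 2 * e)//; ring.
  rewrite mulrCA mulrA -mulrA -mulrA -powRnD// subrr powRr0 mulr1.
  by [].
have KE0 := noise_rate lev_ge0 EW_bound Ek01 EW_meas Ek_meas c0 Ladj Lnorm rho0 Lmeas ht.
apply: filterS KE0 => w hw.
exists (dd * (noise_var lev KE * Cs + 2)).
  by rewrite mulr_ge0// addr_ge0// mulr_ge0// noise_var_ge0.
near=> n.
have n1 : (1 < n)%N by near: n; exact: nbhs_infty_gt.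
have h : normF (noise_sum lev L c n w) <=
  dd * ((noise_var lev KE * Cs + 2) * ln n%:R / t n) by near: n.
by apply: (le_trans h); rewrite -!mulrA ln_div_sqrt// !mulrA.
Unshelve. all: by end_near. Qed.

Let near_contraction : \forall n \near \oo,
  lam * gam n.+1 <= 1 /\ forall X : 'M[R]_d, normF (damp n X) <= (1 - lam * gam n.+1) * normF X.
Proof.
rewrite /damp gamE; near=> n.
have g0 : 0 < power_seq cgamma (- gamma) n.+1 by exact: power_seq_gt0.
have hl : lam * power_seq cgamma (- gamma) n.+1 <= 1.
  by rewrite mulrC -ler_pdivlMr//; near: n; apply: near_step_le => //; exact: divr_gt0.
split=> // X; apply: lyap_contraction => //; [exact: ltW| |exact: dotF_lyap].
have h0 : 0 < 4 * normF H ^+ 2 + 1 by rewrite ltr_wpDl// mulr_ge0 ?sqr_ge0.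
apply: (@le_trans _ _ ((4 * normF H ^+ 2 + 1) * power_seq cgamma (- gamma) n.+1)).
  by rewrite ler_wpM2r ?lerDl// ltW.
rewrite mulrC -ler_pdivlMr//; near: n; apply: near_step_le => //.
by apply: divr_gt0; [exact: mulr_gt0|rewrite ltr_wpDl// mulr_ge0 ?sqr_ge0].
Unshelve. all: by end_near. Qed.

(** [noise_sqr] contracts under a forcing gam^2, so it has order gam; the largest term has order gam
    * bet, that is n^(beta - gamma). The gap gamma/2 < gamma - beta follows from [beta_lt] and
    [gamma_lt1]. *)
Lemma damped_noise_rate : {ae P, forall w,
  dominated (fun n => normF (noise_sum lev damp (fun n => gam n.+1) n w))
    (rate (gamma / 2) (1 / 2))}.
Proof.
case: near_contraction => n0 _ hn0.
(* The contraction starts at [n0] only; earlier steps get a crude operator bound, so that [rho] is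
   valid for every [n] without changing the asymptotics. *)
pose rho n := if (n0 <= n)%N then 1 - lam * gam n.+1 else 1 + 2 * normF H * gam n.+1.
have g0 n : 0 < gam n.+1 by exact: gam_gt0.
have rhoE : \forall n \near \oo, rho n = 1 - lam * gam n.+1.
  by exists n0 => // n /= h; rewrite /rho h.
apply: (@noise_domination _ _ rho (gamma / 2) (gamma - beta)).
- by move=> n; exact: ltW.
- move=> n U X; rewrite /damp dotFBr dotFBl dotFZr dotFZl; congr (_ - _ * _).
  rewrite dotFDr dotFDl; congr (_ + _); first by rewrite dotF_mulr H_posdef.1.
  by rewrite dotF_mull H_posdef.1.
- move=> n U; rewrite /rho; case: ifP => h; first exact: (hn0 _ h).2.
  apply: le_trans (normF_triangleB _ _) _; rewrite mulrDl mul1r lerD2l.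
  by rewrite normFZ gtr0_norm// mulrC mulrAC ler_pM2r// normF_lyap.
- move=> n; rewrite /rho; case: ifP => h; first by rewrite subr_ge0 (hn0 _ h).1.
  by rewrite addr_ge0// mulr_ge0 ?(ltW (g0 n))// mulr_ge0 ?normF_ge0.
- move=> n; apply: measurable_subrmx => //; apply: measurable_scalemx => //.
  by apply: measurable_addmx; apply: measurable_mulmx.
- have := @dominated_contraction _ _ _ cgamma_gt0 gamma_gt gamma_lt1
    (noise_sqr (fun n => gam n.+1) rho) gamma 0 lam cgamma lam_gt0 (ltW cgamma_gt0).
  have gamma0 : 0 <= gamma by move: gamma_gt; lra.
  move=> /(_ gamma0 (lexx 0)) h.
  suff /h : \forall n \near \oo, noise_sqr (fun n => gam n.+1) rho n.+1 <=
      (1 - lam * power_seq cgamma (- gamma) n.+1) * noise_sqr (fun n => gam n.+1) rho n +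
      power_seq cgamma (- gamma) n.+1 * (cgamma * rate gamma 0 n.+1).
    case=> C C0 hC; exists C => //; apply: filterS hC => n.
    by rewrite /rate powRr0 mul1r (_ : 2 * (gamma / 2) = gamma)//; field.
  near=> n; rewrite /= (_ : rho n = 1 - lam * gam n.+1); last by near: n.
  have hl : lam * gam n.+1 <= 1 by apply: (hn0 _ _).1; near: n; exact: nbhs_infty_ge.
  rewrite -gamE /rate powRr0 mul1r; apply: lerD; last first.
    by rewrite expr2 [in leLHS]gamE gamE.
  rewrite ler_wpM2r ?noise_sqr_ge0// expr2 ler_piMl ?subr_ge0//.
  by rewrite gerBl mulr_ge0// ltW.
- have := @dominated_max _ _ _ cgamma_gt0 gamma_gt gamma_lt1
    (noise_sup lev KE (fun n => gam n.+1) rho)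
    (fun n => gam n.+1 * noise_bound lev KE n) (gamma - beta) lam
    (cgamma * bnd_c) lam_gt0.
  have e1 : 0 <= cgamma * bnd_c by rewrite mulr_ge0// ltW.
  have e2 : 0 <= gamma - beta by move: gamma_lt1 beta_lt; lra.
  move=> /(_ e1 e2) h.
  suff /h : \forall n \near \oo, gam n.+1 * noise_bound lev KE n <=
      cgamma * bnd_c * rate (gamma - beta) 0 n.+1.
    have : \forall n \near \oo, noise_sup lev KE (fun n => gam n.+1) rho n.+1 =
       Num.max ((1 - lam * power_seq cgamma (- gamma) n.+1) *
         noise_sup lev KE (fun n => gam n.+1) rho n)
         (gam n.+1 * noise_bound lev KE n).
      apply: filterS rhoE => n /= ->; by rewrite -gamE.
    move=> hm /(_ hm) [C C0 hC]; exists C => //; apply: filterS hC => n.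
    by rewrite /rate powRr0 mul1r.
  apply: nearW => n; rewrite /rate powRr0 mul1r.
  apply: (le_trans (ler_wpM2l (ltW (g0 n)) (noise_bound_le n))).
  rewrite gamE /power_seq -!mulrA ler_pM2l// mulrCA ler_wpM2l// -powRnD//.
  by rewrite opprB addrC.
- by move: gamma_lt1 beta_lt; lra.
Unshelve. all: by end_near. Qed.

(** Without damping [noise_sqr n] is [n] and the largest term has order n^beta, so the exponents are
    negative: e = -1/2 and f = -beta, with beta < 1/2. *)
Lemma plain_noise_rate : {ae P, forall w,
  dominated (fun n => normF (noise_sum lev nodamp (fun=> 1) n w))
    (fun n => n%:R * rate (1 / 2) (1 / 2) n)}.
Proof.
have h : {ae P, forall w, dominated
    (fun n => normF (noise_sum lev nodamp (fun=> 1) n w)) (rate (- (1 / 2)) (1 / 2))}.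
  apply: (@noise_domination _ _ (fun=> 1) (- (1 / 2)) (- beta)) => //.
  - by move=> n U; rewrite mul1r.
  - by move=> n; exact: measurable_id.
  - exists 1 => //; apply: nearW => n; rewrite mul1r.
    rewrite (_ : - (2 * - (1 / 2)) = 1); last by field.
    rewrite powRr1//; elim: n => //= n IH.
    by rewrite expr1n !mul1r -natr1 lerD2r.
  - exists bnd_c => //; exists 1%N => // n /= n0; rewrite opprK.
    elim: n n0 => // n IH _ /=; rewrite !mul1r ge_max noise_bound_le andbT.
    case: n IH => [|n] IH; first by rewrite mulr_ge0 ?powR_ge0.
    apply: (le_trans (IH isT)); rewrite ler_wpM2l//.
    by apply: (ge0_ler_powR (ltW beta_gt0)); rewrite ?nnegrE// ler_nat.
  - by move: gamma_lt1 beta_lt; lra.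
apply: filterS h => w [C C0 hC]; exists C => //; near=> n.
have n0 : (0 < n)%N by near: n; exact: nbhs_infty_gt.
have : normF (noise_sum lev nodamp (fun=> 1) n w) <= C * rate (- (1 / 2)) (1 / 2) n by near: n.
move/le_trans; apply; rewrite ler_wpM2l// /rate mulrCA ler_wpM2l ?powR_ge0// opprK.
rewrite -[X in _ <= X * _]powRr1// -powRnD// (_ : 1 + - (1 / 2) = 1 / 2)//.
by field.
Unshelve. all: by end_near. Qed.

End truncated_level.

(** For symmetric [A] the increment at [(H, 1)] is exactly [lyap H (A - K)], as [H *m K] is the
    identity; what remains is linear in the two biases. *)
Let incr_split (A V : 'M[R]_d) (c : R) : A^T = A ->
  incr A V c = lyap H (A - K) + incr A (V - H) (c - 1).
Proof.
move=> As; have VH : (V - H)^T = V^T - H by rewrite linearB /= H_posdef.1.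
rewrite /incr /lyap As VH.
rewrite !mulmxBr !mulmxBl (mulVmx (posdef_unit H_posdef)) (mulmxV (posdef_unit H_posdef)).
have -> : (2 * (c - 1))%:M = (2 * c)%:M - 1%:M - 1%:M :> 'M[R]_d.
  by rewrite -!raddfB /=; congr (_%:M); ring.
by apply/matrixP => i j; rewrite !mxE; ring.
Qed.

Let incr_lip (A V : 'M[R]_d) (c : R) : normF (incr A V c) <= 2 * normF A * normF V + 2 * dd * `|c|.
Proof.
apply: le_trans (normF_triangleB _ _) _; apply: lerD.
  apply: le_trans (normFD (normF_mul _ _) (normF_mul _ _)) _.
  by rewrite !normF_tr le_eqVlt; apply/orP; left; apply/eqP; ring.
apply: le_trans (normF_scalar _ _) _.
by rewrite normrM ger0_norm// mulrCA mulrA.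
Qed.

Variables (sig q : R).
Hypotheses (sig_gt0 : 0 < sig) (q_ge : 1 / 2 <= q).
Hypothesis est_bnd : {ae P, forall w, exists m : nat, forall n, normF (est n w) <= m%:R}.
Hypothesis mean_rate : {ae P, forall w,
  dominated (fun n => normF (EW n (thetah n w) - H)) (rate (sig / 2) q) /\
  dominated (fun n => `|Ek n (thetah n w) - 1|) (rate (sig / 2) q)}.

(** The bound [m] depends on the trajectory, so the noise rates are first made to hold for all
    natural [m] at once. Along a trajectory bounded by [m] the cutoff acts as the identity and the
    projection is eventually inactive, which leaves the pathwise recursion. *)
Lemma est_rates : {ae P, forall w,
  dominated (fun n => normF (est n w - K)) (rate (Num.min gamma sig / 2) q) /\
  dominated (fun n => normF (\sum_(0 <= k < n) (est k w - K)))
    (fun n => n%:R * rate (Num.min 1 sig / 2) q n)}.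
Proof.
have h1 : {ae P, forall w, forall m : nat, dominated
    (fun n => normF (noise_sum m%:R damp (fun n => gam n.+1) n w))
    (rate (gamma / 2) (1 / 2))}.
  by apply: ae_foralln => m; exact: damped_noise_rate.
have h2 : {ae P, forall w, forall m : nat, dominated
    (fun n => normF (noise_sum m%:R nodamp (fun=> 1) n w))
    (fun n => n%:R * rate (1 / 2) (1 / 2) n)}.
  by apply: ae_foralln => m; exact: plain_noise_rate.
apply: filterS2 (filterI h1 h2) (filterI est_bnd mean_rate).
move=> w [{}h1 {}h2] [[m hm] [hEW hEk]].
pose D n := est n w - K.
pose e n := incr (est n w) (EW n (thetah n w) - H) (Ek n (thetah n w) - 1).
pose eta n := noise m%:R n w.
have hL n X : damp n X = X - power_seq cgamma (- gamma) n.+1 *: lyap H X.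
  by rewrite /damp gamE.
have noiseE n : eta n = lyap H (D n) + e n -
    incr (est n w) (W n (thetah n w) w) (kp n (thetah n w) w).
  have cE : cutoff m%:R (est n w) = est n w by rewrite -[LHS]/(if normF (est n w) <= m%:R then est n w else 0) hm.
  rewrite -[LHS]/(incr (cutoff m%:R (est n w)) (EW n (thetah n w)) (Ek n (thetah n w)) -
    incr (cutoff m%:R (est n w)) (W n (thetah n w) w) (kp n (thetah n w) w)).
  by rewrite cE incr_split ?est_sym.
have D_rec : \forall n \near \oo, D n.+1 = D n -
    power_seq cgamma (- gamma) n.+1 *: lyap H (D n) -
    power_seq cgamma (- gamma) n.+1 *: e n + power_seq cgamma (- gamma) n.+1 *: eta n.
  near=> n.
  have g0 := gam_gt0 n.
  rewrite noiseE -gamE /D estS /step.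
  rewrite -/(W n (thetah n w) w) -/(kp n (thetah n w) w).
  set Inc := incr (est n w) (W n _ w) _.
  rewrite projF_id; last first.
    have hI : normF Inc <= 2 * normF (est n w) * normF (W n (thetah n w) w) + 2 * dd.
      by apply: normF_incr; rewrite keep_ge0 keep_le1.
    have hA := hm n.
    have hW : normF (W n (thetah n w) w) <= bet n.+1 by apply: normF_trunc; exact: ltW.
    have hAW : normF (est n w) * normF (W n (thetah n w) w) <= m%:R * bet n.+1.
      by apply: ler_pM; rewrite ?normF_ge0.
    (* One [m] bounds the current estimate; the other bounds [2 * m * bet n.+1] times the step, by
       [gam_bet]. *)
    apply: (@le_trans _ _ (2 * m%:R + 2 * dd * cgamma)); last first.
      by near: n; exact: bet'_infty.
    apply: le_trans (normF_triangleB _ _) _; rewrite normFZ gtr0_norm//.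
    have h3 : gam n.+1 * normF Inc <= gam n.+1 * (2 * (m%:R * bet n.+1) + 2 * dd).
      rewrite ler_wpM2l ?(ltW g0)//; apply: (le_trans hI).
      by rewrite lerD2r -mulrA ler_wpM2l.
    have h4 : m%:R * (gam n.+1 * bet n.+1) <= m%:R * (1 / 2) by rewrite ler_wpM2l.
    have h5 : gam n.+1 <= cgamma.
      rewrite gamE /power_seq ler_piMr ?(ltW cgamma_gt0)//; apply: powRn_le1 => //.
      by move: gamma_gt; lra.
    have h6 : 2 * dd * gam n.+1 <= 2 * dd * cgamma by rewrite ler_wpM2l// mulr_ge0.
    lra.
  rewrite -/(D n); set Ly := lyap H (D n); rewrite -[est n w](subrK K) -/(D n).
  by apply/matrixP => i j; rewrite !mxE; ring.
have S1_rec n : noise_sum m%:R damp (fun n => gam n.+1) n.+1 w =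
    noise_sum m%:R damp (fun n => gam n.+1) n w -
    power_seq cgamma (- gamma) n.+1 *: lyap H (noise_sum m%:R damp (fun n => gam n.+1) n w) +
    power_seq cgamma (- gamma) n.+1 *: eta n.
  by rewrite -gamE.
have S2_rec n : noise_sum m%:R nodamp (fun=> 1) n.+1 w =
    noise_sum m%:R nodamp (fun=> 1) n w + eta n.
  by rewrite -[LHS]/(_ + 1 *: _) scale1r.
have e_rate : dominated (fun n => normF (e n)) (rate (sig / 2) q).
  have m0 : 0 <= 2 * m%:R :> R by rewrite mulr_ge0.
  have d0 : 0 <= 2 * dd by rewrite mulr_ge0.
  apply: dominated_le (dominated_add (dominated_scale m0 hEW) (dominated_scale d0 hEk)).
  apply: nearW => n; apply: le_trans (incr_lip _ _ _) _; rewrite lerD2r.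
  by rewrite ler_wpM2r ?normF_ge0// ler_wpM2l.
split.
  exact: (error_rate cgamma_gt0 gamma_gt gamma_lt1 H_posdef lam_gt0 coercive sig_gt0
    q_ge D_rec (nearW _ S1_rec) (h1 m) e_rate).
exact: (sum_error_rate cgamma_gt0 gamma_gt gamma_lt1 H_posdef lam_gt0 coercive sig_gt0
    q_ge D_rec (nearW _ S1_rec) S2_rec (h1 m) (h2 m) e_rate).
Unshelve. all: by end_near. Qed.

End rates.
End estimator.

(** * Means of the truncated innovations *)

Section scheme_moments.
Context {disp : measure_display} {T : measurableType disp} {R : realType}.
Variable P : probability T R.
Context {p d : nat}.
Variables (X : {RV P >-> 'cV[R]_p}) (hessg : 'cV[R]_p -> 'cV[R]_d -> 'M[R]_d).
Hypothesis hessg_meas : measurable_fun setT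
  (fun xh : 'cV[R]_p * 'cV[R]_d => hessg xh.1 xh.2).
Variable Hb : 'cV[R]_d -> 'M[R]_d.
Hypothesis hessg_int : forall h, integrable_mx P (fun w => hessg (X w) h).
Hypothesis HbE : forall h, Hb h = expectation_mx P (fun w => hessg (X w) h).
Variables (Xs : nat -> {RV P >-> 'cV[R]_p}) (Z : nat -> {RV P >-> 'cV[R]_d}) (M : R).
Hypothesis Xs_law : forall n, (1 <= n)%N -> same_law (Xs n) X.
Hypothesis XZ_indep : independent2 P (sigma_seq Xs) (sigma_seq Z).
Hypothesis Z_bounded : forall n, (1 <= n)%N -> {ae P, forall w, normF (Z n w) <= M}.
Hypothesis Z_cov : forall n, (1 <= n)%N ->
  expectation_mx P (fun w => Z n w *m (Z n w)^T) = 1%:M.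
Variables (q Cq : R).
Hypothesis q_gt2 : 2 < q.
Hypothesis hessg_moment : forall h,
  ('E_P[fun w => (normF (hessg (X w) h) `^ q)%R] <= Cq%:E)%E.
Variable bet : nat -> R.
Hypothesis bet_gt0 : forall n, 0 < bet n.+1.

Let W n h w := trunc (bet n.+1) (hessg^~ h) (Xs n.+1 w, Z n.+1 w).
Let kp n h w := keep (bet n.+1) (hessg^~ h) (Xs n.+1 w, Z n.+1 w).

Definition trunc_mx n h : 'M[R]_d := \matrix_(i, j) \int[P]_w W n h w i j.
Definition keep_prob n h : R := \int[P]_w kp n h w.
Definition raw_const : R := (M ^+ 2) `^ q * Cq.

Let mhs h : measurable_fun setT (fun x => hessg x h).
Proof. exact: (measurable_fun_pair1 h hessg_meas). Qed.

Let mnq h : measurable_fun setT (fun x => normF (hessg x h) `^ q).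
Proof.
by apply: (measurableT_comp (measurable_powR _)); exact: measurable_normF.
Qed.

Let EmomentE h : ('E_P[fun w => (normF (hessg (X w) h) `^ q)%R] =
  \int[P]_w (normF (hessg (X w) h) `^ q)%:E)%E.
Proof. by rewrite unlock. Qed.

Let Cq_ge0 : 0 <= Cq.
Proof.
rewrite -lee_fin (le_trans _ (hessg_moment 0))// EmomentE.
by apply: integral_ge0 => w _; rewrite lee_fin powR_ge0.
Qed.

Let hs_transfer n h i j : intg P (fun w => hessg (Xs n.+1 w) h i j) /\
  \int[P]_w hessg (Xs n.+1 w) h i j = Hb h i j.
Proof.
have me : measurable_fun setT (fun x => hessg x h i j) by exact: measurable_entry.
have [h1 h2] := same_law_integral (Xs_law (ltn0Sn n)) me (hessg_int h i j).
split; first exact: h1.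
by rewrite HbE mxE unlock /Rintegral h2.
Qed.

Let hs_moment n h :
  (\int[P]_w (normF (hessg (Xs n.+1 w) h) `^ q)%:E <= Cq%:E)%E.
Proof.
rewrite (same_law_ge0_integral (Xs_law (ltn0Sn n)) (mnq h)); last first.
  by move=> x; exact: powR_ge0.
by rewrite -EmomentE.
Qed.

Lemma raw_const_ge0 : 0 <= raw_const.
Proof. by rewrite mulr_ge0 ?powR_ge0. Qed.

Let ZB n : {ae P, forall w, normF (Z n.+1 w) <= M} := Z_bounded (ltn0Sn n).
Let ZC n := Z_cov (ltn0Sn n).
Let XZ n A B := @XZ_independent _ _ _ P _ _ _ _ Xs Z XZ_indep n A B.
Let hsi n h i j := (hs_transfer n h i j).1.
Let hsm n h i j := (hs_transfer n h i j).2.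

Lemma fresh_mean n h (phi : T -> R) c0 (C : 'M[R]_d) c1 c2 :
  0 <= c2 -> measurable_fun setT phi -> (forall w, 0 <= phi w) ->
  (forall w, phi w <= c0 + dotF C (W n h w) + c1 * kp n h w +
                      c2 * normF (W n h w) ^+ 2) ->
  (\int[P]_w (phi w)%:E <= (c0 + dotF C (trunc_mx n h) + c1 * keep_prob n h +
     c2 * (1 + raw_const))%:E)%E.
Proof.
exact: (integral_affine_bound (X := Xs n.+1) (Z := Z n.+1) (mhs h)
  q_gt2 (hs_moment n h) (ZB n) (bet_gt0 n)).
Qed.

Lemma keep_prob_bias n h : 0 <= 1 - keep_prob n h <= raw_const * bet n.+1 `^ (- q).
Proof.
exact: (keep_mean (X := Xs n.+1) (Z := Z n.+1) (mhs h)
  q_gt2 (hs_moment n h) (ZB n) (bet_gt0 n)).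
Qed.

Lemma trunc_mx_bias n h i j :
  `|trunc_mx n h i j - Hb h i j| <= raw_const * bet n.+1 `^ (1 - q).
Proof.
rewrite mxE.
exact: (trunc_mean (X := Xs n.+1) (Z := Z n.+1) (@XZ n) (mhs h)
  q_gt2 (hsi n h) (hsm n h) (hs_moment n h) (ZB n) (ZC n) (bet_gt0 n)).
Qed.

Lemma keep_prob01 n h : 0 <= keep_prob n h <= 1.
Proof.
have /andP[h1 _] := keep_prob_bias n h; rewrite -(subr_ge0 (keep_prob n h)) h1 andbT.
by apply: Rintegral_ge0 => w _; exact: keep_ge0.
Qed.

Let W_int n h i j : intg P (fun w => W n h w i j).
Proof.
exact: (intg_trunc (Xs n.+1) (Z n.+1) (mhs h) (bet_gt0 n)).
Qed.

(** Uniform in [n] although the truncation level grows: a norm is at most one plus its square, and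
    the second moment is bounded by [1 + raw_const]. *)
Lemma trunc_mx_bounded n h : normF (trunc_mx n h) <= (d * d)%:R * (2 + raw_const).
Proof.
apply: normF_le_entries => i j; rewrite mxE.
have [i2 h2] : intg P (fun w => normF (W n h w) ^+ 2) /\
    \int[P]_w (normF (W n h w) ^+ 2) <= 1 + raw_const.
  exact: (trunc_second_moment (X := Xs n.+1) (Z := Z n.+1) (mhs h)
    q_gt2 (hs_moment n h) (ZB n) (bet n.+1)).
apply: le_trans (le_normr_Rintegral measurableT (W_int n h i j)) _.
have i3 : intg P (fun w => 1 + normF (W n h w) ^+ 2).
  by apply: intgD => //; exact: intg_cst.
apply: (@le_trans _ _ (\int[P]_w (1 + normF (W n h w) ^+ 2))).
  apply: le_Rintegral => //; first exact: (integrable_norm (W_int n h i j)).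
  move=> w _; apply: le_trans (normF_coord _ _ _) _.
  by have := sqr_ge0 (normF (W n h w) - 1); have := normF_ge0 (W n h w); nra.
rewrite RintegralD//; last exact: intg_cst.
by rewrite Rintegral_1 (_ : 2 = 1 + 1 :> R)// -addrA lerD2l.
Qed.

Let joint n (y : 'cV[R]_d * T) := (Xs n.+1 y.2, Z n.+1 y.2).

Let mjoint n : measurable_fun setT (joint n).
Proof.
by apply: measurable_fun_pair; apply: measurableT_comp.
Qed.

Let mraw_joint n : measurable_fun setT (fun y => raw (hessg^~ y.1) (joint n y)).
Proof.
have m1 : measurable_fun setT (fun y => (joint n y).1).
  exact: measurableT_comp measurable_fst (mjoint n).
have m2 : measurable_fun setT (fun y => (joint n y).2).
  exact: measurableT_comp measurable_snd (mjoint n).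
have mh : measurable_fun setT (fun y : 'cV[R]_d * T => hessg (joint n y).1 y.1).
  exact: (measurableT_comp hessg_meas (measurable_fun_pair m1 measurable_fst)).
apply: measurable_mulmx => //; apply: measurable_mulmx => //.
exact: measurable_trmx.
Qed.

Let mkeep_joint n : measurable_fun setT
  (fun y => keep (bet n.+1) (hessg^~ y.1) (joint n y)).
Proof.
apply: (measurableT_comp (f := fun b : bool => b%:R : R)) => //.
by apply: measurable_fun_ler => //; exact: measurable_normF.
Qed.

(* Parametric integrals of a bounded integrand: shift it to a nonnegative one. *)
Let measurable_param_mean (b : R) (f : 'cV[R]_d * T -> R) :
  measurable_fun setT f -> (forall y, `|f y| <= b) ->
  measurable_fun setT (fun h => \int[P]_w f (h, w)).
Proof.
move=> mf fb.
have f0 y : (0 <= (f y + b)%:E)%E.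
  by rewrite lee_fin -lerBlDr sub0r; have := fb y; rewrite ler_norml => /andP[].
have mfb : measurable_fun setT (fun y => (f y + b)%:E).
  by apply/measurable_EFinP; exact: measurable_funD.
have m1 := measurable_fun_fubini_tonelli_F (m2 := P) _ mfb f0.
have -> : (fun h => \int[P]_w f (h, w)) =
    (fun h => fine (fubini_F P (fun y => (f y + b)%:E) h) - b).
  apply/funext => h; rewrite /fubini_F.
  have mfh : measurable_fun setT (fun w => f (h, w)) by exact: measurableT_comp mf _.
  have i1 : intg P (fun w => f (h, w)).
    by apply: (@intg_le _ _ _ _ _ (cst b)) => //; exact: intg_cst.
  rewrite -/(Rintegral P setT (fun w => f (h, w) + b)) RintegralD//; last exact: intg_cst.
  by rewrite Rintegral_1 addrK.
apply: measurable_funB => //.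
exact: (measurableT_comp (@fine_measurable _ _ _)) m1.
Qed.

Lemma keep_prob_measurable n : measurable_fun setT (keep_prob n).
Proof.
apply: (measurable_param_mean (b := 1) (mkeep_joint n)) => y.
by rewrite ger0_norm ?keep_ge0 ?keep_le1.
Qed.

Lemma trunc_mx_measurable n : measurable_fun setT (trunc_mx n).
Proof.
apply: measurable_mx => i j; under eq_fun do rewrite mxE.
pose f (y : 'cV[R]_d * T) := trunc (bet n.+1) (hessg^~ y.1) (joint n y) i j.
have mf : measurable_fun setT f.
  by apply: measurable_entry; apply: measurable_scalemx.
apply: (measurable_param_mean (b := bet n.+1) mf) => y.
by apply: le_trans (normF_coord _ _ _) _; rewrite normF_trunc// ltW.
Qed.

End scheme_moments.

Section littleo_to_dominated.
Context {R : realType}.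

Lemma dominated_of_littleo (f : nat -> R^o) (a delta : R) : (forall n, 0 <= f n) ->
  (fun n => f n ^+ 2 : R^o) =o_\oo
    (fun n => ln n%:R `^ (1 + delta) / n%:R `^ a : R^o) ->
  dominated f (rate (a / 2) ((1 + delta) / 2)).
Proof.
move=> f0 /eqoP/(_ 1 ltr01) h; exists 1 => //; near=> n; rewrite mul1r.
have n1 : (1 < n)%N by near: n; exact: nbhs_infty_gt.
have r0 := rate_ge0 (a / 2) ((1 + delta) / 2) n.
rewrite -(ler_pXn2r (ltn0Sn 1)) ?nnegrE// [leRHS]expr2 rateM//.
have -> : a / 2 + a / 2 = a by lra.
have -> : (1 + delta) / 2 + (1 + delta) / 2 = 1 + delta by lra.
have : `|f n ^+ 2| <= 1 * `|ln n%:R `^ (1 + delta) / n%:R `^ a| by near: n; exact: h.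
by rewrite mul1r /rate powRN !ger0_norm ?sqr_ge0// divr_ge0 ?powR_ge0.
Unshelve. all: by end_near. Qed.

Lemma dominated_rate_near_le (f : nat -> R) (s p eps : R) : 0 <= p -> 0 < s -> 0 < eps ->
  dominated f (rate s p) -> \forall n \near \oo, f n <= eps.
Proof.
move=> p0 s0 eps0 [C C0 h]; have C1 : 0 < C + 1 by rewrite ltr_wpDl.
apply: filterS2 h (near_polylog_le p0 s0 (divr_gt0 eps0 C1)) => n h1 h2.
apply: (le_trans h1); apply: (@le_trans _ _ ((C + 1) * rate s p n)).
  by rewrite ler_wpM2r ?rate_ge0// lerDl.
by rewrite mulrC -ler_pdivlMr.
Qed.

Lemma power_seq_powRN_dominated (c b e : R) : 0 < c -> 0 <= b -> 0 <= e ->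
  dominated (fun n => power_seq c b n.+1 `^ (- e)) (rate (b * e) 0).
Proof.
move=> c0 b0 e0; exists (c `^ (- e)); first exact: powR_ge0.
near=> n; have n0 : (0 < n)%N by near: n; exact: nbhs_infty_gt.
rewrite /power_seq powRM ?powR_ge0 ?(ltW c0)// ler_wpM2l ?powR_ge0//.
rewrite /rate powRr0 mul1r -powRrM mulrN !powRN lef_pV2 ?posrE ?powRn_gt0//.
by apply: ge0_ler_powR; rewrite ?mulr_ge0 ?nnegrE ?ler_nat.
Unshelve. all: by end_near. Qed.

End littleo_to_dominated.

Theorem theorem3p1
  (R : realType) (disp : measure_display) (T : measurableType disp)
  (P : probability T R) (p d : nat)
  (X : {RV P >-> 'cV[R]_p})
  (g : 'cV[R]_p -> 'cV[R]_d -> R^o)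
  (gradg : 'cV[R]_p -> 'cV[R]_d -> 'cV[R]_d)
  (hessg : 'cV[R]_p -> 'cV[R]_d -> 'M[R]_d)
  (g_convex : {ae distribution P X, forall x, convex_function setT (g x)})
  (g_twice_diff : forall h : 'cV[R]_d, exists Omega : set 'cV[R]_p,
     [/\ measurable Omega, P (X @^-1` Omega) = 1%E &
         forall x, Omega x -> twice_differentiable (g x) h])
  (* gradg x and hessg x are the gradient and the Hessian of g x wherever these
     exist; their (measurable) values elsewhere are irrelevant. *)
  (gradgE : forall (x : 'cV[R]_p) (h : 'cV[R]_d), differentiable (g x) h ->
     gradg x h = gradient (g x) h)
  (hessgE : forall (x : 'cV[R]_p) (h : 'cV[R]_d), twice_differentiable (g x) h ->
     hessg x h = hessian (g x) h)
  (hessg_meas : measurable_fun setT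
     (fun xh : 'cV[R]_p * 'cV[R]_d => hessg xh.1 xh.2))
  (G : 'cV[R]_d -> R^o) (theta : 'cV[R]_d) (H : 'M[R]_d)
  (g_int : forall h, P.-integrable setT (fun w => (g (X w) h)%:E))
  (GE : forall h, G h = fine 'E_P[fun w => g (X w) h])
  (G_convex : convex_function setT G)
  (gradg_int : forall h, integrable_mx P (fun w => gradg (X w) h))
  (gradGE : forall h, gradient G h = expectation_mx P (fun w => gradg (X w) h))
  (hessg_int : forall h, integrable_mx P (fun w => hessg (X w) h))
  (hessGE : forall h, hessian G h = expectation_mx P (fun w => hessg (X w) h))
  (theta_zero : gradient G theta = 0)
  (theta_unique : forall h, gradient G h = 0 -> h = theta)
  (HE : H = hessian G theta)
  (Xs : nat -> {RV P >-> 'cV[R]_p}) (Z : nat -> {RV P >-> 'cV[R]_d}) (M : R)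
  (Xs_iid : iid Xs)
  (Xs_law : forall n, (1 <= n)%N -> same_law (Xs n) X)
  (Z_iid : iid Z)
  (XZ_indep : independent2 P (sigma_seq Xs) (sigma_seq Z))
  (Z_bounded : forall n, (1 <= n)%N -> {ae P, forall w, normF (Z n w) <= M})
  (Z_mean : forall n, (1 <= n)%N -> expectation_mx P (Z n) = 0)
  (Z_cov : forall n, (1 <= n)%N ->
     expectation_mx P (fun w => Z n w *m (Z n w)^T) = 1%:M)
  (thetah : nat -> T -> 'cV[R]_d)
  (thetah_adapted : forall n (B : set 'cV[R]_d), measurable B ->
     sigma_upto Xs Z n (thetah n @^-1` B))
  (cgamma gamma cbeta beta cbeta' beta' tau q Cq a : R)
  (cgamma_gt0 : 0 < cgamma) (gamma_gt : 1 / 2 < gamma) (gamma_lt1 : gamma < 1)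
  (cbeta_gt0 : 0 < cbeta)
  (gamma_beta : forall n, (1 <= n)%N ->
     power_seq cgamma (- gamma) n * power_seq cbeta beta n <= 1 / 2)
  (cbeta'_gt0 : 0 < cbeta')
  (beta'_gt : 1 - gamma < beta') (beta'_lt : beta' < gamma - 2 * beta)
  (gamma_beta_beta' : forall n, (1 <= n)%N ->
     power_seq cgamma (- gamma) n ^+ 2 * power_seq cbeta beta n ^+ 2 *
       power_seq cbeta' beta' n <= power_seq cgamma (- gamma) n)
  (tau_ge0 : 0 <= tau)
  (A0 : 'M[R]_d) (A0_posdef : posdef A0)
  (G_diff2 : forall h, twice_differentiable G h)
  (G_cont2 : continuous (hessian G))
  (H_posdef : posdef H)
  (hessG_bounded : exists2 L : R, 0 < L & forall h, normop (hessian G h) <= L)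
  (hessG_lipschitz : exists r Lr : R, [/\ 0 < r, 0 < Lr &
     forall h : 'cV[R]_d, normF (h - theta) < r ->
       normop (hessian G h - hessian G theta) <= Lr * normF (theta - h)])
  (q_gt2 : 2 < q)
  (hessg_moment : forall h,
     ('E_P[fun w => (normF (hessg (X w) h) `^ q)%R] <= Cq%:E)%E)
  (beta_gt : (1 - gamma) / (q - 1) < beta) (beta_lt : beta < gamma - 1 / 2)
  (a_gt0 : 0 < a)
  (thetah_rate : forall delta : R, 0 < delta -> {ae P, forall w,
     (fun n => normF (thetah n w - theta) ^+ 2 : R^o) =o_\oo
     (fun n => ln n%:R `^ (1 + delta) / n%:R `^ a : R^o)}) :
  let A n w := inv_hessian_est (power_seq cgamma (- gamma))
    (power_seq cbeta beta) (power_seq cbeta' beta') hessg A0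
    (fun k => Xs k w) (fun k => Z k w) (fun k => thetah k w) n in
  let Atau n w := weighted_average tau (fun k => A k w) n in
  forall delta : R, 0 < delta ->
  {ae P, forall w,
     (fun n => normF (A n w - invmx H) ^+ 2 : R^o) =o_\oo
     (fun n => ln n%:R `^ (1 + delta) /
       n%:R `^ Num.min gamma (Num.min a (2 * beta * (q - 1))) : R^o)} /\
  {ae P, forall w,
     (fun n => normF (Atau n w - invmx H) ^+ 2 : R^o) =o_\oo
     (fun n => ln n%:R `^ (1 + delta) /
       n%:R `^ Num.min 1 (Num.min a (2 * beta * (q - 1))) : R^o)}.
Proof.
move=> A Atau delta delta_gt0.
have q1 : 0 < q - 1 by move: q_gt2; lra.
have beta_gt0 : 0 < beta.
  by apply: lt_trans beta_gt; rewrite divr_gt0//; move: gamma_lt1; lra.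
have beta'_gt0 : 0 < beta' by move: beta'_gt gamma_lt1; lra.
have [lam lam_gt0 coercive] := posdef_coercive H_posdef.
have [r0 [Lr [r0_gt0 Lr_gt0 lip]]] := hessG_lipschitz.
set gam := power_seq cgamma (- gamma) in A Atau *.
set bet := power_seq cbeta beta in A Atau *.
set bet' := power_seq cbeta' beta' in A Atau *.
have gam_gt0 n : 0 < gam n.+1 by exact: power_seq_gt0.
have bet_gt0 n : 0 < bet n.+1 by exact: power_seq_gt0.
have bet'_gt0 n : 0 < bet' n.+1 by exact: power_seq_gt0.
have bet'_infty (x : R) : \forall n \near \oo, x <= bet' n.+1.
  apply: (nbhs_infty_succ (Q := fun n => x <= bet' n)).
  apply: filterS (near_powRn_ge (x / cbeta') beta'_gt0) => n.
  by rewrite ler_pdivrMr// mulrC.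
have A0_sym : A0^T = A0 by case: A0_posdef.
have C0 : 0 <= raw_const M q Cq := raw_const_ge0 M hessg_moment.
have K2_ge0 : 0 <= 1 + raw_const M q Cq by rewrite addr_ge0.
pose EW := trunc_mx hessg Xs Z bet.
pose Ek := keep_prob hessg Xs Z bet.
pose dd : R := (d * d)%:R.
have dd0 : 0 <= dd by [].
have mean := @fresh_mean _ _ _ _ _ _ _ _ hessg_meas _ _ _ Xs_law Z_bounded _ _ q_gt2
  hessg_moment _ bet_gt0.
have Ek_bias n h : `|Ek n h - 1| <= raw_const M q Cq * bet n.+1 `^ (- q).
  have /andP[h1 h2] :=
    keep_prob_bias hessg_meas Xs_law Z_bounded q_gt2 hessg_moment bet_gt0 n h.
  by rewrite distrC ger0_norm.
(* The truncation bias at [h], plus the variation of the Hessian of G between [theta] and [h]. The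
   factors [dd] convert entrywise and operator bounds into Frobenius bounds. *)
have EW_bias n h : normF (h - theta) < r0 -> normF (EW n h - H) <=
    dd * (raw_const M q Cq * bet n.+1 `^ (- (q - 1))) + dd * Lr * normF (h - theta).
  move=> hr.
  have -> : EW n h - H = (EW n h - hessian G h) + (hessian G h - hessian G theta).
    by rewrite addrA subrK HE.
  apply: normFD.
    apply: normF_le_entries => i j.
    have -> (A1 B1 : 'M[R]_d) : (A1 - B1) i j = A1 i j - B1 i j by rewrite !mxE.
    rewrite opprB; exact: (trunc_mx_bias hessg_meas hessg_int hessGE Xs_law XZ_indep Z_bounded
      Z_cov q_gt2 hessg_moment bet_gt0 n h i j).
  apply: le_trans (normF_normop _) _; rewrite -mulrA ler_wpM2l// -normFB.
  exact: lip.
have bet1 := power_seq_powRN_dominated cbeta_gt0 (ltW beta_gt0) (ltW q1).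
have betq := power_seq_powRN_dominated cbeta_gt0 (ltW beta_gt0)
  (ltW (lt_trans (ltr0Sn _ 1) q_gt2)).
have bq_gt0 : 0 < beta * (q - 1) by exact: mulr_gt0.
have bqq_gt0 : 0 < beta * q by apply: mulr_gt0 => //; move: q_gt2; lra.
have d2 : 0 < delta / 2 by exact: divr_gt0.
(* [thetah_rate] is used with delta/2, and halved because norms are not squared; the other half of
   [delta] is spent at the end to pass from O to o. *)
set pl := (1 + delta / 2) / 2.
have pl_ge : 1 / 2 <= pl by rewrite /pl; lra.
have pl0 : 0 <= pl by rewrite /pl; lra.
have thetah_dom : {ae P, forall w,
    dominated (fun n => normF (thetah n w - theta)) (rate (a / 2) pl)}.
  have := thetah_rate _ d2; apply: filterS => w.
  by apply: dominated_of_littleo => n; exact: normF_ge0.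
have a2 : 0 < a / 2 by exact: divr_gt0.
have thetah_near r : 0 < r -> {ae P, forall w, \forall n \near \oo,
    normF (thetah n w - theta) <= r}.
  move=> rp; apply: filterS thetah_dom => w.
  exact: dominated_rate_near_le.
pose kK := 1 + normF (invmx H).
have kK0 : 0 <= kK by rewrite addr_ge0// normF_ge0.
pose D := dd * Lr * kK.
have D0 : 0 <= D by rewrite !mulr_ge0// ltW.
(* The Lipschitz term is to cost at most [lam / 2], each of the two truncation biases eventually at
   most [lam / 4]. Halving [r0] gives the strict inequality asked for by [hessG_lipschitz]. *)
pose r := Num.min (r0 / 2) (lam / 2 / (D + 1)).
have D1 : 0 < D + 1 by rewrite ltr_wpDl.
have r_gt0 : 0 < r by rewrite lt_min !divr_gt0.
have rr0 : r < r0.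
  by rewrite gt_min ltr_pdivrMr// ltr_pMr// ltr1n.
have Dr : D * r <= lam / 2.
  apply: (@le_trans _ _ ((D + 1) * (lam / 2 / (D + 1)))); last first.
    by rewrite mulrCA divff ?mulr1// gt_eqF.
  by apply: ler_pM => //; rewrite ?(ltW r_gt0) ?lerDl// ge_min lexx orbT.
have small_bias : \forall n \near \oo, forall h, normF (h - theta) <= r ->
    normF (EW n h - H) * (1 + normF (invmx H)) + `|Ek n h - 1| * (d * d)%:R <= lam.
  have e1 : dominated (fun n => dd * (raw_const M q Cq * bet n.+1 `^ (- (q - 1))) * kK)
      (rate (beta * (q - 1)) 0).
    have := dominated_scale (mulr_ge0 (mulr_ge0 dd0 C0) kK0) bet1.
    by apply: dominated_le; near=> n; rewrite le_eqVlt; apply/orP; left; apply/eqP; ring.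
  have e2 : dominated (fun n => raw_const M q Cq * bet n.+1 `^ (- q) * dd)
      (rate (beta * q) 0).
    have := dominated_scale (mulr_ge0 dd0 C0) betq.
    by apply: dominated_le; near=> n; rewrite le_eqVlt; apply/orP; left; apply/eqP; ring.
  have l4 : 0 < lam / 4 by exact: divr_gt0.
  have := dominated_rate_near_le (lexx 0) bqq_gt0 l4 e2.
  apply: filterS2 (dominated_rate_near_le (lexx 0) bq_gt0 l4 e1) => n h1 h2 h hr.
  have b1 := ler_wpM2r kK0 (EW_bias n h (le_lt_trans hr rr0)).
  have b2 := ler_wpM2r dd0 (Ek_bias n h).
  have b3 : dd * Lr * normF (h - theta) * kK <= D * r.
    rewrite [dd * Lr * _ * _]mulrAC; exact: ler_wpM2l.
  apply: le_trans (lerD b1 b2) _; rewrite mulrDl.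
  apply: le_trans (lerD (lerD h1 (le_trans b3 Dr)) h2) _.
  by rewrite le_eqVlt; apply/orP; left; apply/eqP; field.
have est_bnd := est_bounded hessg_meas Xs_iid Z_iid XZ_indep thetah_adapted gam_gt0
  bet'_gt0 A0_sym K2_ge0 mean H_posdef coercive gamma_gt (erefl gam) bet'_infty
  small_bias (thetah_near _ r_gt0).
(* Exponents of squared errors: the first is that of [thetah], the second is twice the exponent of
   the truncation bias bet^(1-q). *)
pose sig := Num.min a (2 * beta * (q - 1)).
have sig_gt0 : 0 < sig by rewrite lt_min a_gt0 -mulrA mulr_gt0.
have mean_rate : {ae P, forall w,
    dominated (fun n => normF (EW n (thetah n w) - H)) (rate (sig / 2) pl) /\
    dominated (fun n => `|Ek n (thetah n w) - 1|) (rate (sig / 2) pl)}.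
  have sa : sig / 2 <= a / 2 by rewrite ler_pM2r ?invr_gt0// ge_min lexx.
  have sb : sig / 2 <= beta * (q - 1).
    by rewrite ler_pdivrMr// mulrC mulrA ge_min lexx orbT.
  have sbq : sig / 2 <= beta * q.
    by apply: le_trans sb _; rewrite ler_wpM2l ?(ltW beta_gt0)//; lra.
  have t1 := dominated_trans bet1 (dominated_near (rate_mono sb pl0)).
  have t2 := dominated_trans betq (dominated_near (rate_mono sbq pl0)).
  have r2 : 0 < r0 / 2 by exact: divr_gt0.
  apply: filterS2 thetah_dom (thetah_near _ r2) => w tw tn; split; last first.
    by apply: dominated_le (dominated_scale C0 t2); near=> n; exact: Ek_bias.
  have u1 := dominated_scale (mulr_ge0 dd0 C0) t1.
  have u2 := dominated_scale (mulr_ge0 dd0 (ltW Lr_gt0))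
    (dominated_trans tw (dominated_near (rate_mono sa (lexx pl)))).
  apply: dominated_le (dominated_add u1 u2); apply: filterS tn => n hn.
  apply: le_trans (EW_bias _ _ (le_lt_trans hn _)) _; last by rewrite mulrA.
  by rewrite ltr_pdivrMr// ltr_pMr// ltr1n.
have EW_bd n h : normF (EW n h) <= (d * d)%:R * (2 + raw_const M q Cq) :=
  trunc_mx_bounded hessg_meas Xs_law Z_bounded q_gt2 hessg_moment bet_gt0 n h.
have Ek01 n h : 0 <= Ek n h <= 1 :=
  keep_prob01 hessg_meas Xs_law Z_bounded q_gt2 hessg_moment bet_gt0 n h.
have rates := est_rates hessg_meas Xs_iid Z_iid XZ_indep thetah_adapted gam_gt0 bet_gt0
  bet'_gt0 A0_sym K2_ge0 mean H_posdef lam_gt0 coercive cgamma_gt0 gamma_gt gamma_lt1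
  (erefl gam) bet'_infty cbeta_gt0 beta_gt0 beta_lt (erefl bet)
  (fun n => gamma_beta n.+1 (ltn0Sn n)) EW_bd Ek01
  (trunc_mx_measurable hessg_meas Xs Z bet_gt0)
  (keep_prob_measurable hessg_meas Xs Z bet)
  sig_gt0 pl_ge est_bnd mean_rate.
split; apply: filterS rates => w [r1 r2]; apply: littleo_of_dominated => //.
- by move=> n; exact: normF_ge0.
- by move=> n; exact: normF_ge0.
apply: weighted_average_rate r2 => //.
  by rewrite divr_ge0// le_min ler01 ltW.
by rewrite ltr_pdivrMr// mul1r gt_min ltr1n.
Unshelve. all: by end_near. Qed.
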